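(* Let $g_t$ be the hypoelliptic Brownian motion on $\mathbb{H}$ and $g^\ast_1=\max_{0\le s\le 1}|g_s|$. Then the limit \[ \lim_{\varepsilon\to0}-\varepsilon^2\log\mathbb{P}\left(g^{\ast}_1<\varepsilon\right) \] exists and equals $c^2$, where $c\in(0,\infty)$ is the almost sure constant value of $\liminf_{t\to\infty}\sqrt{\frac{\log\log t}{t}}\,\max_{0\le s\le t}|g_s|$.
   Context: The Heisenberg group $\mathbb{H}$ is $\mathbb{R}^2\times\mathbb{R}$ with multiplication $(\mathbf{v}_1,z_1)\cdot(\mathbf{v}_2,z_2)=(\mathbf{v}_1+\mathbf{v}_2,\ z_1+z_2+\tfrac12\omega(\mathbf{v}_1,\mathbf{v}_2))$, where $\omega((x_1,y_1),(x_2,y_2))=x_1y_2-x_2y_1$. The homogeneous norm on $\mathbb{H}$ is $|(\mathbf{x},z)|:=\left(\|\mathbf{x}\|_{\mathbb{R}^2}^4+z^2\right)^{1/4}$. Let $\bm{W}_t=(W_1(t),W_2(t))$ be a standard two-dimensional Brownian motion. The hypoelliptic Brownian motion on $\mathbb{H}$ is $g_t:=(\bm{W}_t,A_t)$ with $A_t:=\frac12\int_0^t (W_1(s)\,dW_2(s)-W_2(s)\,dW_1(s))$ (Lévy's stochastic area, Itô integral). *)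

(* Defs.v *)
From HB Require Import structures.
From mathcomp Require Import all_boot all_order all_algebra.
From mathcomp Require Import all_classical all_reals all_analysis.
From mathcomp Require Import normal_distribution.
Set Implicit Arguments. Unset Strict Implicit. Unset Printing Implicit Defensive.
Import Order.TTheory GRing.Theory Num.Def Num.Theory.
Import numFieldNormedType.Exports.
Local Open Scope classical_set_scope.
Local Open Scope ring_scope.

Section Heisenberg.
Context {R : realType} {d : measure_display} {T : measurableType d}.
Variable P : probability T R.

Definition std_BM2 (W1 W2 : R -> T -> R) : Prop :=
  [/\ forall t, measurable_fun setT (W1 t) /\ measurable_fun setT (W2 t),
      forall w, W1 0 w = 0 /\ W2 0 w = 0,
      forall w, {within `[0, +oo[, continuous (fun t => W1 t w)} /\
                {within `[0, +oo[, continuous (fun t => W2 t w)} &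
      forall (n : nat) (t : nat -> R) (B C : nat -> set R),
        0 <= t 0%N ->
        (forall i, (i < n)%N -> t i < t i.+1) ->
        (forall i, measurable (B i)) -> (forall i, measurable (C i)) ->
        P (\bigcap_(i in `I_n)
             ([set w | B i (W1 (t i.+1) w - W1 (t i) w)] `&`
              [set w | C i (W2 (t i.+1) w - W2 (t i) w)])) =
        \big[*%E/1%E]_(i < n)
           (normal_prob 0 (Num.sqrt (t i.+1 - t i)) (B i) *
            normal_prob 0 (Num.sqrt (t i.+1 - t i)) (C i))%E].

(** Left-point (Ito) Riemann sum of Levy's area
    (1/2) int_0^t (W1 dW2 - W2 dW1) along the dyadic partition of [0,t]
    with 2^n intervals. *)
Definition levy_area_sum (W1 W2 : R -> T -> R) (n : nat) (t : R) (w : T) : R :=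
  2^-1 * \sum_(k < 2 ^ n)
    (let a := t * k%:R / (2 ^ n)%:R in
     let b := t * k.+1%:R / (2 ^ n)%:R in
     W1 a w * (W2 b w - W2 a w) - W2 a w * (W1 b w - W1 a w)).

(** A is (a continuous version of) Levy's stochastic area of (W1,W2):
    its paths are continuous on [0,+oo) and for every t >= 0, A t is the
    limit in probability of the Ito Riemann sums above, i.e. A t is the Ito
    integral (1/2) int_0^t (W1 dW2 - W2 dW1). *)
Definition is_levy_area (W1 W2 A : R -> T -> R) : Prop :=
  (forall t, measurable_fun setT (A t)) /\
  (forall w, {within `[0, +oo[, continuous (fun t => A t w)}) /\
  (forall t, 0 <= t -> forall delta, 0 < delta ->
     (fun n => P [set w | delta < `|levy_area_sum W1 W2 n t w - A t w|])
       @ \oo --> 0%E).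

End Heisenberg.

Definition hnorm {R : realType} (x y z : R) : R :=
  Num.sqrt (Num.sqrt ((x ^+ 2 + y ^+ 2) ^+ 2 + z ^+ 2)).

Definition gstar {R : realType} {T : Type} (W1 W2 A : R -> T -> R)
  (t : R) (w : T) : R :=
  sup [set hnorm (W1 s w) (W2 s w) (A s w) | s in `[0, t]].

Definition liminf_pinfty {R : realType} (f : R -> R) : \bar R :=
  ereal_sup [set ereal_inf [set (f t)%:E | t in `]M, +oo[] | M in [set: R]].

(* Main.v *)
Require Import Defs.
From HB Require Import structures.
From mathcomp Require Import all_boot all_order all_algebra.
From mathcomp Require Import all_classical all_reals all_analysis.
From mathcomp Require Import normal_distribution measurable_realfun.
From mathcomp Require Import ring lra.
Set Implicit Arguments.
Unset Strict Implicit.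
Unset Printing Implicit Defensive.
Import Order.TTheory GRing.Theory Num.Def Num.Theory.
Import numFieldNormedType.Exports.
Local Open Scope classical_set_scope.
Local Open Scope ring_scope.

(** Sampling [(W1, W2, A)] at all dyadic times gives a random path whose law is
    determined by the Gaussian increments, hence satisfies the Markov property for left
    translations of the Heisenberg group.  The supremum, over starting points in a ball,
    of the probability of staying in that ball up to time [n] is submultiplicative in
    [n], so it decays at an exponential rate by Fekete's lemma.  Steering the path with
    a bounded probabilistic cost compares it with the path started at the identity, and
    Brownian scaling turns this into
      [P(gstar t < e) = exp(- (L + o(1)) * t / e^2)] as [t / e^2 -> oo],
    for some [L > 0]; at [t = 1] this is the limit, with [c = sqrt L].
    For the liminf, the lower bound is Borel-Cantelli along a geometric sequence of times.
    The upper bound uses the times [t_k = (k!)^4]: the increments over [[t_k, t_(k+1)]]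
    are independent, stay small with probability at least [1 / (k + 2)], and dominate the
    path up to [t_k]. *)

(** The hypothesis on [A] only provides limits in probability of Riemann sums along partitions that
    depend on [t], so no Markov property is available at the outset. It is proved for a walk on one
    dyadic grid shared by all times, where the area recursion is exactly group multiplication, and
    then passed to the limit. The main obstacle is that the distance given by the norm is invariant
    under left translations only: moving the starting point from [v] to [v k] displaces a later
    position [v g] by the conjugate [g^-1 k g], whose norm can be of order [sqrt (|k| |g|)]. The
    argument therefore works at unit time scale with balls of large radius: a radius large compared
    with [|k|] absorbs the displacement at the price of a factor [1 + delta]. Steering costs a
    constant factor and a bounded delay, which leave the exponential rate unchanged. Steering itself
    rests on symmetry: at time 1 all eight sign patterns of the three coordinates are equally
    likely, and from a far point a step with suitable signs lowers the fourth power of the norm. *)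

Definition pushm d1 d2 (T1 : measurableType d1) (T2 : measurableType d2)
    (R : realType) (m : {measure set T1 -> \bar R}) (f : T1 -> T2)
    (mf : measurable_fun [set: T1] f) : {measure set T2 -> \bar R} :=
  measure_function_pushforward__canonical__measure_function_Measure m mf.
Arguments pushm {d1 d2 T1 T2 R} m [f] mf.

(** * Gaussian laws on the line: scaling, symmetry, positivity, moments *)

Section gaussian.
Import HBNNSimple.
Context {R : realType}.
Local Notation mu := (@lebesgue_measure R).
Implicit Types (s c a : R) (B : set R).

(** Lebesgue measure is determined by its values on half-open intervals, and [c] times its image
    under multiplication by [c] has the same values there. *)
Lemma lebesgue_measureZ c (A : set R) : 0 < c -> measurable A ->
  mu ((fun x : measurableTypeR R => c * x : measurableTypeR R) @^-1` A)
  = (c^-1%:E * mu A)%E.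
Proof.
move=> c0 mA.
have c0' : 0 <= c by exact: ltW.
have mc : measurable_fun [set: measurableTypeR R]
    (fun x : measurableTypeR R => c * x : measurableTypeR R).
  by apply: measurable_funM.
pose nu := mscale (NngNum c0') (pushm mu mc).
have -> : mu A = nu A.
  apply: (@lebesgue_measure_unique R nu) => // _ [[a b]] _ <-.
  rewrite /nu/= /mscale/= /pushforward.
  have -> : (fun x : measurableTypeR R => c * x : measurableTypeR R) @^-1` `]a, b]
     = `]a / c, b / c]%classic.
    by apply/seteqP; split => x /=; rewrite !in_itv/= ltr_pdivrMr// ler_pdivlMr// mulrC.
  rewrite !lebesgue_measure_itv/= !lte_fin ltr_pM2r ?invr_gt0//.
  case: ifPn => _; last by rewrite mule0.
  by rewrite -!EFinD -EFinM -mulrBl mulrCA divff ?mulr1// gt_eqF.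
by rewrite /nu /mscale/= /pushforward muleA -EFinM mulVf ?mul1e// gt_eqF.
Qed.

(** For a simple function this is the definition of [normal_prob] through its density; monotone
    convergence extends it to nonnegative [f]. *)
Lemma ge0_integral_normal_prob s (f : R -> \bar R) :
  measurable_fun [set: R] f -> (forall x, 0 <= f x)%E ->
  (\int[normal_prob 0%R s]_x f x =
   \int[mu]_x (f x * (normal_pdf 0 s x)%:E))%E.
Proof.
move=> mf f0.
have mpdf : measurable_fun [set: R] (fun x => (normal_pdf 0 s x)%:E).
  by apply/measurable_EFinP; exact: measurable_normal_pdf.
pose f_ := nnsfun_approx measurableT mf.
transitivity (limn (fun n => \int[normal_prob 0%R s]_x (f_ n x)%:E))%E.
  rewrite -monotone_convergence//.
  - apply: eq_integral => y _; apply/esym/cvg_lim => //.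
    by apply: cvg_nnsfun_approx.
  - by move=> n; apply/measurable_EFinP; exact: (measurable_funP (f_ n)).
  - by move=> n y _; rewrite lee_fin.
  - by move=> y _ m n mn; rewrite lee_fin; exact/(@lefP _ _ R)/(nd_nnsfun_approx measurableT mf).
transitivity (limn (fun n => \int[mu]_x ((f_ n x)%:E * (normal_pdf 0 s x)%:E)))%E; last first.
  rewrite -monotone_convergence//.
  - apply: eq_integral => y _; apply/cvg_lim => //.
    apply: cvgeZr => //.
    by apply: cvg_nnsfun_approx.
  - by move=> n; apply: emeasurable_funM => //; apply/measurable_EFinP; exact: (measurable_funP (f_ n)).
  - by move=> n y _; rewrite mule_ge0// lee_fin// normal_pdf_ge0.
  - move=> y _ m n mn; apply: lee_wpmul2r; first by rewrite lee_fin normal_pdf_ge0.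
    by rewrite lee_fin; exact/(@lefP _ _ R)/(nd_nnsfun_approx measurableT mf).
congr (limn _); apply/funext => n.
have mfk y : measurable (f_ n @^-1` [set y]) by exact: measurable_sfunP.
transitivity (\sum_(k \in range (f_ n)) (k%:E * normal_prob 0%R s (f_ n @^-1` [set k])))%E.
  under eq_integral do rewrite fimfunE -fsumEFin//.
  rewrite ge0_integral_fsum//; last 2 first.
  - move=> y; apply/measurable_EFinP; apply: measurable_funM => //; apply: measurable_indic; exact: mfk.
  - by move=> y x _; rewrite nnfun_muleindic_ge0.
  apply: eq_fsbigr => r _.
  under eq_integral do rewrite EFinM.
  have [r0|r0] := ltP r 0.
    rewrite preimage_nnfun0// measure0 mule0 indic0.
    by under eq_integral do rewrite mule0; rewrite integral0.
  rewrite ge0_integralZl//; last first.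
    by apply/measurable_EFinP; apply: measurable_indic; exact: mfk.
  by rewrite integral_indic//= ?setIT//; exact: mfk.
under [RHS]eq_integral => x _.
  rewrite fimfunE -fsumEFin// ge0_mule_fsuml; last first.
    by move=> r; exact: nnfun_muleindic_ge0.
  over.
rewrite ge0_integral_fsum//; last 2 first.
- move=> r; apply: emeasurable_funM => //.
  apply/measurable_EFinP; apply: measurable_funM => //.
  by apply: measurable_indic; exact: mfk.
- by move=> r x _; rewrite mule_ge0// ?nnfun_muleindic_ge0// lee_fin normal_pdf_ge0.
apply: eq_fsbigr => r _.
under eq_integral do rewrite EFinM -muleA.
have [r0|r0] := ltP r 0.
  rewrite preimage_nnfun0// measure0 mule0 indic0.
  by under eq_integral do rewrite mul0e mule0; rewrite integral0.
rewrite ge0_integralZl//; last 2 first.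
- by apply: emeasurable_funM => //; apply/measurable_EFinP; apply: measurable_indic; exact: mfk.
- by move=> x _; rewrite mule_ge0// lee_fin// normal_pdf_ge0.
congr (_ * _)%E; rewrite /normal_prob [LHS]integral_mkcond.
apply: eq_integral => x _; rewrite patchE indicE.
by case: ifPn => _; rewrite ?mul1e ?mul0e.
Qed.

Lemma normal_probZ s c B : 0 < s -> 0 < c -> measurable B ->
  normal_prob 0 (c * s) B = normal_prob 0 s [set x | B (c * x)].
Proof.
move=> s0 c0 mB; rewrite /normal_prob.
have c0' : 0 <= c by exact: ltW.
have mc : measurable_fun [set: measurableTypeR R]
    (fun x : measurableTypeR R => c * x : measurableTypeR R).
  by apply: measurable_funM.
pose phi := fun x : measurableTypeR R => c * x : measurableTypeR R.
rewrite (_ : [set x | B (c * x)] = phi @^-1` B)//.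
(* [g] is the density at scale [c * s] times the Jacobian [c], so that [g (c * x)] is the density at
   scale [s]. *)
pose g y := (c%:E * (normal_pdf 0 (c * s) y)%:E)%E.
have -> : (\int[mu]_(x in phi @^-1` B) (normal_pdf 0 s x)%:E =
    \int[mu]_(x in phi @^-1` B) (g \o phi) x)%E.
  apply: eq_integral => x _; rewrite /g /= -EFinM; congr EFin.
  rewrite !normal_pdfE ?mulf_neq0 ?gt_eqF// /normal_peak /normal_fun /= !subr0 mulrA; congr (_ * _).
    rewrite [X in _ = _ * (Num.sqrt X)^-1](_ : _ = c ^+ 2 * (s ^+ 2 * pi *+ 2)); last by ring.
    by rewrite sqrtrM ?sqr_ge0// sqrtr_sqr gtr0_norm// invfM mulrA mulfV ?mul1r// gt_eqF.
  have sn : s != 0 by rewrite gt_eqF.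
  have cn : c != 0 by rewrite gt_eqF.
  congr expR; rewrite /phi; field.
  by rewrite sn cn.
have mpdf r : measurable_fun [set: R] (fun x => (normal_pdf 0 r x)%:E).
  by apply/measurable_EFinP; exact: measurable_normal_pdf.
transitivity (\int[pushm mu mc]_(y in B) g y)%E; last first.
  apply: ge0_integral_pushforward => //.
    by apply: emeasurable_funM => //; exact: measurable_funTS (mpdf _).
  by move=> y _; rewrite mule_ge0// lee_fin ?normal_pdf_ge0.
rewrite ge0_integralZl//=; last 2 first.
- exact: measurable_funTS (mpdf _).
- by move=> y _; rewrite lee_fin normal_pdf_ge0.
rewrite -(ge0_integral_mscale (pushm mu mc) mB (NngNum c0'))//=; last 2 first.
- exact: measurable_funTS (mpdf _).
- by move=> y _; rewrite lee_fin normal_pdf_ge0.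
apply: eq_measure_integral => A mA _.
transitivity (c%:E * mu ((fun x : measurableTypeR R => (c * x)%R : measurableTypeR R) @^-1` A))%E => //.
rewrite (lebesgue_measureZ c0 mA) muleA -EFinM mulfV ?mul1e// gt_eqF//.
Qed.

Lemma normal_probN s B : 0 < s -> measurable B ->
  normal_prob 0 s B = normal_prob 0 s [set x | B (- x)].
Proof.
move=> s0 mB; rewrite /normal_prob.
rewrite (_ : [set x | B (- x)] = (-%R : _ -> measurableTypeR R) @^-1` B)//.
pose g y := (normal_pdf 0 s y)%:E.
have -> : (\int[mu]_(x in (-%R : _ -> measurableTypeR R) @^-1` B) (normal_pdf 0 s x)%:E =
    \int[mu]_(x in (-%R : _ -> measurableTypeR R) @^-1` B) (g \o -%R) x)%E.
  apply: eq_integral => x _; rewrite /g /=; congr EFin.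
  by rewrite !normal_pdfE ?gt_eqF// /normal_fun /= !subr0 sqrrN.
have mpdf r : measurable_fun [set: R] (fun x => (normal_pdf 0 r x)%:E).
  by apply/measurable_EFinP; exact: measurable_normal_pdf.
have mN : measurable_fun [set: measurableTypeR R] (-%R : _ -> measurableTypeR R) by [].
transitivity (\int[pushm mu mN]_(y in B) g y)%E; last first.
  apply: ge0_integral_pushforward => //; first exact: measurable_funTS (mpdf _).
  by move=> y _; rewrite lee_fin ?normal_pdf_ge0.
by apply: eq_measure_integral => A mA _; rewrite /pushm/= lebesgue_measureN.
Qed.

Lemma normal_prob_set1 s a : normal_prob 0 s [set a] = 0%E.
Proof.
have /null_content_dominatesP := @normal_prob_dominates R 0 s.
by apply => //; exact: lebesgue_measure_set1.
Qed.

Lemma normal_prob_gt0 s a : 0 < s -> (0 < normal_prob 0 s `]a, +oo[)%E.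
Proof.
(* [e] bounds the density from below on []a, a + 1]], whose points have absolute value at most
   [|a| + 1]. *)
move=> s0; pose e := normal_peak s * expR (- (`|a| + 1) ^+ 2 / (s ^+ 2 *+ 2)).
have e0 : 0 < e by rewrite mulr_gt0// ?expR_gt0// normal_peak_gt0// gt_eqF.
have mpdf : measurable_fun [set: R] (fun x => (normal_pdf 0 s x)%:E).
  by apply/measurable_EFinP; exact: measurable_normal_pdf.
apply: (@lt_le_trans _ _ (normal_prob 0 s `]a, a + 1])); last first.
  by apply: le_measure; rewrite ?inE// => x /=; rewrite !in_itv/= => /andP[->].
apply: (@lt_le_trans _ _ (\int[mu]_(x in `]a, (a + 1)%R]) e%:E)%E).
  by rewrite integral_cst//= lebesgue_measure_itv/= lte_fin ltrDl ltr01 -EFinD -EFinM lte_fin addrC addKr mulr1.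
apply: ge0_le_integral => //.
- by move=> x _; rewrite lee_fin ltW.
- exact: measurable_funTS (mpdf).
move=> x; rewrite /= in_itv/= => /andP[ax xa]; rewrite lee_fin normal_pdfE ?gt_eqF//.
rewrite /e ler_pM2l ?normal_peak_gt0 ?gt_eqF// /normal_fun ler_expR subr0.
rewrite !mulNr lerN2 ler_wpM2r ?invr_ge0 ?mulrn_wge0 ?sqr_ge0//.
rewrite -(real_normK (num_real x)) ler_sqr ?nnegrE ?addr_ge0//.
rewrite ler_norml; apply/andP; split.
  rewrite lerNl; have := ler_norm (- a); rewrite normrN; lra.
by have := ler_norm a; lra.
Qed.

Lemma normal_prob_lt0 s a : 0 < s -> (0 < normal_prob 0 s `]-oo, a[)%E.
Proof.
move=> s0; rewrite normal_probN//.
rewrite (_ : [set x | _] = `]-a, +oo[%classic); first exact: normal_prob_gt0.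
by apply/seteqP; split => x /=; rewrite !in_itv/= andbT ltrNl.
Qed.

Let expR_ub (x : R) : 0 <= x -> x * expR (- x) <= 1.
Proof.
move=> x0; rewrite expRN ler_pdivrMr ?expR_gt0// mul1r.
by apply: le_trans (expR_ge1Dx x); rewrite lerDr.
Qed.

Lemma normal_prob_sqr_fin : (\int[normal_prob 0%R 1%R]_x (x ^+ 2)%:E < +oo :> \bar R)%E.
Proof.
have s2 : 0 < Num.sqrt 2 :> R by rewrite sqrtr_gt0.
rewrite ge0_integral_normal_prob; last 2 first.
- by apply/measurable_EFinP; exact: measurable_funX.
- by move=> x; rewrite lee_fin sqr_ge0.
(* Since [y * expR (- y) <= 1] at [y = x ^+ 2 / 4], the integrand is at most
   [4 * normal_peak 1 * expR (- x ^+ 2 / 4)], which is [k] times the density of variance 2. *)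
pose k : R := 4 * (normal_peak 1 / normal_peak (Num.sqrt 2)).
have mpdf r : measurable_fun [set: R] (fun x => (normal_pdf 0 r x)%:E).
  by apply/measurable_EFinP; exact: measurable_normal_pdf.
apply: (@le_lt_trans _ _ (\int[mu]_x (k%:E * (normal_pdf 0 (Num.sqrt 2) x)%:E))%E).
  apply: ge0_le_integral => //.
  - by move=> x _; rewrite -EFinM lee_fin mulr_ge0 ?sqr_ge0 ?normal_pdf_ge0.
  - apply: emeasurable_funM; last exact: mpdf.
    by apply/measurable_EFinP; exact: measurable_funX.
  - by apply: emeasurable_funM; last exact: mpdf.
  move=> x _; rewrite -!EFinM lee_fin !normal_pdfE ?gt_eqF//.
  rewrite /k [X in _ <= X](_ : _ = normal_peak 1 * (4 * normal_fun 0 (Num.sqrt 2) x)); last first.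
    by field; rewrite gt_eqF// normal_peak_gt0// gt_eqF.
  rewrite mulrCA ler_wpM2l ?normal_peak_ge0// /normal_fun !subr0 sqr_sqrtr//.
  rewrite (_ : - x ^+ 2 / (1 ^+ 2 *+ 2) = - (x ^+ 2 / 4) - (x ^+ 2 / 4)); last by field.
  rewrite (_ : - x ^+ 2 / (2 *+ 2) = - (x ^+ 2 / 4)); last by field.
  rewrite expRD mulrA ler_wpM2r ?expR_ge0//.
  rewrite -[X in X * _ <= _](@divfK _ 4)// mulrAC -[leRHS]mul1r ler_wpM2r//.
  by apply: expR_ub; rewrite divr_ge0// sqr_ge0.
rewrite ge0_integralZl//; last 2 first.
- by move=> x _; rewrite lee_fin normal_pdf_ge0.
- by rewrite lee_fin mulr_ge0// divr_ge0 ?normal_peak_ge0.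
- by rewrite integral_normal_pdf mule1 ltry.
- exact: mpdf.
Qed.

(** Scaling reduces every [s] to [s = 1]; [m2] is the variance of the standard normal law. *)
Lemma normal_prob_sqr : exists m2 : R, 0 <= m2 /\ forall s, 0 < s ->
  (\int[normal_prob 0%R s]_x (x ^+ 2)%:E = (m2 * s ^+ 2)%:E)%E.
Proof.
have m0 : (0 <= \int[normal_prob 0%R 1%R]_x (x ^+ 2)%:E :> \bar R)%E.
  by apply: integral_ge0 => x _; rewrite lee_fin sqr_ge0.
exists (fine (\int[normal_prob 0%R 1%R]_x (x ^+ 2)%:E)%E); split; first exact: fine_ge0.
move=> s s0.
have msc : measurable_fun [set: measurableTypeR R]
    (fun x : measurableTypeR R => s * x : measurableTypeR R).
  by apply: measurable_funM.
have msq : measurable_fun [set: R] (fun x : R => (x ^+ 2)%:E).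
  by apply/measurable_EFinP; exact: measurable_funX.
transitivity (\int[pushm (normal_prob 0%R 1%R) msc]_x (x ^+ 2)%:E)%E.
  apply: eq_measure_integral => A mA _.
  by rewrite /pushm/= /pushforward -normal_probZ ?mulr1.
rewrite (ge0_integral_pushforward msc (normal_prob 0 1) measurableT)//=; last first.
  by move=> x _; rewrite lee_fin sqr_ge0.
rewrite preimage_setT.
under eq_integral do rewrite exprMn mulrC EFinM.
rewrite ge0_integralZr//; [|by move=> x _; rewrite lee_fin sqr_ge0|by rewrite lee_fin sqr_ge0].
by rewrite [RHS]EFinM fineK// ge0_fin_numE// normal_prob_sqr_fin.
Qed.

Lemma integrable_normal_prob_id s : 0 < s ->
  (normal_prob 0%R s).-integrable [set: R] (fun x => x%:E).
Proof.
move=> s0; have [m2 [m20 /(_ _ s0) Es]] := normal_prob_sqr.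
have msq : measurable_fun [set: R] (fun x : R => (x ^+ 2)%:E).
  by apply/measurable_EFinP; exact: measurable_funX.
apply: (@le_integrable _ (measurableTypeR R) _ (normal_prob 0 s) _ measurableT _ (fun x : measurableTypeR R => (1 + x ^+ 2)%:E)).
- by apply/measurable_EFinP.
- move=> x _; rewrite /= lee_fin [leRHS]ger0_norm ?addr_ge0 ?sqr_ge0//.
  have := sqr_ge0 (`|x| - 1); rewrite sqrrB1 real_normK ?num_real// => H.
  have := sqr_ge0 x; have := normr_ge0 x; move: H; set y := x ^+ 2; lra.
apply/integrableP; split.
  by apply/measurable_EFinP; apply: measurable_funD => //; exact: measurable_funX.
under eq_integral => x _.
  rewrite abse_EFin ger0_norm ?addr_ge0 ?sqr_ge0// EFinD. over.
rewrite ge0_integralD//=; last first.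
  by move=> x _; rewrite lee_fin sqr_ge0.
by rewrite Es integral_cst//= probability_setT mule1 -EFinD ltry.
Qed.

(** The law is symmetric, so the mean equals its own opposite; being finite, it vanishes. *)
Lemma normal_prob_mean s : 0 < s -> (\int[normal_prob 0%R s]_x x%:E = 0)%E.
Proof.
move=> s0; have ix := integrable_normal_prob_id s0.
have mN : measurable_fun [set: measurableTypeR R] (-%R : _ -> measurableTypeR R) by [].
have E : (\int[normal_prob 0%R s]_x x%:E = - \int[normal_prob 0%R s]_x x%:E)%E.
  rewrite [LHS](_ : _ = \int[pushm (normal_prob 0%R s) mN]_x x%:E)%E; last first.
    apply: eq_measure_integral => A mA _.
    by rewrite /pushm/= /pushforward -normal_probN.
  have iN : (normal_prob 0%R s).-integrable [set: R] (fun x => (- x)%:E).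
    rewrite (_ : (fun x => _) = (fun x => (- x%:E)%E)) //.
    exact: integrableN.
  rewrite (integral_pushforward mN) ?preimage_setT//=.
  - under eq_integral do rewrite EFinN.
    by rewrite integralN//; exact: integrable_add_def.
have Efin := integrable_fin_num measurableT ix.
move: E; rewrite -(fineK Efin) -EFinN => -[] E; congr EFin.
by lra.
Qed.
End gaussian.

(** * The product sigma-algebra on real paths over an arbitrary index type *)

Section path_space.
Context {R : realType} {I : Type}.

(** Finitely many one-sided closed constraints. Boxes form a pi-system that generates the product
    sigma-algebra, and a box is the decreasing intersection of its widenings, which is what limits
    in probability require. *)
Definition box (s : seq (I * R)) : set (I -> R) :=
  [set x | all (fun p => x p.1 <= p.2) s].

Definition boxes : set (set (I -> R)) := range box.

Definition pathT := g_sigma_algebraType boxes.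

HB.instance Definition _ := Measurable.on pathT.

Lemma boxI s s' : box s `&` box s' = box (s ++ s').
Proof. by apply/seteqP; split => x /=; rewrite /box/= all_cat => /andP. Qed.

Lemma setI_closed_boxes : setI_closed boxes.
Proof. by move=> _ _ [s _ <-] [s' _ <-]; exists (s ++ s') => //; rewrite boxI. Qed.

Lemma box_nil : box [::] = setT.
Proof. by apply/seteqP; split. Qed.

Lemma measurable_box s : measurable (box s : set pathT).
Proof. by apply: sub_sigma_algebra; exists s. Qed.

Lemma measurable_coord i : measurable_fun [set: pathT] (fun x : pathT => x i : R).
Proof.
apply: (@measurability _ _ pathT R setT _ (@RGenOInfty.G R)).
  exact: RGenOInfty.measurableE.
move=> _ [_ [c ->] <-]; rewrite setTI.
rewrite (_ : _ @^-1` _ = ~` box [:: (i, c)]); first by apply: measurableC; exact: measurable_box.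
apply/seteqP; split => x /=; rewrite in_itv/= andbT /box/= andbT leNgt.
  by move=> ->.
by move/negP; rewrite negbK.
Qed.

Lemma measurable_path d (T : measurableType d) (X : T -> pathT) :
  (forall i, measurable_fun setT (fun w => X w i : R)) -> measurable_fun setT X.
Proof.
move=> mX; apply: (@measurability _ _ T pathT setT X boxes) => //.
move=> _ [_ [s _ <-] <-]; rewrite setTI.
elim: s => [|[i c] s IH]; first by rewrite box_nil preimage_setT.
rewrite -cat1s -boxI preimage_setI; apply: measurableI => //.
rewrite (_ : _ @^-1` _ = (fun w => X w i : R) @^-1` `]-oo, c]).
  by rewrite -[X in measurable X]setTI; exact: mX.
by apply/seteqP; split => w /=; rewrite in_itv/= /box/= andbT.
Qed.

End path_space.
Arguments pathT : clear implicits.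

(** * Independence from a generating pi-system, and conditional bounds *)

Section product_law.
Context {R : realType} {d d1 d2} {T : measurableType d}
  {T1 : measurableType d1} {T2 : measurableType d2}.
Variable P : probability T R.

Lemma measurable_preim d' (S : measurableType d') (X : T -> S) A :
  measurable_fun setT X -> measurable A -> measurable (X @^-1` A).
Proof. by move=> mX mA; rewrite -[X in measurable X]setTI; exact: mX. Qed.

(** Uniqueness of finite measures that agree on a pi-system, applied to the law of [X] restricted to
    [E] and to [c] times the law of [X']. With [c] the probability of [E], it says that [X] is
    independent of [E] and distributed as [X']. *)
Lemma law_eq_gen d' (T' : measurableType d') (G : set (set T')) (X X' : T -> T') :
  @measurable _ T' = <<s G >> -> setI_closed G -> G setT ->
  measurable_fun setT X -> measurable_fun setT X' ->
  (forall E : set T, forall c : {nonneg R}, measurable E ->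
     (forall A, G A -> P (E `&` X @^-1` A) = (c%:num%:E * P (X' @^-1` A))%E) ->
   forall A, measurable A -> P (E `&` X @^-1` A) = (c%:num%:E * P (X' @^-1` A))%E).
Proof.
move=> mG IG GT mX mX' E c mE H A mA.
transitivity (pushm (mrestr P mE) mX A).
  by rewrite /pushm/= /pushforward /mrestr setIC.
apply: (@measure_unique _ R T' G (fun=> setT) mG IG (fun=> GT) _
  (pushm (mrestr P mE) mX) (mscale c (pushm P mX'))) => //.
- by rewrite bigcup_const.
- by move=> B GB; rewrite /mscale/= /pushforward /mrestr setIC H.
move=> _; rewrite /pushm/= /pushforward /mrestr preimage_setT setTI.
by apply: le_lt_trans (probability_le1 P mE) _; rewrite ltry.
Qed.

(** The two variables are extended from generators one at a time. Keeping [Y'] apart from [Y] lets a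
    single identity express that the future is independent of the past and that it has a prescribed
    law. *)
Lemma indep_gen (G1 : set (set T1)) (G2 : set (set T2))
    (X : T -> T1) (Y Y' : T -> T2) :
  @measurable _ T1 = <<s G1 >> -> setI_closed G1 -> G1 setT ->
  @measurable _ T2 = <<s G2 >> -> setI_closed G2 -> G2 setT ->
  measurable_fun setT X -> measurable_fun setT Y -> measurable_fun setT Y' ->
  (forall A B, G1 A -> G2 B ->
     P (X @^-1` A `&` Y @^-1` B) = P (X @^-1` A) * P (Y' @^-1` B))%E ->
  forall A B, measurable A -> measurable B ->
     P (X @^-1` A `&` Y @^-1` B) = (P (X @^-1` A) * P (Y' @^-1` B))%E.
Proof.
move=> mG1 IG1 G1T mG2 IG2 G2T mX mY mY' H.
have pnn E : measurable E -> exists c : {nonneg R}, P E = c%:num%:E.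
  move=> mE; have p0 : 0 <= fine (P E) by exact: fine_ge0.
  by exists (NngNum p0) => /=; rewrite fineK ?fin_num_measure.
have H1 A B : G1 A -> measurable B ->
    P (X @^-1` A `&` Y @^-1` B) = (P (X @^-1` A) * P (Y' @^-1` B))%E.
  move=> GA mB.
  have mXA : measurable (X @^-1` A).
    by apply: measurable_preim => //; rewrite mG1; exact: sub_sigma_algebra.
  have [c Ec] := pnn _ mXA; rewrite Ec.
  by apply: (law_eq_gen mG2) => // C GC; rewrite -Ec H.
move=> A B mA mB; rewrite setIC muleC.
have mYB : measurable (Y @^-1` B) by exact: measurable_preim.
have mYB' : measurable (Y' @^-1` B) by exact: measurable_preim.
have [c Ec] := pnn _ mYB'; rewrite Ec.
by apply: (law_eq_gen mG1) => // C GC; rewrite -Ec setIC H1 // muleC.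
Qed.

Definition mkRV d' (S : measurableType d') (X : T -> S)
    (mX : measurable_fun setT X) : {RV P >-> S} :=
  HB.pack X (isMeasurableFun.Build _ _ _ _ X mX).

Lemma indep_prod (X : T -> T1) (Y Y' : T -> T2) :
  measurable_fun setT X -> measurable_fun setT Y -> measurable_fun setT Y' ->
  (forall A B, measurable A -> measurable B ->
     P (X @^-1` A `&` Y @^-1` B) = P (X @^-1` A) * P (Y' @^-1` B))%E ->
  forall S : set (T1 * T2), measurable S ->
    P [set w | S (X w, Y w)] = (\int[P]_w P [set w' | S (X w, Y' w')])%E.
Proof.
move=> mX mY mY' H S mS.
have mXY : measurable_fun setT (fun w => (X w, Y w)).
  exact: measurable_fun_pair.
pose m1 := distribution P (mkRV mX); pose m2 := distribution P (mkRV mY').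
have -> : P [set w | S (X w, Y w)] = pushm P mXY S by [].
have Hr A B : measurable A -> measurable B -> pushm P mXY (A `*` B) = (m1 A * m2 B)%E.
  by move=> mA mB; rewrite [RHS](_ : _ = P (X @^-1` A) * P (Y' @^-1` B))%E// -H.
rewrite -(product_measure_unique Hr mS).
rewrite /product_measure1 [LHS](@ge0_integral_distribution _ _ _ _ _ P (mkRV mX))//=.
- apply: eq_integral => w _ /=; rewrite /m2 /distribution/= /pushforward.
  by congr (P _); apply/seteqP; split => w' /=; rewrite /xsection/= inE.
- exact: measurable_fun_xsection.
Qed.

(** Fubini with the past [X] frozen: a bound, uniform over [G], on the probability of [S] given [X]
    may be multiplied by the probability of [G]. This is the form in which the Markov property is
    used. *)
Lemma indep_prod_bounds (X : T -> T1) (Y Y' : T -> T2) (G : set T1) (S : set (T1 * T2)) :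
  measurable_fun setT X -> measurable_fun setT Y -> measurable_fun setT Y' ->
  (forall A B, measurable A -> measurable B ->
     P (X @^-1` A `&` Y @^-1` B) = P (X @^-1` A) * P (Y' @^-1` B))%E ->
  measurable G -> measurable S -> forall c : R, 0 <= c ->
  ((forall w, G (X w) -> P [set w' | S (X w, Y' w')] <= c%:E)%E ->
   P [set w | G (X w) /\ S (X w, Y w)] <= c%:E * P (X @^-1` G))%E /\
  ((forall w, G (X w) -> c%:E <= P [set w' | S (X w, Y' w')])%E ->
   c%:E * P (X @^-1` G) <= P [set w | G (X w) /\ S (X w, Y w)])%E.
Proof.
move=> mX mY mY' H mG mS c c0.
have mGS : measurable ((G `*` setT) `&` S) by apply: measurableI => //; exact: measurableX.
have mXY' : measurable_fun setT (fun z : T * T => (X z.1, Y' z.2)).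
  by apply: measurable_fun_pair; apply: measurableT_comp.
have mint : measurable_fun setT (fun w => P [set w' | ((G `*` setT) `&` S) (X w, Y' w')]).
  rewrite (_ : (fun w => _) = P \o xsection ((fun z : T * T => (X z.1, Y' z.2)) @^-1` ((G `*` setT) `&` S))).
    apply: measurable_fun_xsection; rewrite -[X in measurable X]setTI; exact: mXY'.
  by apply/funext => w /=; congr (P _); apply/seteqP; split => w' /=; rewrite /xsection/= inE.
have mXG : measurable (X @^-1` G) by exact: measurable_preim.
have E : P [set w | G (X w) /\ S (X w, Y w)] =
    (\int[P]_w P [set w' | ((G `*` setT) `&` S) (X w, Y' w')])%E.
  rewrite -(indep_prod mX mY mY' H mGS); congr (P _).
  by apply/seteqP; split => w /= [] // [].
have cE : (c%:E * P (X @^-1` G) = \int[P]_w (c%:E * (\1_(X @^-1` G) w)%:E))%E.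
  rewrite ge0_integralZl//; last by apply/measurable_EFinP; exact: measurable_indic.
  by rewrite integral_indic// setIT.
have mc : measurable_fun setT (fun w => (c%:E * (\1_(X @^-1` G) w)%:E)%E : \bar R).
  by apply: emeasurable_funM => //; apply/measurable_EFinP; exact: measurable_indic.
have Gcase w : ~ G (X w) -> P [set w' | ((G `*` setT) `&` S) (X w, Y' w')] = 0%E.
  by move=> nG; rewrite (_ : [set w' | _] = set0) ?measure0// -subset0 => w' [[/=]].
have Gcase' w : G (X w) -> [set w' | ((G `*` setT) `&` S) (X w, Y' w')] =
    [set w' | S (X w, Y' w')].
  by move=> Gw; apply/seteqP; split => w' /=; [case|move=> ?; split].
rewrite E cE; split => Hc; apply: ge0_le_integral => //.
- move=> w _; rewrite indicE; have [Gw|nGw] := pselect (G (X w)).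
    by rewrite mem_set// mule1 Gcase' ?Hc.
  by rewrite memNset// mule0 Gcase.
- by move=> w _; rewrite mule_ge0// lee_fin.
- move=> w _; rewrite indicE; have [Gw|nGw] := pselect (G (X w)).
    by rewrite mem_set// mule1 Gcase' ?Hc.
  by rewrite memNset// mule0 Gcase.
Qed.

End product_law.

(** * Expectation of a product of independent variables *)

Section expectation_indep.
Context {R : realType} {d} {T : measurableType d}.
Variable P : probability T R.
Variables X Y : T -> R.
Hypotheses (mX : measurable_fun setT X) (mY : measurable_fun setT Y).
Hypothesis indXY : forall A B : set R, measurable A -> measurable B ->
     P (X @^-1` A `&` Y @^-1` B) = (P (X @^-1` A) * P (Y @^-1` B))%E.
Hypotheses (iX : P.-integrable setT (EFin \o X)) (iY : P.-integrable setT (EFin \o Y)).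

Let m1 := distribution P (mkRV P mX).
Let m2 := distribution P (mkRV P mY).
Let mXY : measurable_fun setT (fun w => (X w, Y w)).
Proof. exact: measurable_fun_pair. Qed.
Let f := (fun z : R * R => (z.1 * z.2)%:E : \bar R).
Let mf : measurable_fun setT f.
Proof. by apply/measurable_EFinP; apply: measurable_funM. Qed.

Let prodE S : measurable S -> pushm P mXY S = (m1 \x m2)%E S.
Proof.
have Hr A B : measurable A -> measurable B -> pushm P mXY (A `*` B) = (m1 A * m2 B)%E.
  by move=> mA mB; rewrite [RHS](_ : _ = P (X @^-1` A) * P (Y @^-1` B))%E// -indXY.
by move=> mS; rewrite -(product_measure_unique Hr mS).
Qed.

Let intabs (Z : T -> R) (mZ : measurable_fun setT Z) :
  P.-integrable setT (EFin \o Z) ->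
  (\int[distribution P (mkRV P mZ)]_x `|x%:E| = \int[P]_w `|(Z w)%:E|)%E.
Proof.
move=> iZ; rewrite ge0_integral_distribution//.
by apply/measurableT_comp => //; apply/measurable_EFinP.
Qed.

Let intid (Z : T -> R) (mZ : measurable_fun setT Z) :
  P.-integrable setT (EFin \o Z) ->
  (\int[distribution P (mkRV P mZ)]_x x%:E = \int[P]_w (Z w)%:E)%E.
Proof.
by move=> iZ; rewrite integral_distribution.
Qed.

Let iabs (Z : T -> R) : P.-integrable setT (EFin \o Z) -> (\int[P]_w `|(Z w)%:E| < +oo)%E.
Proof. by move/integrableP => []. Qed.

(** Tonelli on the product law; it supplies the integrability that Fubini requires in
    [integral_mul_indep]. *)
Let absf : (\int[m1]_x \int[m2]_y `|f (x, y)| = \int[P]_w `|(X w)%:E| * \int[P]_w `|(Y w)%:E|)%E.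
Proof.
transitivity (\int[m1]_x (`|x%:E| * \int[m2]_y `|y%:E|))%E.
  apply: eq_integral => x _; rewrite /f/=.
  under eq_integral do rewrite normrM EFinM.
  rewrite ge0_integralZl//.
  by apply/measurableT_comp => //; apply/measurable_EFinP.
rewrite ge0_integralZr//; last 2 first.
- by apply/measurableT_comp => //; apply/measurable_EFinP.
- by apply: integral_ge0.
by rewrite !intabs.
Qed.

Let absf_lty : (\int[m1]_x \int[m2]_y `|f (x, y)| < +oo)%E.
Proof.
rewrite absf lte_mul_pinfty//; last exact: iabs.
- by apply: integral_ge0.
- by rewrite ge0_fin_numE ?iabs//; apply: integral_ge0.
Qed.

Let if_ : (m1 \x m2)%E.-integrable setT f.
Proof. by apply/integrable12ltyP => //; exact: absf_lty. Qed.

Lemma integrable_mul_indep : P.-integrable setT (EFin \o (X \* Y)).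
Proof.
apply/integrableP; split.
  by apply/measurable_EFinP; exact: measurable_funM.
have -> : (\int[P]_w `|(EFin \o (X \* Y)%R) w| = \int[pushm P mXY]_z `|f z|)%E.
  rewrite (ge0_integral_pushforward mXY P measurableT)// ?preimage_setT//.
  exact: measurableT_comp.
rewrite (@eq_measure_integral _ _ _ _ (m1 \x m2)%E) => [|A mA _]; last exact: prodE.
by move/integrableP : if_ => [].
Qed.

Lemma integral_mul_indep :
  (\int[P]_w (X w * Y w)%:E = \int[P]_w (X w)%:E * \int[P]_w (Y w)%:E)%E.
Proof.
have -> : (\int[P]_w (X w * Y w)%:E = \int[pushm P mXY]_z f z)%E.
  rewrite (integral_pushforward mXY) ?preimage_setT//.
  exact: integrable_mul_indep.
rewrite (@eq_measure_integral _ _ _ _ (m1 \x m2)%E) => [|A mA _]; last exact: prodE.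
rewrite -(integral12_prod_meas1 if_) /fubini_F/= /f/=.
have iYd : m2.-integrable setT (fun y => y%:E).
  apply/integrableP; split; first exact/measurable_EFinP.
  by rewrite intabs// iabs.
have iXd : m1.-integrable setT (fun y => y%:E).
  apply/integrableP; split; first exact/measurable_EFinP.
  by rewrite intabs// iabs.
transitivity (\int[m1]_x (x%:E * \int[P]_w (Y w)%:E))%E.
  apply: eq_integral => x _; under eq_integral do rewrite EFinM.
  by rewrite integralZl// intid.
have Yfin : (\int[P]_w (Y w)%:E)%E \is a fin_num by exact: (integrable_fin_num measurableT iY).
by rewrite -(fineK Yfin) integralZr// intid.
Qed.

End expectation_indep.

(** * Passing product formulas on boxes to limits in probability *)

Section box_limit.
Context {R : realType} {d} {T : measurableType d}.
Variable P : probability T R.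

Definition cvg_in_prob (Xn : nat -> T -> R) (X : T -> R) :=
  forall e, 0 < e -> P [set w | e < `|Xn n w - X w|] @[n --> \oo] --> 0%E.

Definition widen_box (I : Type) (s : seq (I * R)) (e : R) :=
  [seq (p.1, p.2 + e) | p <- s].

Lemma Pr_le (A B : set T) : measurable A -> measurable B -> A `<=` B ->
  fine (P A) <= fine (P B).
Proof. by move=> mA mB AB; rewrite fine_le ?fin_num_measure// le_measure ?inE. Qed.

Lemma Pr_le1 (A : set T) : measurable A -> fine (P A) <= 1.
Proof.
by move=> mA; rewrite -lee_fin fineK ?fin_num_measure// probability_le1.
Qed.

Lemma Pr_ge0 (A : set T) : 0 <= fine (P A).
Proof. exact: fine_ge0. Qed.

Lemma Pr_leU (A B C : set T) : measurable A -> measurable B -> measurable C ->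
  A `<=` B `|` C -> fine (P A) <= fine (P B) + fine (P C).
Proof.
move=> mA mB mC ABC; rewrite -lee_fin EFinD !fineK ?fin_num_measure//.
apply: (le_trans (le_measure P _ _ ABC)); rewrite ?inE//; first exact: measurableU.
exact: measureU2.
Qed.

Section one.
Context {I : Type}.
Variables (Xn : nat -> T -> pathT R I) (X : T -> pathT R I).
Hypotheses (mXn : forall n, measurable_fun setT (Xn n)) (mX : measurable_fun setT X).
Hypothesis cX : forall i, cvg_in_prob (fun n w => Xn n w i) (fun w => X w i).

Let mbox (Z : T -> pathT R I) s : measurable_fun setT Z -> measurable (Z @^-1` box s).
Proof. by move=> mZ; apply: measurable_preim => //; exact: measurable_box. Qed.

Let mdev (e : R) n i : measurable [set w | e < `|Xn n w i - X w i|].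
Proof.
rewrite (_ : [set w | _] = (fun w => `|Xn n w i - X w i|) @^-1` `]e, +oo[); last first.
  by apply/seteqP; split => w /=; rewrite in_itv/= andbT.
rewrite -[X in measurable X]setTI.
have m1 : measurable_fun setT (fun w => `|Xn n w i - X w i|); last exact: m1.
apply: measurableT_comp => //; apply: measurable_funB.
  exact: (measurableT_comp (measurable_coord i) (mXn n)).
exact: (measurableT_comp (measurable_coord i) mX).
Qed.

(** Union bound over the finitely many coordinates constrained by [s]: a single small exceptional
    event serves them all. *)
Lemma dev_box s (e eta : R) : 0 < e -> 0 < eta -> \forall n \near \oo,
  exists E : set T, [/\ measurable E, fine (P E) <= eta &
    forall w, ~ E w -> all (fun p : I * R => `|Xn n w p.1 - X w p.1| <= e) s].
Proof.
move=> e0; elim: s eta => [|[i c] s IH] eta eta0.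
  by near=> n; exists set0; split; rewrite ?measure0//= ltW.
have eta2 : 0 < eta / 2 by rewrite divr_gt0.
have H1 : \forall n \near \oo, (P [set w | (e < `|Xn n w i - X w i|)%R] < (eta / 2)%:E)%E.
  have /fine_cvgP[_ /cvgrPdist_lt /(_ _ eta2)] := cX i e0.
  apply: filterS => n; rewrite sub0r normrN /= => H.
  by rewrite -[X in (X < _)%E]fineK ?fin_num_measure// lte_fin; apply: le_lt_trans (ler_norm _) H.
near=> n.
have [E [mE PE HE]] : exists E : set T, [/\ measurable E, fine (P E) <= eta / 2 &
    forall w, ~ E w -> all (fun p : I * R => `|Xn n w p.1 - X w p.1| <= e) s].
  by near: n; exact: IH.
exists ([set w | e < `|Xn n w i - X w i|] `|` E); split.
- exact: measurableU.
- apply: le_trans (Pr_leU _ _ _ (@subset_refl _ _)) _ => //; first exact: measurableU.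
  rewrite [leRHS](splitr eta) lerD// -lee_fin fineK ?fin_num_measure// ltW//.
  by near: n.
- move=> w /= /not_orP[/negP]; rewrite -leNgt => -> /= nE; exact: HE.
Unshelve. all: by end_near. Qed.

Lemma box_upper s (e eta : R) : 0 < e -> 0 < eta -> \forall n \near \oo,
  fine (P (X @^-1` box s)) <= fine (P (Xn n @^-1` box (widen_box s e))) + eta.
Proof.
move=> e0 eta0; apply: filterS (dev_box s e0 eta0) => n [E [mE PE HE]].
apply: le_trans (_ : _ <= fine (P (Xn n @^-1` box (widen_box s e))) + fine (P E)) _; last exact: lerD.
apply: Pr_leU; try exact: mbox; try exact: mE.
move=> w /=; rewrite /box/= => Hw; have [Ew|nEw] := pselect (E w); [by right|left].
have := HE _ nEw; move: Hw; rewrite /widen_box all_map /=.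
elim: (s) => //= p s' IH /andP[H1 H2] /andP[H3 H4]; rewrite IH// andbT.
by move: H3; rewrite ler_norml => /andP[]; lra.
Qed.

Lemma box_lower s (e eta : R) : 0 < e -> 0 < eta -> \forall n \near \oo,
  fine (P (Xn n @^-1` box s)) <= fine (P (X @^-1` box (widen_box s e))) + eta.
Proof.
move=> e0 eta0; apply: filterS (dev_box s e0 eta0) => n [E [mE PE HE]].
apply: le_trans (_ : _ <= fine (P (X @^-1` box (widen_box s e))) + fine (P E)) _; last exact: lerD.
apply: Pr_leU; try exact: mbox; try exact: mE.
move=> w /=; rewrite /box/= => Hw; have [Ew|nEw] := pselect (E w); [by right|left].
have := HE _ nEw; move: Hw; rewrite /widen_box all_map /=.
elim: (s) => //= p s' IH /andP[H1 H2] /andP[H3 H4]; rewrite IH// andbT.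
by move: H3; rewrite ler_norml => /andP[]; lra.
Qed.

Lemma widen_boxD s e e' : widen_box (widen_box s e) e' = widen_box s (e + e') :> seq (I * R).
Proof. by rewrite /widen_box -map_comp; apply: eq_map => p /=; rewrite addrA. Qed.

Lemma sub_widen_box s e e' : e <= e' -> box (widen_box s e) `<=` box (widen_box s e' : seq (I * R)).
Proof.
move=> ee' x; rewrite /box/= !all_map; apply: sub_all => p /=; lra.
Qed.

(** Continuity of the measure from above; it depends on the constraints of a box being closed. *)
Lemma widen_box_cvg s (eta : R) : 0 < eta -> exists2 e, 0 < e &
  fine (P (X @^-1` box (widen_box s e))) <= fine (P (X @^-1` box s)) + eta.
Proof.
move=> eta0.
pose F (n : nat) := X @^-1` box (widen_box s n.+1%:R^-1).
have mF n : measurable (F n) by exact: mbox.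
have bF : \bigcap_n F n = X @^-1` box s.
  apply/seteqP; split => w; last first.
    move=> Hw n _; rewrite /F/=; rewrite /box/= /widen_box all_map.
    move: Hw; rewrite /= /box/=; apply: sub_all => p /=.
    by move/le_trans; apply; rewrite lerDl.
  rewrite /F /= /bigcap /box/= => H.
  have {}H n : all (fun p : I * R => X w p.1 <= p.2 + n.+1%:R^-1) s.
    by have := H n Logic.I; rewrite /widen_box all_map.
  elim: (s) H => //= p s' IH H; apply/andP; split; last first.
    by apply: IH => n; have /andP[] := H n.
  apply/ler_addgt0Pr => e e0.
  have [n] := @ltr_add_invr R _ _ e0; rewrite add0r => en.
  by have /andP[H1 _] := H n; apply: le_trans H1 _; rewrite lerD2l ltW.
have cF : P (F n) @[n --> \oo] --> P (\bigcap_n F n).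
  apply: nonincreasing_cvg_mu => //.
  - by apply: le_lt_trans (probability_le1 P _) _; rewrite ?ltry.
  - by rewrite bF; exact: mbox.
  - move=> m n mn; apply/subsetPset => w; apply: sub_widen_box.
    by rewrite lef_pV2 ?posrE// ler_nat.
move: cF; rewrite bF => cF.
have /fine_cvgP[_ /cvgrPdist_lt /(_ _ eta0) [n _ /(_ n (leqnn _))]] :
  P (F n) @[n --> \oo] --> (fine (P (X @^-1` box s)))%:E.
  rewrite fineK; first exact: cF.
  by rewrite fin_num_measure; last exact: mbox.
move=> /ltW H; exists n.+1%:R^-1 => //.
by move: H; rewrite distrC ler_distl => /andP[_].
Qed.

End one.

(** A threshold may carry mass in the limit law, so box probabilities need not converge. Comparing
    approximations and limits through widened boxes gives one inequality in each direction, and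
    right continuity of the limit probabilities closes the gap. *)
Lemma box_limit (I J : Type) (Xn : nat -> T -> pathT R I) (X : T -> pathT R I)
  (Yn : nat -> T -> pathT R J) (Y : T -> pathT R J)
  (Zn : nat -> T -> pathT R J) (Z : T -> pathT R J) :
  (forall n, measurable_fun setT (Xn n)) -> measurable_fun setT X ->
  (forall n, measurable_fun setT (Yn n)) -> measurable_fun setT Y ->
  (forall n, measurable_fun setT (Zn n)) -> measurable_fun setT Z ->
  (forall i, cvg_in_prob (fun n w => Xn n w i) (fun w => X w i)) ->
  (forall i, cvg_in_prob (fun n w => Yn n w i) (fun w => Y w i)) ->
  (forall i, cvg_in_prob (fun n w => Zn n w i) (fun w => Z w i)) ->
  (forall s s', \forall n \near \oo,
    P (Xn n @^-1` box s `&` Yn n @^-1` box s') =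
    P (Xn n @^-1` box s) * P (Zn n @^-1` box s'))%E ->
  forall s s', P (X @^-1` box s `&` Y @^-1` box s') =
    (P (X @^-1` box s) * P (Z @^-1` box s'))%E.
Proof.
move=> mXn mX mYn mY mZn mZ cX cY cZ H s s'.
(* Indexing the joint path by [I + J] turns the joint event into a single box. *)
pose pair (U : T -> pathT R I) (V : T -> pathT R J) (w : T) : pathT R (I + J) :=
  fun i => match i with inl i => U w i | inr j => V w j end.
pose pr (s : seq (I * R)) (s' : seq (J * R)) : seq ((I + J) * R) :=
  [seq (inl p.1, p.2) | p <- s] ++ [seq (inr p.1, p.2) | p <- s'].
have prE U V s1 s2 : pair U V @^-1` box (pr s1 s2) = U @^-1` box s1 `&` V @^-1` box s2.
  by apply/seteqP; split => w /=; rewrite /box/= all_cat !all_map => /andP.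
have wE s1 s2 e : widen_box (pr s1 s2) e = pr (widen_box s1 e) (widen_box s2 e).
  by rewrite /widen_box /pr map_cat -!map_comp.
have mpair U V : measurable_fun setT U -> measurable_fun setT V -> measurable_fun setT (pair U V).
  move=> mU mV; apply: measurable_path => -[i|j].
    exact: (measurableT_comp (measurable_coord i) mU).
  exact: (measurableT_comp (measurable_coord j) mV).
have mB K (U : T -> pathT R K) s0 : measurable_fun setT U -> measurable (U @^-1` box s0).
  by move=> mU; apply: measurable_preim => //; exact: measurable_box.
have finB K (U : T -> pathT R K) s0 : measurable_fun setT U -> P (U @^-1` box s0) \is a fin_num.
  by move=> mU; apply: fin_num_measure; exact: mB.
pose Wn n := pair (Xn n) (Yn n); pose W := pair X Y.
have mWn n : measurable_fun setT (Wn n) by exact: mpair.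
have mW : measurable_fun setT W by exact: mpair.
have cW i : cvg_in_prob (fun n w => Wn n w i) (fun w => W w i).
  by case: i => [i|j]; [exact: cX|exact: cY].
rewrite -prE -/W.
set a := fine (P (W @^-1` box (pr s s'))).
set b := fine (P (X @^-1` box s)); set c := fine (P (Z @^-1` box s')).
suff abc : a = b * c.
  have fK A : measurable A -> P A = (fine (P A))%:E.
    by move=> mA; rewrite fineK// fin_num_measure.
  by rewrite (fK _ (mB _ W _ mW)) (fK _ (mB _ X s mX)) (fK _ (mB _ Z s' mZ)) -EFinM -/a abc.
have b0 : 0 <= b by exact: Pr_ge0.
have c0 : 0 <= c by exact: Pr_ge0.
have b1 : b <= 1 by apply: Pr_le1; exact: mB.
have c1 : c <= 1 by apply: Pr_le1; exact: mB.
apply/eqP; rewrite eq_le; apply/andP; split; apply/ler_addgt0Pr => e' e'0.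
  (* The bound reached is [(b + 2 e) (c + 2 e) + e], at most [b c + 9 e] when [b], [c] and [e] are
     at most 1. *)
  pose e := Num.min (e' / 9) 1.
  have e0 : 0 < e by rewrite /e lt_min divr_gt0//=.
  have ee' : 9 * e <= e'.
    have : e <= e' / 9 by rewrite ge_min lexx.
    lra.
  have e1 : e <= 1 by rewrite ge_min lexx orbT.
  have [d1 d10 Hd1] := widen_box_cvg mX s e0.
  have [d2 d20 Hd2] := widen_box_cvg mZ s' e0.
  pose dl := Num.min d1 d2 / 2.
  have dl0 : 0 < dl by rewrite divr_gt0// lt_min d10.
  near \oo => n.
  have h1 : a <= fine (P (Wn n @^-1` box (widen_box (pr s s') dl))) + e.
    by near: n; exact: box_upper.
  have h2 : fine (P (Xn n @^-1` box (widen_box s dl))) <= fine (P (X @^-1` box (widen_box (widen_box s dl) dl))) + e.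
    by near: n; exact: box_lower.
  have h3 : fine (P (Zn n @^-1` box (widen_box s' dl))) <= fine (P (Z @^-1` box (widen_box (widen_box s' dl) dl))) + e.
    by near: n; exact: box_lower.
  have h4 : P (Xn n @^-1` box (widen_box s dl) `&` Yn n @^-1` box (widen_box s' dl)) =
    (P (Xn n @^-1` box (widen_box s dl)) * P (Zn n @^-1` box (widen_box s' dl)))%E.
    by near: n; exact: H.
  move: h1; rewrite wE prE h4 fineM ?finB// => h1.
  have h2' : fine (P (X @^-1` box (widen_box (widen_box s dl) dl))) <= b + e.
    apply: le_trans Hd1; apply: Pr_le; try exact: mB.
    move=> w; rewrite widen_boxD; apply: sub_widen_box; rewrite /dl -splitr.
    by rewrite ge_min lexx.
  have h3' : fine (P (Z @^-1` box (widen_box (widen_box s' dl) dl))) <= c + e.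
    apply: le_trans Hd2; apply: Pr_le; try exact: mB.
    move=> w; rewrite widen_boxD; apply: sub_widen_box; rewrite /dl -splitr.
    by rewrite ge_min lexx orbT.
  set bn := fine (P (Xn n @^-1` _)) in h1 h2; set cn := fine (P (Zn n @^-1` _)) in h1 h3.
  have bn0 : 0 <= bn by exact: Pr_ge0.
  have cn0 : 0 <= cn by exact: Pr_ge0.
  have : bn * cn <= (b + e + e) * (c + e + e) by apply: ler_pM => //; lra.
  have : b * e <= e by rewrite ler_piMl// ltW.
  have : c * e <= e by rewrite ler_piMl// ltW.
  have : e * e <= e by rewrite ler_piMl// ltW.
  nra.
(* Expanding [(bn + e) (cn + e)] costs [3 e], and comparing [bn * cn] with [a] costs [2 e] more. *)
pose e := Num.min (e' / 5) 1.
have e0 : 0 < e by rewrite /e lt_min divr_gt0//=.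
have ee' : 5 * e <= e'.
  have : e <= e' / 5 by rewrite ge_min lexx.
  lra.
have e1 : e <= 1 by rewrite ge_min lexx orbT.
have [d1 d10 Hd1] := widen_box_cvg mW (pr s s') e0.
pose dl := d1 / 2.
have dl0 : 0 < dl by rewrite divr_gt0.
near \oo => n.
have h1 : fine (P (Wn n @^-1` box (widen_box (pr s s') dl))) <= fine (P (W @^-1` box (widen_box (widen_box (pr s s') dl) dl))) + e.
  by near: n; exact: box_lower.
have h2 : b <= fine (P (Xn n @^-1` box (widen_box s dl))) + e.
  by near: n; exact: box_upper.
have h3 : c <= fine (P (Zn n @^-1` box (widen_box s' dl))) + e.
  by near: n; exact: box_upper.
have h4 : P (Xn n @^-1` box (widen_box s dl) `&` Yn n @^-1` box (widen_box s' dl)) =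
  (P (Xn n @^-1` box (widen_box s dl)) * P (Zn n @^-1` box (widen_box s' dl)))%E.
  by near: n; exact: H.
move: h1; rewrite [X in _ @^-1` box X]wE prE h4 fineM ?finB//.
rewrite widen_boxD -splitr => h1.
set bn := fine (P (Xn n @^-1` _)) in h1 h2; set cn := fine (P (Zn n @^-1` _)) in h1 h3.
have bn0 : 0 <= bn by exact: Pr_ge0.
have cn0 : 0 <= cn by exact: Pr_ge0.
have bn1 : bn <= 1 by apply: Pr_le1; exact: mB.
have cn1 : cn <= 1 by apply: Pr_le1; exact: mB.
have : b * c <= (bn + e) * (cn + e) by exact: ler_pM.
have : bn * e <= e by rewrite ler_piMl// ltW.
have : cn * e <= e by rewrite ler_piMl// ltW.
have : e * e <= e by rewrite ler_piMl// ltW.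
move: h1 Hd1 ee'; rewrite -/a; lra.
Unshelve. all: by end_near. Qed.

End box_limit.

(** * Discrete walks in the Heisenberg group *)

Section walk.
Context {R : realType}.
Implicit Types (x : bool * nat -> R) (v u : R * R * R).

Definition hmul v u : R * R * R :=
  (v.1.1 + u.1.1, v.1.2 + u.1.2,
   v.2 + u.2 + (v.1.1 * u.1.2 - v.1.2 * u.1.1) / 2).

Definition hinv v : R * R * R := (- v.1.1, - v.1.2, - v.2).

Lemma hmulA v u t : hmul v (hmul u t) = hmul (hmul v u) t.
Proof. by rewrite /hmul/=; congr (_, _, _); field. Qed.

Lemma hmulV v : hmul v (hinv v) = (0, 0, 0).
Proof. by rewrite /hmul/=; congr (_, _, _); field. Qed.

Lemma hmulVl v : hmul (hinv v) v = (0, 0, 0).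
Proof. by rewrite /hmul/=; congr (_, _, _); field. Qed.

Lemma hmul1 v : hmul v (0, 0, 0) = v.
Proof. by case: v => [[a b] c]; rewrite /hmul/=; congr (_, _, _); field. Qed.

Lemma hmul1l v : hmul (0, 0, 0) v = v.
Proof. by case: v => [[a b] c]; rewrite /hmul/=; congr (_, _, _); field. Qed.

Definition wk x b j := \sum_(i < j) x (b, nat_of_ord i).

Definition ar x j := 2^-1 * \sum_(i < j)
  (wk x true i * x (false, nat_of_ord i) - wk x false i * x (true, nat_of_ord i)).

Definition walk x j : R * R * R := (wk x true j, wk x false j, ar x j).

Definition shiftx (p : nat) x : bool * nat -> R := fun i => x (i.1, (p + i.2)%N).

Lemma wkS x b j : wk x b j.+1 = wk x b j + x (b, j).
Proof. by rewrite /wk big_ord_recr. Qed.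

Lemma arS x j : ar x j.+1 =
  ar x j + (wk x true j * x (false, j) - wk x false j * x (true, j)) / 2.
Proof. by rewrite /ar big_ord_recr/= mulrDr [X in _ + X]mulrC. Qed.

Lemma walk0 x : walk x 0 = (0, 0, 0).
Proof. by rewrite /walk /wk /ar !big_ord0 mulr0. Qed.

(** A horizontal step adds to the area exactly the cocycle of the group law, so the walk with its
    area is a product of group elements. *)
Lemma walkS x j : walk x j.+1 = hmul (walk x j) (x (true, j), x (false, j), 0).
Proof. by rewrite /walk !wkS arS /hmul/= addr0. Qed.

(** Restarting the walk is a left translation: the algebraic source of the Markov property. *)
Lemma walkD x p j : walk x (p + j) = hmul (walk x p) (walk (shiftx p x) j).
Proof.
elim: j => [|j IH]; first by rewrite addn0 walk0 hmul1.
by rewrite addnS !walkS IH hmulA.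
Qed.

Lemma eq_walk x y j : (forall b i, (i < j)%N -> x (b, i) = y (b, i)) ->
  walk x j = walk y j.
Proof.
elim: j => [|j IH] xy; first by rewrite !walk0.
by rewrite !walkS IH ?xy// => b i ij; apply: xy; exact: ltnW.
Qed.

Definition sel (c : option bool) v :=
  match c with Some true => v.1.1 | Some false => v.1.2 | None => v.2 end.

Lemma measurable_walk d (T : measurableType d) (X : T -> bool * nat -> R) j c :
  (forall i, measurable_fun setT (fun w => X w i)) ->
  measurable_fun setT (fun w => sel c (walk (X w) j)).
Proof.
move=> mX.
have mwk b i : measurable_fun setT (fun w => wk (X w) b i).
  by apply: measurable_sum => k; exact: mX.
case: c => [[]|]; [exact: mwk|exact: mwk|].
apply: measurable_funM => //; apply: measurable_sum => k.
by apply: measurable_funB; apply: measurable_funM => //; exact: mX.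
Qed.

End walk.

(** * Independence of Brownian increments on a dyadic grid *)

Section increments.
Context {R : realType} {d : measure_display} {T : measurableType d}.
Variable P : probability T R.
Implicit Types (W : R -> T -> R).

(** The distributional content of [std_BM2]. It is stable under the shifts, reflections, exchanges
    and scalings applied later. *)
Definition BMinc W1 W2 :=
  [/\ forall t, measurable_fun setT (W1 t) /\ measurable_fun setT (W2 t),
      forall w, W1 0 w = 0 /\ W2 0 w = 0 &
      forall (n : nat) (t : nat -> R) (B C : nat -> set R),
        0 <= t 0%N ->
        (forall i, (i < n)%N -> t i < t i.+1) ->
        (forall i, measurable (B i)) -> (forall i, measurable (C i)) ->
        P (\bigcap_(i in `I_n)
             ([set w | B i (W1 (t i.+1) w - W1 (t i) w)] `&`
              [set w | C i (W2 (t i.+1) w - W2 (t i) w)])) =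
        \big[*%E/1%E]_(i < n)
           (normal_prob 0 (Num.sqrt (t i.+1 - t i)) (B i) *
            normal_prob 0 (Num.sqrt (t i.+1 - t i)) (C i))%E].

Lemma std_BM2_inc W1 W2 : std_BM2 P W1 W2 -> BMinc W1 W2.
Proof. by case. Qed.

Definition dyt (n k : nat) : R := k%:R / 2 ^+ n.

Definition incr W1 W2 (n : nat) (w : T) : pathT R (bool * nat) := fun i =>
  let W := if i.1 then W1 else W2 in
  W (dyt n i.2.+1) w - W (dyt n i.2) w.

Definition gn (n : nat) := normal_prob (0 : R) (Num.sqrt (2 ^- n)).

Lemma dyt_lt n k : dyt n k < dyt n k.+1.
Proof. by rewrite /dyt ltr_pM2r ?invr_gt0 ?exprn_gt0// ltr_nat. Qed.

Lemma dytB n k : dyt n k.+1 - dyt n k = 2 ^- n.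
Proof. by rewrite /dyt -mulrBl -natrB// subSn// subnn mul1r. Qed.

Lemma incr_rect W1 W2 n N (B : bool -> nat -> set R) : BMinc W1 W2 ->
  (forall b i, measurable (B b i)) ->
  P [set w | forall i, (i < N)%N -> forall b, B b i (incr W1 W2 n w (b, i))] =
  (\big[*%E/1%E]_(i < N) (gn n (B true i) * gn n (B false i)))%E.
Proof.
move=> [_ _ H] mB.
have := H N (dyt n) (B true) (B false).
rewrite /dyt mul0r lexx => /(_ erefl) /(_ _ (mB true) (mB false)) E.
transitivity (\big[*%E/1%E]_(i < N) (gn n (B true i) * gn n (B false i)))%E => //.
under eq_bigr => i _ do rewrite /gn -(dytB n i).
rewrite -E; last by move=> i _; exact: dyt_lt.
congr (P _); apply/seteqP; split => w /=.
  by move=> Hw i iN; split; [exact: (Hw i iN true)|exact: (Hw i iN false)].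
by move=> Hw i iN [|]; have [] := Hw i iN.
Qed.

Lemma measurable_incr W1 W2 n : BMinc W1 W2 -> measurable_fun setT (incr W1 W2 n).
Proof.
move=> [mW _ _]; apply: measurable_path => -[[|] i]; rewrite /incr/=;
by apply: measurable_funB; have [] := mW (dyt n i); have [] := mW (dyt n i.+1).
Qed.

(** The set that a list of constraints allows for coordinate [j], the whole line if [j] does not
    occur. A box is the product of these sets over its coordinates. *)
Definition half (J : eqType) (s : seq (J * R)) (j : J) : set R :=
  [set r | all (fun q => (q.1 == j) ==> (r <= q.2)) s].

Lemma measurable_half (J : eqType) (s : seq (J * R)) j : measurable (half s j).
Proof.
rewrite /half; elim: s => [|q s IH] /=.
  by rewrite (_ : [set r | _] = setT)//; exact/seteqP.
rewrite (_ : [set r | _] = [set r : R | (q.1 == j) ==> (r <= q.2)] `&` half s j); last first.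
  by apply/seteqP; split => r /= /andP.
apply: measurableI => //; case: (q.1 == j) => /=; last first.
  by rewrite (_ : [set r | _] = setT)//; exact/seteqP.
by rewrite (_ : [set r | _] = `]-oo, q.2]%classic)//.
Qed.

Lemma gnT n : gn n setT = 1%E.
Proof. exact: (@probability_setT _ _ R (normal_prob 0 (Num.sqrt (2 ^- n)))). Qed.

Definition pinc (p : nat) (x : pathT R (bool * nat)) : pathT R (bool * 'I_p) :=
  fun i => x (i.1, nat_of_ord i.2).
Arguments pinc : clear implicits.

Lemma box_rect (s : seq ((bool * nat) * R)) N :
  all (fun q => (q.1.2 < N)%N) s -> forall x : bool * nat -> R,
  box s x <-> forall i, (i < N)%N -> forall b,
    half s (b, i) (x (b, i)).
Proof.
move=> sN x; rewrite /box/half/=; split => [Hx i _ b|Hx].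
  by apply: sub_all Hx => q; case: eqP => //= ->.
elim: s sN Hx => //= q s IH /andP[qN sN] Hx; apply/andP; split.
  by have := Hx _ qN q.1.1; rewrite -surjective_pairing eqxx/= => /andP[].
by apply: IH => // i iN b; have := Hx i iN b => /andP[].
Qed.

Lemma incr_box W1 W2 n (s : seq ((bool * nat) * R)) N : BMinc W1 W2 ->
  all (fun q => (q.1.2 < N)%N) s ->
  P (incr W1 W2 n @^-1` box s) = (\big[*%E/1%E]_(i < N)
   (gn n (half s (true, nat_of_ord i)) *
    gn n (half s (false, nat_of_ord i))))%E.
Proof.
move=> BM sN.
rewrite -(@incr_rect W1 W2 n N (fun b i => half s (b, i)))//.
  by congr (P _); apply/seteqP; split => w /= /(box_rect sN).
by move=> b i; exact: measurable_half.
Qed.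

(** Constraints on the past involve indices below [p] and those on the future indices from [p] on,
    so the product of Gaussian masses splits at [p]. The future factor depends only on the Gaussian
    law, hence may be computed with any other pair [W1'], [W2']. *)
Lemma incr_indep_box W1 W2 W1' W2' n p s s' :
  BMinc W1 W2 -> BMinc W1' W2' ->
  P ((pinc p \o incr W1 W2 n) @^-1` box s `&`
     (shiftx p \o incr W1 W2 n) @^-1` box s') =
  (P ((pinc p \o incr W1 W2 n) @^-1` box s) * P (incr W1' W2' n @^-1` box s'))%E.
Proof.
move=> BM BM'.
pose s1 : seq ((bool * nat) * R) := [seq ((q.1.1, nat_of_ord q.1.2), q.2) | q <- s].
have s1E : (pinc p \o incr W1 W2 n) @^-1` box s = incr W1 W2 n @^-1` box s1.
  by apply/seteqP; split => w /=; rewrite /box/= all_map.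
pose s2 : seq ((bool * nat) * R) := [seq ((q.1.1, p + q.1.2)%N, q.2) | q <- s'].
have s2E : (shiftx p \o incr W1 W2 n) @^-1` box s' = incr W1 W2 n @^-1` box s2.
  by apply/seteqP; split => w /=; rewrite /box/= all_map.
pose N := \max_(q <- s') q.1.2.+1.
have s'N : all (fun q => (q.1.2 < N)%N) s'.
  by apply/allP => q qs; exact: (@leq_bigmax_seq _ s' xpredT (fun q => q.1.2.+1) q qs).
have s1p : all (fun q => (q.1.2 < p)%N) s1.
  by rewrite all_map; apply/allP => q _ /=.
rewrite s1E s2E -preimage_setI boxI (incr_box n BM s1p) (incr_box n BM' s'N).
rewrite (@incr_box W1 W2 n _ (p + N) BM); last first.
  rewrite all_cat; apply/andP; split.
    by apply: sub_all s1p => q /= qp; exact: ltn_addr.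
  by rewrite all_map; apply: sub_all s'N => q /=; rewrite ltn_add2l.
rewrite big_split_ord/=; congr (_ * _)%E; apply: eq_bigr => i _; congr (gn n _ * gn n _)%E;
  apply/seteqP; split => r; rewrite /half/= all_cat.
- by case/andP.
- move=> ->/=; rewrite all_map; apply/allP => q _ /=.
  by rewrite xpair_eqE [(p + _)%N == _]gtn_eqF ?andbF// ltn_addr.
- by case/andP.
- move=> ->/=; rewrite all_map; apply/allP => q _ /=.
  by rewrite xpair_eqE [(p + _)%N == _]gtn_eqF ?andbF// ltn_addr.
- case/andP => _; rewrite all_map; apply: sub_all => q /=.
  by rewrite !xpair_eqE eqn_add2l [q.1]surjective_pairing xpair_eqE.
- move=> H; apply/andP; split.
    rewrite all_map; apply/allP => q _ /=.
    by rewrite xpair_eqE ltn_eqF ?andbF// ltn_addr.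
  rewrite all_map; apply: sub_all H => q /=.
  by rewrite !xpair_eqE eqn_add2l [q.1]surjective_pairing xpair_eqE.
- case/andP => _; rewrite all_map; apply: sub_all => q /=.
  by rewrite !xpair_eqE eqn_add2l [q.1]surjective_pairing xpair_eqE.
- move=> H; apply/andP; split.
    rewrite all_map; apply/allP => q _ /=.
    by rewrite xpair_eqE ltn_eqF ?andbF// ltn_addr.
  rewrite all_map; apply: sub_all H => q /=.
  by rewrite !xpair_eqE eqn_add2l [q.1]surjective_pairing xpair_eqE.
Qed.

Lemma measurable_pinc p : measurable_fun setT (pinc p).
Proof. by apply: measurable_path => i; exact: measurable_coord. Qed.

Lemma measurable_shiftx p :
  measurable_fun [set: pathT R (bool * nat)] (shiftx p : _ -> pathT R (bool * nat)).
Proof. by apply: measurable_path => i; exact: measurable_coord. Qed.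

Lemma incr_indep W1 W2 W1' W2' n p :
  BMinc W1 W2 -> BMinc W1' W2' ->
  forall (A : set (pathT R (bool * 'I_p))) (B : set (pathT R (bool * nat))),
  measurable A -> measurable B ->
  P ((pinc p \o incr W1 W2 n) @^-1` A `&`
     (shiftx p \o incr W1 W2 n) @^-1` B) =
  (P ((pinc p \o incr W1 W2 n) @^-1` A) * P (incr W1' W2' n @^-1` B))%E.
Proof.
move=> BM BM'.
have mi := measurable_incr n BM.
apply: (@indep_gen _ _ _ _ _ (pathT R (bool * 'I_p)) (pathT R (bool * nat)) P boxes boxes) => //.
- exact: setI_closed_boxes.
- by exists [::] => //; exact: box_nil.
- exact: setI_closed_boxes.
- by exists [::] => //; exact: box_nil.
- by apply: measurableT_comp mi; exact: measurable_pinc.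
- by apply: measurableT_comp mi; exact: measurable_shiftx.
- exact: measurable_incr.
- by move=> _ _ [s _ <-] [s' _ <-]; exact: incr_indep_box.
Qed.

End increments.
Arguments pinc {R} p x.

(** * Second moments of sums of products of increments *)

Section moments.
Context {R : realType} {d : measure_display} {T : measurableType d}.
Variable P : probability T R.
Variables (W1 W2 : R -> T -> R) (n : nat).
Hypothesis BM : BMinc P W1 W2.
Local Notation x := (incr W1 W2 n).

Let mx i : measurable_fun setT (fun w => x w i : R).
Proof. exact: (measurableT_comp (measurable_coord i) (measurable_incr n BM)). Qed.

Lemma incr_law b j (A : set R) : measurable A -> P [set w | A (x w (b, j))] = gn n A.
Proof.
move=> mA.
(* Only the factor at [(b, j)] is constrained; all the others have mass one. *)
pose B b' i : set R := if (b' == b) && (i == j) then A else setT.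
have mB b' i : measurable (B b' i) by rewrite /B; case: ifP.
transitivity (P [set w | forall i, (i < j.+1)%N -> forall b', B b' i (x w (b', i))]).
  congr (P _); apply/seteqP; split => w /=.
    by move=> H i _ b'; rewrite /B; case: ifPn => // /andP[/eqP-> /eqP->].
  by move/(_ j (ltnSn j) b); rewrite /B !eqxx.
rewrite (incr_rect n j.+1 BM mB) big_ord_recr/= big1 ?mul1e; last first.
  by move=> i _; rewrite /B ![nat_of_ord i == j]ltn_eqF// !andbF gnT mule1.
by rewrite /B !eqxx !andbT; case: b {B mB}; rewrite /= gnT ?mule1 ?mul1e.
Qed.

Lemma incr_indep2 b j k (A B : set R) : (j < k)%N -> measurable A -> measurable B ->
  P ((fun w => x w (b, j)) @^-1` A `&` (fun w => x w (b, k)) @^-1` B) =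
  (P ((fun w => x w (b, j)) @^-1` A) * P ((fun w => x w (b, k)) @^-1` B))%E.
Proof.
move=> jk mA mB.
have := incr_indep n BM BM (p := k) (A := [set y | A (y (b, Ordinal jk))])
  (B := [set y | B (y (b, 0%N))]).
have -> : (shiftx k \o x) @^-1` [set y | B (y (b, 0%N))] = (fun w => x w (b, k)) @^-1` B.
  by apply/seteqP; split => w /=; rewrite /shiftx/= addn0.
have -> : P (x @^-1` [set y | B (y (b, 0))]) = P ((fun w => x w (b, k)) @^-1` B).
  by rewrite (incr_law b k mB) -(incr_law b 0 mB).
apply.
  by rewrite -[X in measurable X]setTI; exact: measurable_coord.
by rewrite -[X in measurable X]setTI; exact: measurable_coord.
Qed.

Definition cpath (c : bool) (w : T) : pathT R nat := fun j => x w (c, j).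

Let mcpath c : measurable_fun setT (cpath c).
Proof. by apply: measurable_path => i; exact: mx. Qed.

Lemma cpath_box c (s : seq (nat * R)) N : all (fun q => (q.1 < N)%N) s ->
  forall w, box s (cpath c w) <-> (forall i, (i < N)%N -> half s i (x w (c, i))).
Proof.
move=> sN w; rewrite /box/half/=; split => [Hx i _|Hx].
  by apply: sub_all Hx => q; case: eqP => //= ->.
elim: s sN Hx => //= q s IH /andP[qN sN] Hx; apply/andP; split.
  by have := Hx _ qN; rewrite eqxx/= => /andP[].
by apply: IH => // i iN; have := Hx i iN => /andP[].
Qed.

Lemma cpath_indep c (A B : set (pathT R nat)) : measurable A -> measurable B ->
  P (cpath c @^-1` A `&` cpath (~~ c) @^-1` B) =
  (P (cpath c @^-1` A) * P (cpath (~~ c) @^-1` B))%E.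
Proof.
apply: (@indep_gen _ _ _ _ _ (pathT R nat) (pathT R nat) P boxes boxes) => //.
- exact: setI_closed_boxes.
- by exists [::] => //; exact: box_nil.
- exact: setI_closed_boxes.
- by exists [::] => //; exact: box_nil.
move=> _ _ [s _ <-] [s' _ <-].
pose N := \max_(q <- s ++ s') q.1.+1.
have [sN s'N] : all (fun q => (q.1 < N)%N) s /\ all (fun q => (q.1 < N)%N) s'.
  apply/andP; rewrite -all_cat.
  by apply/allP => q qs; exact: (@leq_bigmax_seq _ (s ++ s') xpredT (fun q => q.1.+1) q qs).
(* [D true] imposes both lists of constraints, [D false] only the one on coordinate [~~ c], and [D0]
   only the one on coordinate [c]; the rectangle of [D true] thus factors into the other two. *)
pose D (b b' : bool) i : set R := if b' == c then (if b then half s i else setT) else half s' i.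
pose D0 b' i : set R := if b' == c then half s i else setT.
have mD b b' i : measurable (D b b' i).
  by rewrite /D; case: ifP => _; [case: ifP => _ //; exact: measurable_half|exact: measurable_half].
have mD0 b' i : measurable (D0 b' i).
  by rewrite /D0; case: ifP => _ //; exact: measurable_half.
have -> : cpath c @^-1` box s `&` cpath (~~ c) @^-1` box s' =
    [set w | forall i, (i < N)%N -> forall b', D true b' i (x w (b', i))].
  apply/seteqP; split => w /=.
    move=> [/(cpath_box _ sN) H1 /(cpath_box _ s'N) H2] i iN b'; rewrite /D.
    case: ifPn => [/eqP->|b'c]; first exact: H1.
    have -> : b' = ~~ c by case: b' c b'c {D D0 mD mD0 H1 H2} => -[].
    exact: H2.
  move=> H; split; [apply/(cpath_box _ sN) => i iN|apply/(cpath_box _ s'N) => i iN].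
    by have := H i iN c; rewrite /D eqxx.
  by have := H i iN (~~ c); rewrite /D; case: (c).
have -> : cpath c @^-1` box s =
    [set w | forall i, (i < N)%N -> forall b', D0 b' i (x w (b', i))].
  apply/seteqP; split => w /=.
    move=> /(cpath_box _ sN) H1 i iN b'; rewrite /D0.
    by case: ifPn => [/eqP->|b'c //]; exact: H1.
  by move=> H; apply/(cpath_box _ sN) => i iN; have := H i iN c; rewrite /D0 eqxx.
have -> : cpath (~~ c) @^-1` box s' =
    [set w | forall i, (i < N)%N -> forall b', D false b' i (x w (b', i))].
  apply/seteqP; split => w /=.
    move=> /(cpath_box _ s'N) H2 i iN b'; rewrite /D.
    case: ifPn => [//|b'c].
    have -> : b' = ~~ c by case: b' c b'c {D D0 mD mD0 H2} => -[].
    exact: H2.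
  move=> H; apply/(cpath_box _ s'N) => i iN.
  by have := H i iN (~~ c); rewrite /D; case: (c).
rewrite !(incr_rect n N BM)// -big_split/=; apply: eq_bigr => i _.
by rewrite /D /D0; case: (c); rewrite /= gnT ?mule1 ?mul1e// muleC.
Qed.

Let hs : 0 < Num.sqrt (2 ^- n : R).
Proof. by rewrite sqrtr_gt0 invr_gt0 exprn_gt0. Qed.

Let mxR b j : measurable_fun setT (fun w => x w (b, j) : measurableTypeR R).
Proof. exact: mx. Qed.

Let push_law b j : forall A : set (measurableTypeR R), measurable A -> A `<=` setT ->
  pushm P (@mxR b j) A = gn n A.
Proof. by move=> A mA _; rewrite -(incr_law b j mA). Qed.

Lemma incr_integrable b j : P.-integrable setT (fun w => (x w (b, j))%:E).
Proof.
apply/integrableP; split; first by apply/measurable_EFinP; exact: mx.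
have -> : (\int[P]_w `|(x w (b, j))%:E| = \int[pushm P (mxR b j)]_y `|y%:E|)%E.
  rewrite (ge0_integral_pushforward (mxR b j) P measurableT)// ?preimage_setT//.
  by apply/measurableT_comp => //; apply/measurable_EFinP.
rewrite (@eq_measure_integral _ _ _ _ (normal_prob 0 (Num.sqrt (2 ^- n))) _ _ (push_law b j)).
by have /integrableP[] := integrable_normal_prob_id hs.
Qed.

Lemma incr_mean b j : (\int[P]_w (x w (b, j))%:E = 0)%E.
Proof.
have -> : (\int[P]_w (x w (b, j))%:E = \int[pushm P (mxR b j)]_y y%:E)%E.
  have mE : measurable_fun [set: measurableTypeR R] (fun y : measurableTypeR R => y%:E).
    by apply/measurable_EFinP.
  rewrite (integral_pushforward (mxR b j) mE) ?preimage_setT//.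
  exact: incr_integrable.
rewrite (@eq_measure_integral _ _ _ _ (normal_prob 0 (Num.sqrt (2 ^- n))) _ _ (push_law b j)).
exact: normal_prob_mean.
Qed.

Variable m2 : R.
Hypothesis Hm2 : forall s, 0 < s -> (\int[normal_prob 0%R s]_y (y ^+ 2)%:E = (m2 * s ^+ 2)%:E)%E.

Lemma incr_sqr b j : (\int[P]_w (x w (b, j) ^+ 2)%:E = (m2 * 2 ^- n)%:E)%E.
Proof.
have -> : (\int[P]_w (x w (b, j) ^+ 2)%:E = \int[pushm P (mxR b j)]_y (y ^+ 2)%:E)%E.
  rewrite (ge0_integral_pushforward (mxR b j) P measurableT)// ?preimage_setT//.
    by apply/measurable_EFinP; exact: measurable_funX.
  by move=> y _; rewrite lee_fin sqr_ge0.
rewrite (@eq_measure_integral _ _ _ _ (normal_prob 0 (Num.sqrt (2 ^- n))) _ _ (push_law b j)).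
by rewrite Hm2// sqr_sqrtr// invr_ge0 exprn_ge0.
Qed.

Lemma incr_cov b j k :
  P.-integrable setT (EFin \o (fun w => x w (b, j) * x w (b, k))) /\
  (\int[P]_w (x w (b, j) * x w (b, k))%:E = (if j == k then m2 * 2 ^- n else 0)%:E)%E.
Proof.
have [<-|jk] := eqVneq j k.
  have E : (\int[P]_w (x w (b, j) * x w (b, j))%:E = (m2 * 2 ^- n)%:E)%E.
    by under eq_integral do rewrite -expr2; rewrite incr_sqr.
  split => //; apply/integrableP; split.
    by apply/measurable_EFinP; apply: measurable_funM; exact: mx.
  under eq_integral do rewrite /= ger0_norm -?expr2 ?sqr_ge0// expr2.
  by rewrite E ltry.
have key j' k' : (j' < k')%N ->
   P.-integrable setT (EFin \o (fun w => x w (b, j') * x w (b, k'))) /\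
  (\int[P]_w (x w (b, j') * x w (b, k'))%:E = 0)%E.
  move=> jk'; split.
    apply: (integrable_mul_indep (mx _) (mx _)); try exact: incr_integrable.
    by move=> A B mA mB; exact: incr_indep2.
  rewrite (integral_mul_indep (mx _) (mx _)); try exact: incr_integrable.
    by rewrite incr_mean mul0e.
  by move=> A B mA mB; exact: incr_indep2.
move: jk; rewrite neq_ltn => /orP[|] /key //.
by under [X in (EFin \o X)]funext do rewrite mulrC;
   under eq_integral do rewrite mulrC.
Qed.

Lemma incr_cov4 c (a a' b b' : nat) :
  P.-integrable setT (EFin \o (fun w =>
    (x w (c, a) * x w (c, a')) * (x w (~~ c, b) * x w (~~ c, b')))) /\
  (\int[P]_w ((x w (c, a) * x w (c, a')) * (x w (~~ c, b) * x w (~~ c, b')))%:E =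
   ((if a == a' then m2 * 2 ^- n else 0) * (if b == b' then m2 * 2 ^- n else 0))%:E)%E.
Proof.
have [i1 e1] := incr_cov c a a'; have [i2 e2] := incr_cov (~~ c) b b'.
have m1 c' i j : measurable_fun setT (fun w => x w (c', i) * x w (c', j)).
  by apply: measurable_funM; exact: mx.
have mp i j : measurable_fun [set: pathT R nat] (fun y : pathT R nat => y i * y j).
  by apply: measurable_funM; exact: measurable_coord.
pose U w := x w (c, a) * x w (c, a').
pose V w := x w (~~ c, b) * x w (~~ c, b').
have ind (A B : set R) : measurable A -> measurable B ->
  P (U @^-1` A `&` V @^-1` B) = (P (U @^-1` A) * P (V @^-1` B))%E.
  move=> mA mB.
  have := @cpath_indep c ((fun y : pathT R nat => y a * y a') @^-1` A)
    ((fun y : pathT R nat => y b * y b') @^-1` B).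
  apply; rewrite -[X in measurable X]setTI; exact: mp.
split; first exact: (integrable_mul_indep (m1 _ _ _) (m1 _ _ _)).
by rewrite (integral_mul_indep (m1 _ _ _) (m1 _ _ _))// e1 e2 -EFinM.
Qed.

(** Distinct terms are orthogonal: by the injectivity hypothesis they differ in the index of one of
    the two coordinates, and the covariance of two different increments vanishes. Only the diagonal
    contributes. *)
Lemma area_L2 (Q : finType) (p : pred Q) (al be : Q -> nat) c :
  (forall q q', p q -> p q' -> al q = al q' -> be q = be q' -> q = q') ->
  (\int[P]_w ((\sum_(q | p q) x w (c, al q) * x w (~~ c, be q)) ^+ 2)%:E <=
   (#|Q|%:R * (m2 * 2 ^- n) ^+ 2)%:E)%E.
Proof.
move=> inj.
pose F (z : Q * Q) w := (x w (c, al z.1) * x w (c, al z.2)) *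
   (x w (~~ c, be z.1) * x w (~~ c, be z.2)).
have E w : ((\sum_(q | p q) x w (c, al q) * x w (~~ c, be q)) ^+ 2)%:E =
    (\sum_(z : Q * Q | p z.1 && p z.2) (F z w)%:E)%E.
  rewrite sumEFin expr2 big_distrlr/= pair_big/=; congr EFin; apply: eq_bigr => z _.
  by rewrite /F/=; ring.
under eq_integral do rewrite E.
rewrite integral_sum//; last first.
  by move=> z; have [] := incr_cov4 c (al z.1) (al z.2) (be z.1) (be z.2).
under eq_bigr do rewrite (incr_cov4 _ _ _ _ _).2.
rewrite sumEFin lee_fin.
rewrite -(pair_big p p (fun q q' => (if al q == al q' then m2 * 2 ^- n else 0) *
  (if be q == be q' then m2 * 2 ^- n else 0)))/=.
rewrite mulr_natl -sumr_const.
apply: (@le_trans _ _ (\sum_(q | p q) (m2 * 2 ^- n) ^+ 2)); last first.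
  by rewrite big_mkcond/=; apply: ler_sum => q _; case: ifP => // _; rewrite sqr_ge0.
apply: ler_sum => q pq; rewrite (bigD1 q)//= !eqxx -expr2 big1 ?addr0// => q' /andP[pq' q'q].
case: eqP => [aa|_]; last by rewrite mul0r.
case: eqP => [bb|_]; last by rewrite mulr0.
by move: q'q; rewrite (inj q q')// eqxx.
Qed.

(** Chebyshev's inequality for the sum of [area_L2]. *)
Lemma area_tail (Q : finType) (p : pred Q) (al be : Q -> nat) c (e : R) : 0 < e ->
  (forall q q', p q -> p q' -> al q = al q' -> be q = be q' -> q = q') ->
  fine (P [set w | e < `|\sum_(q | p q) x w (c, al q) * x w (~~ c, be q)|]) <=
   #|Q|%:R * (m2 * 2 ^- n) ^+ 2 / e ^+ 2.
Proof.
move=> e0 inj; set S := fun w => \sum_(q | p q) x w (c, al q) * x w (~~ c, be q).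
have mS : measurable_fun setT S.
  rewrite /S; under [X in measurable_fun _ X]funext do rewrite big_mkcond/=.
  apply: measurable_sum => q; case: (p q) => //.
  by apply: measurable_funM; exact: mx.
have mE : measurable [set w | e < `|S w|].
  rewrite (_ : [set w | _] = (fun w => `|S w|) @^-1` `]e, +oo[); last first.
    by apply/seteqP; split => w /=; rewrite in_itv/= andbT.
  rewrite -[X in measurable X]setTI.
  have m1 : measurable_fun setT (fun w => `|S w|) by exact: measurableT_comp.
  exact: m1.
rewrite ler_pdivlMr ?exprn_gt0// -lee_fin.
apply: le_trans (area_L2 c inj); rewrite EFinM fineK ?fin_num_measure//.
rewrite muleC.
have -> : ((e ^+ 2)%:E * P [set w | (e < `|S w|)%R] = \int[P]_w ((e ^+ 2)%:E * (\1_[set w | (e < `|S w|)%R] w)%:E))%E.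
  rewrite ge0_integralZl ?lee_fin ?sqr_ge0//; last by apply/measurable_EFinP; exact: measurable_indic.
  by rewrite integral_indic// setIT.
apply: ge0_le_integral => //.
- by move=> w _; rewrite -EFinM lee_fin mulr_ge0// sqr_ge0.
- by apply: emeasurable_funM => //; apply/measurable_EFinP; exact: measurable_indic.
- by apply/measurable_EFinP; exact: measurable_funX.
move=> w _; rewrite -EFinM lee_fin indicE.
have [/set_mem/=|_] := boolP (w \in _); last by rewrite mulr0 sqr_ge0.
move=> eS; rewrite mulr1 -[leRHS]real_normK ?num_real// ler_sqr ?nnegrE//; exact: ltW.
Qed.

End moments.

(** * Elementary rules for convergence in probability *)

Section cvg_prob.
Context {R : realType} {d : measure_display} {T : measurableType d}.
Variable P : probability T R.

Lemma measurable_dev (X Y : T -> R) (e : R) :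
  measurable_fun setT X -> measurable_fun setT Y -> measurable [set w | e < `|X w - Y w|].
Proof.
move=> mX mY.
rewrite (_ : [set w | _] = (fun w => `|X w - Y w|) @^-1` `]e, +oo[); last first.
  by apply/seteqP; split => w /=; rewrite in_itv/= andbT.
rewrite -[X in measurable X]setTI.
have m1 : measurable_fun setT (fun w => `|X w - Y w|); last exact: m1.
by apply: measurableT_comp => //; exact: measurable_funB.
Qed.

Lemma cvg_in_probP (Xn : nat -> T -> R) (X : T -> R) :
  (forall n, measurable_fun setT (Xn n)) -> measurable_fun setT X ->
  cvg_in_prob P Xn X <-> (forall e eta : R, 0 < e -> 0 < eta ->
    \forall n \near \oo, fine (P [set w | e < `|Xn n w - X w|]) <= eta).
Proof.
move=> mXn mX; split.
  move=> H e eta e0 eta0.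
  have /fine_cvgP[_ /cvgrPdist_le /(_ _ eta0)] := H e e0.
  apply: filterS => n; rewrite sub0r normrN /=.
  by apply: le_trans; exact: ler_norm.
move=> H e e0; apply/fine_cvgP; split.
  by near=> n; rewrite fin_num_measure//; exact: measurable_dev.
apply/cvgrPdist_le => eta eta0; apply: filterS (H e eta e0 eta0) => n.
by rewrite sub0r normrN /= ger0_norm// fine_ge0.
Unshelve. all: by end_near. Qed.

Lemma cvg_in_probB (Xn Yn : nat -> T -> R) (X Y : T -> R) :
  (forall n, measurable_fun setT (Xn n)) -> measurable_fun setT X ->
  (forall n, measurable_fun setT (Yn n)) -> measurable_fun setT Y ->
  cvg_in_prob P Xn X -> cvg_in_prob P Yn Y ->
  cvg_in_prob P (fun n w => Xn n w - Yn n w) (fun w => X w - Y w).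
Proof.
move=> mXn mX mYn mY /(cvg_in_probP mXn mX) cX /(cvg_in_probP mYn mY) cY.
apply/cvg_in_probP => [n||]; [exact: measurable_funB|exact: measurable_funB|].
move=> e eta e0 eta0.
have e2 : 0 < e / 2 by rewrite divr_gt0.
have eta2 : 0 < eta / 2 by rewrite divr_gt0.
near=> n.
have h1 : fine (P [set w | e / 2 < `|Xn n w - X w|]) <= eta / 2 by near: n; exact: cX.
have h2 : fine (P [set w | e / 2 < `|Yn n w - Y w|]) <= eta / 2 by near: n; exact: cY.
rewrite (splitr eta); apply: le_trans (lerD h1 h2).
apply: Pr_leU; try exact: measurable_dev.
  by apply: measurable_dev; exact: measurable_funB.
move=> w /= ew; have [h|h] := ltP (e / 2) `|Xn n w - X w|; [by left|right].
rewrite /= ltNge; apply/negP => h'.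
have : `|Xn n w - Yn n w - (X w - Y w)| <= `|Xn n w - X w| + `|Yn n w - Y w|.
  by rewrite (_ : _ - _ = (Xn n w - X w) - (Yn n w - Y w)) ?ler_normB//; ring.
by lra.
Unshelve. all: by end_near. Qed.

Lemma cvg_in_prob_near (Xn : nat -> T -> R) (X : T -> R) :
  (\forall n \near \oo, Xn n = X) -> cvg_in_prob P Xn X.
Proof.
move=> H e e0; apply: cvg_near_cst; apply: filterS H => n ->.
rewrite (_ : [set w | _] = set0) ?measure0//.
by apply/seteqP; split => w //=; rewrite subrr normr0 ltNge ltW.
Qed.

Lemma cvg_in_prob_shift (m : nat) (Xn : nat -> T -> R) (X : T -> R) :
  cvg_in_prob P (fun n => Xn (n + m)%N) X -> cvg_in_prob P Xn X.
Proof. by move=> H e e0; rewrite -(cvg_shiftn m); exact: (H e e0). Qed.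

End cvg_prob.

(** * Coarse and fine Riemann sums of the area *)

Section area.
Context {R : realType}.
Implicit Types x : bool * nat -> R.

(** The Ito sum over [N] blocks of [k] grid steps each; this is what [levy_area_sum] becomes at a
    dyadic time. *)
Definition coarse x (k N : nat) := 2^-1 * \sum_(i < N)
  (wk x true (k * i) * (wk x false (k * i.+1) - wk x false (k * i)) -
   wk x false (k * i) * (wk x true (k * i.+1) - wk x true (k * i))).

Lemma wkD x b p j : wk x b (p + j) = wk x b p + wk (shiftx p x) b j.
Proof. by have := walkD x p j; rewrite /walk /hmul/= => -[]; case: b. Qed.

Lemma arD x p j : ar x (p + j) = ar x p + ar (shiftx p x) j +
  (wk x true p * wk (shiftx p x) false j - wk x false p * wk (shiftx p x) true j) / 2.
Proof. by have := walkD x p j; rewrite /walk /hmul/= => -[]. Qed.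

(** By the cocycle rule [arD], refining the mesh changes the sum exactly by the areas enclosed
    inside the blocks. *)
Lemma ar_coarse x k N :
  ar x (k * N) = coarse x k N + \sum_(i < N) ar (shiftx (k * i) x) k.
Proof.
elim: N => [|N IH]; first by rewrite muln0 /coarse /ar !big_ord0 addr0.
rewrite mulnS addnC arD IH /coarse !big_ord_recr/= mulnS [(k + _)%N]addnC !wkD.
by field.
Qed.

(** Inside a block the area pairs an earlier increment of one coordinate with a later one of the
    other. A triple [q] consists of the block, the later index and the earlier index, the form to
    which [area_tail] applies. *)
Lemma ar_blocks x k N : \sum_(i < N) ar (shiftx (k * i) x) k =
  2^-1 * ((\sum_(q : 'I_N * 'I_k * 'I_k | (q.2 < q.1.2)%N)
              x (true, (k * q.1.1 + q.2)%N) * x (false, (k * q.1.1 + q.1.2)%N)) -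
          (\sum_(q : 'I_N * 'I_k * 'I_k | (q.2 < q.1.2)%N)
              x (false, (k * q.1.1 + q.2)%N) * x (true, (k * q.1.1 + q.1.2)%N))).
Proof.
have E c : \sum_(q : 'I_N * 'I_k * 'I_k | (q.2 < q.1.2)%N)
              x (c, (k * q.1.1 + q.2)%N) * x (~~ c, (k * q.1.1 + q.1.2)%N) =
    \sum_(i < N) \sum_(b < k) wk (shiftx (k * i) x) c b * shiftx (k * i) x (~~ c, nat_of_ord b).
  rewrite pair_bigA/=.
  rewrite -(@pair_big_dep _ _ _ _ _ xpredT (fun q a => (nat_of_ord a < nat_of_ord q.2)%N)
    (fun (q : 'I_N * 'I_k) (a : 'I_k) => x (c, (k * q.1 + a)%N) * x (~~ c, (k * q.1 + q.2)%N)))/=.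
  apply: eq_bigr => q _; rewrite -mulr_suml; congr (_ * _).
  rewrite /wk /shiftx/= (big_ord_widen k (fun j => x (c, (k * q.1 + j)%N)))//.
  exact: ltnW.
rewrite (E true) (E false) -sumrB mulr_sumr; apply: eq_bigr => i _.
by rewrite /ar -sumrB.
Qed.

End area.

(** * The area as a limit along one dyadic grid *)

Section hbm.
Context {R : realType} {d : measure_display} {T : measurableType d}.
Variable P : probability T R.
Implicit Types (W A : R -> T -> R).

Definition levy_lim W1 W2 A := (forall t, measurable_fun setT (A t)) /\
  (forall t, 0 <= t -> cvg_in_prob P (fun n => levy_area_sum W1 W2 n t) (A t)).

(** In [levy_lim] the partition depends on [t]. Here all dyadic times share the grid of mesh
    [2^-(n + m)], so that areas at different times can be combined and shifted. *)
Definition HBM W1 W2 A := [/\ BMinc P W1 W2, forall t, measurable_fun setT (A t) &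
  forall m k, cvg_in_prob P (fun n w => ar (incr W1 W2 (n + m) w) (k * 2 ^ n)%N)
                (A (dyt m k))].

Lemma dyt0 n : dyt n 0 = 0 :> R.
Proof. by rewrite /dyt mul0r. Qed.

Lemma wk_incr W1 W2 n w b j : BMinc P W1 W2 ->
  wk (incr W1 W2 n w) b j = (if b then W1 else W2) (dyt n j) w.
Proof.
move=> [_ W0 _]; elim: j => [|j IH].
  by rewrite /wk big_ord0 dyt0; have [] := W0 w; case: b.
by rewrite wkS IH /incr/= addrC subrK.
Qed.

Lemma levy_area_coarse W1 W2 n m k w : BMinc P W1 W2 ->
  levy_area_sum W1 W2 n (dyt m k) w = coarse (incr W1 W2 (n + m) w) k (2 ^ n).
Proof.
move=> BM; rewrite /levy_area_sum /coarse; congr (_ * _); apply: eq_bigr => i _.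
have E j : dyt m k * j%:R / (2 ^ n)%:R = dyt (n + m) (k * j) :> R.
  by rewrite /dyt natrM exprD natrX; field; rewrite !expf_neq0.
by rewrite /= !E !(wk_incr _ _ _ _ BM).
Qed.

Lemma measurable_ar W1 W2 n j : BMinc P W1 W2 ->
  measurable_fun setT (fun w => ar (incr W1 W2 n w) j).
Proof.
move=> BM; apply: (measurable_walk j None) => i.
exact: (measurableT_comp (measurable_coord i) (measurable_incr n BM)).
Qed.

(** At time [k / 2^m] the two approximations differ by areas inside blocks of [k] steps, whose
    second moment is of order [2^-n]. *)
Lemma levy_HBM W1 W2 A : BMinc P W1 W2 -> levy_lim W1 W2 A -> HBM W1 W2 A.
Proof.
move=> BM [mA cA]; split => // m k.
have t0 : 0 <= dyt m k :> R by rewrite /dyt divr_ge0// exprn_ge0.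
have [m2 [m20 Hm2]] := @normal_prob_sqr R.
pose Dn n w := coarse (incr W1 W2 (n + m) w) k (2 ^ n) - ar (incr W1 W2 (n + m) w) (k * 2 ^ n)%N.
have mlev n : measurable_fun setT (levy_area_sum W1 W2 n (dyt m k)).
  have [mW _ _] := BM.
  apply: measurable_funM => //; apply: measurable_sum => i.
  by apply: measurable_funB; apply: measurable_funM => //; try apply: measurable_funB;
    [have [] := mW (dyt m k * i%:R / (2 ^ n)%:R)|have [] := mW (dyt m k * i.+1%:R / (2 ^ n)%:R)
    |have [] := mW (dyt m k * i%:R / (2 ^ n)%:R)|have [] := mW (dyt m k * i%:R / (2 ^ n)%:R)
    |have [] := mW (dyt m k * i.+1%:R / (2 ^ n)%:R)|have [] := mW (dyt m k * i%:R / (2 ^ n)%:R)].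
have mar n := measurable_ar (n + m) (k * 2 ^ n) BM.
have mDn n : measurable_fun setT (Dn n).
  apply: measurable_funB => //; rewrite [X in measurable_fun _ X](_ : _ = levy_area_sum W1 W2 n (dyt m k))//.
  by apply/funext => w; rewrite levy_area_coarse.
suff cD : cvg_in_prob P Dn (cst 0).
  have mc : measurable_fun setT (cst (0 : R) : T -> R) by [].
  have := cvg_in_probB mlev (mA _) mDn mc (cA _ t0) cD.
  rewrite (_ : (fun w => _ - _) = A (dyt m k)); last by apply/funext => w; rewrite subr0.
  rewrite (_ : (fun n w => _ - _) = (fun n w => ar (incr W1 W2 (n + m) w) (k * 2 ^ n)%N))//.
  apply/funext => n; apply/funext => w; rewrite levy_area_coarse// /Dn; ring.
apply/cvg_in_probP => // e eta e0 eta0.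
(* Each of the two sums has at most [2^n k^2] terms of second moment [(m2 2^-(n + m))^2]; after
   Chebyshev a factor [2^-n] remains. *)
pose C : R := 2 * (k%:R * k%:R) * (m2 / 2 ^+ m) ^+ 2 / e ^+ 2.
have : C * 2^-1 ^+ n @[n --> \oo] --> C * 0.
  apply: cvgMr; apply: cvg_expr; rewrite gtr0_norm// invf_lt1//; lra.
rewrite mulr0 => /cvgrPdist_le /(_ _ eta0); apply: filterS => n.
rewrite sub0r normrN => /(le_trans (ler_norm _)); apply: le_trans.
pose x w := incr W1 W2 (n + m) w.
pose S c w := \sum_(q : 'I_(2 ^ n) * 'I_k * 'I_k | (q.2 < q.1.2)%N)
  x w (c, (k * q.1.1 + q.2)%N) * x w (~~ c, (k * q.1.1 + q.1.2)%N).
have tail c : fine (P [set w | e < `|S c w|]) <=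
    #|{: 'I_(2 ^ n) * 'I_k * 'I_k}|%:R * (m2 * 2 ^- (n + m)) ^+ 2 / e ^+ 2.
  apply: (area_tail (n + m) BM Hm2 (al := fun q : 'I_(2 ^ n) * 'I_k * 'I_k => (k * q.1.1 + q.2)%N) (be := fun q => (k * q.1.1 + q.1.2)%N) c) => //.
  move=> [[i b] a] [[i' b'] a'] /= _ _ Ea Eb.
  have k0 : (0 < k)%N by exact: leq_ltn_trans (ltn_ord a).
  have ii : i = i'.
    apply/val_inj => /=; have := congr1 (fun z => z %/ k)%N Ea.
    by rewrite ![(k * _)%N]mulnC !divnMDl// !divn_small// !addn0.
  rewrite ii in Ea Eb *; move/addnI : Ea => /val_inj ->.
  by move/addnI : Eb => /val_inj ->.
have mS c : measurable_fun setT (S c).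
  rewrite /S; under [X in measurable_fun _ X]funext do rewrite big_mkcond/=.
  apply: measurable_sum => q; case: (q.2 < q.1.2)%N => //.
  by apply: measurable_funM; exact: (measurableT_comp (measurable_coord _) (measurable_incr _ BM)).
have mE c : measurable [set w | e < `|S c w|].
  rewrite (_ : [set w | _] = [set w | e < `|S c w - 0|]); first exact: measurable_dev.
  by apply/seteqP; split => w /=; rewrite subr0.
apply: le_trans (_ : _ <= fine (P [set w | e < `|S true w|]) + fine (P [set w | e < `|S false w|])) _.
  apply: Pr_leU => //; first exact: measurable_dev.
  move=> w /=; rewrite subr0 /Dn ar_coarse ar_blocks -/(S true w) -/(S false w) => ew.
  have [h|h] := ltP e `|S true w|; [by left|right].
  rewrite /= ltNge; apply/negP => h'; move: ew.
  rewrite opprD addrA subrr add0r normrN normrM gtr0_norm//.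
  have := ler_normB (S true w) (S false w); lra.
apply: le_trans (lerD (tail true) (tail false)) _.
rewrite !card_prod !card_ord !natrM natrX /C exprD.
rewrite le_eqVlt; apply/orP; left; apply/eqP; rewrite exprVn.
have e1 : e != 0 by rewrite gt_eqF.
have e2 j : 2 ^+ j != 0 :> R by rewrite expf_neq0.
by field; rewrite e1 !e2.
Qed.

End hbm.

(** * Law of the sampled path: Markov property, symmetries, scaling *)

Section path_law.
Context {R : realType} {d : measure_display} {T : measurableType d}.
Variable P : probability T R.
Implicit Types (W A : R -> T -> R).

(* [(Some true, (m, k))], [(Some false, (m, k))] and [(None, (m, k))] index the values
   at time [k / 2^m] of the first coordinate, the second coordinate and the area. *)
Definition idx : Type := option bool * (nat * nat).

Definition gpt W1 W2 A (t : R) (w : T) : R * R * R := (W1 t w, W2 t w, A t w).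

Definition pth W1 W2 A (w : T) : pathT R idx :=
  fun i => sel i.1 (gpt W1 W2 A (dyt i.2.1 i.2.2) w).

(* The walk with mesh [2^-n] at time [k / 2^m], rounded down to the grid when [n < m]. *)
Definition pwalk n (x : pathT R (bool * nat)) : pathT R idx :=
  fun i => sel i.1 (walk x (i.2.2 * 2 ^ n %/ 2 ^ i.2.1)).

Definition stop (tau : nat) (x : pathT R idx) : pathT R idx :=
  fun i => x (i.1, (i.2.1, minn i.2.2 (tau * 2 ^ i.2.1))).

Definition Wshift W (tau : nat) (t : R) (w : T) := W (tau%:R + t) w - W tau%:R w.

(** The area of the left-translated path, not the difference of areas: the cross term is removed so
    that [gpt_shift] is a group product. *)
Definition Ashift W1 W2 A (tau : nat) (t : R) (w : T) :=
  A (tau%:R + t) w - (A tau%:R w +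
    (W1 tau%:R w * Wshift W2 tau t w - W2 tau%:R w * Wshift W1 tau t w) / 2).

Lemma gpt_shift W1 W2 A tau t w : gpt W1 W2 A (tau%:R + t) w =
  hmul (gpt W1 W2 A tau%:R w)
    (gpt (Wshift W1 tau) (Wshift W2 tau) (Ashift W1 W2 A tau) t w).
Proof. by rewrite /gpt /hmul /Ashift /Wshift /=; congr (_, _, _); field. Qed.

Lemma pow2_neq0 j : 2 ^+ j != 0 :> R.
Proof. by rewrite expf_neq0. Qed.

Lemma dytD tau m k : tau%:R + dyt m k = dyt m (tau * 2 ^ m + k) :> R.
Proof. by rewrite /dyt natrD natrM natrX mulrDl mulfK// expf_neq0. Qed.

Lemma BMinc_shift W1 W2 tau : BMinc P W1 W2 -> BMinc P (Wshift W1 tau) (Wshift W2 tau).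
Proof.
move=> [mW W0 H]; split.
- move=> t; split; apply: measurable_funB.
  + by have [] := mW (tau%:R + t).
  + by have [] := mW tau%:R.
  + by have [] := mW (tau%:R + t).
  + by have [] := mW tau%:R.
- by move=> w; rewrite /Wshift !addr0 !subrr.
move=> n t B C t0 tS mB mC.
have E i : tau%:R + t i.+1 - (tau%:R + t i) = t i.+1 - t i by ring.
have t0' : 0 <= tau%:R + t 0%N by rewrite addr_ge0.
have tS' i : (i < n)%N -> tau%:R + t i < tau%:R + t i.+1 by move=> /tS; rewrite ltrD2l.
rewrite (eq_bigr (fun i : 'I_n =>
  normal_prob 0 (Num.sqrt (tau%:R + t i.+1 - (tau%:R + t i))) (B i) *
  normal_prob 0 (Num.sqrt (tau%:R + t i.+1 - (tau%:R + t i))) (C i))%E); last first.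
  by move=> i _; rewrite (E i).
rewrite -(H n (fun i => tau%:R + t i) B C t0' tS' mB mC).
congr (P _); apply: eq_bigcapr => i _.
have D W w : Wshift W tau (t i.+1) w - Wshift W tau (t i) w =
    W (tau%:R + t i.+1) w - W (tau%:R + t i) w by rewrite /Wshift; ring.
by apply/seteqP; split => w /=; rewrite !D.
Qed.

Lemma incr_shift W1 W2 tau n w : 
  incr (Wshift W1 tau) (Wshift W2 tau) n w = shiftx (tau * 2 ^ n) (incr W1 W2 n w).
Proof.
apply/funext => -[b i]; rewrite /incr /shiftx/= /Wshift -addnS.
by case: b; rewrite !dytD; ring.
Qed.

(** For walks the area after a restart is an exact algebraic expression in areas and positions of
    the original walk; each of its terms converges. *)
Lemma HBM_shift W1 W2 A tau : HBM P W1 W2 A ->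
  HBM P (Wshift W1 tau) (Wshift W2 tau) (Ashift W1 W2 A tau).
Proof.
move=> [BM mA cA].
have BMs := BMinc_shift tau BM.
have mWs c t : measurable_fun setT (Wshift (if c then W1 else W2) tau t).
  by have [mW _ _] := BMs; have [] := mW t; case: c.
have mWt c : measurable_fun setT ((if c then W1 else W2) (tau%:R)).
  by have [mW _ _] := BM; have [] := mW tau%:R; case: c.
have mcst t : measurable_fun setT (fun w => (W1 tau%:R w * Wshift W2 tau t w - W2 tau%:R w * Wshift W1 tau t w) / 2).
  apply: measurable_funM => //; apply: measurable_funB; apply: measurable_funM.
  - exact: (mWt true).
  - exact: (mWs false).
  - exact: (mWt false).
  - exact: (mWs true).
split => //.
  move=> t; apply: measurable_funB => //; exact: measurable_funD.
move=> m k; pose t : R := dyt m k.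
pose cst w := (W1 tau%:R w * Wshift W2 tau t w - W2 tau%:R w * Wshift W1 tau t w) / 2.
(* The cross term is the same for every [n]; only the areas at the two times [tau + k / 2^m] and
   [tau] have to be passed to the limit. *)
have c1 := cA m (tau * 2 ^ m + k)%N.
have c2 := cA m (tau * 2 ^ m)%N.
have mar n m' j := measurable_ar (n + m') j BM.
have c3 : cvg_in_prob P (fun n w => - cst w) (fun w => - cst w).
  by apply: cvg_in_prob_near; near=> n.
have mc : measurable_fun setT (fun w => - cst w) by apply: measurable_funN; exact: mcst.
have mc' (n : nat) : measurable_fun setT (fun w => - cst w) := mc.
have c4 := cvg_in_probB (fun n => mar n m (tau * 2 ^ m * 2 ^ n)%N) (mA _) mc' mc c2 c3.
have m4 n : measurable_fun setT (fun w => ar (incr W1 W2 (n + m) w) (tau * 2 ^ m * 2 ^ n) - - cst w).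
  exact: measurable_funB.
have m4' : measurable_fun setT (fun w => A (dyt m (tau * 2 ^ m)) w - - cst w).
  exact: measurable_funB.
have c5 := cvg_in_probB (fun n => mar n m ((tau * 2 ^ m + k) * 2 ^ n)%N) (mA _) m4 m4' c1 c4.
have Et : tau%:R = dyt m (tau * 2 ^ m) :> R by rewrite -(addr0 tau%:R) -(dyt0 m) dytD addn0.
rewrite (_ : Ashift _ _ _ _ _ = (fun w => A (dyt m (tau * 2 ^ m + k)) w - (A (dyt m (tau * 2 ^ m)) w - - cst w))); last first.
  by apply/funext => w; rewrite /Ashift -Et dytD opprK.
rewrite (_ : (fun n w => _) = (fun n w => ar (incr W1 W2 (n + m) w) ((tau * 2 ^ m + k) * 2 ^ n)
   - (ar (incr W1 W2 (n + m) w) (tau * 2 ^ m * 2 ^ n) - - cst w)))//.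
apply/funext => n; apply/funext => w.
have -> : (tau * 2 ^ m * 2 ^ n = tau * 2 ^ (n + m))%N by rewrite -mulnA -expnD addnC.
have -> : ((tau * 2 ^ m + k) * 2 ^ n = tau * 2 ^ (n + m) + k * 2 ^ n)%N.
  by rewrite mulnDl -mulnA -expnD [(m + n)%N]addnC.
rewrite incr_shift arD -incr_shift !(wk_incr _ _ _ _ BM) !(wk_incr _ _ _ _ BMs) /=.
have -> : dyt (n + m) (tau * 2 ^ (n + m)) = tau%:R :> R.
  by rewrite -[in RHS](addr0 tau%:R) -(dyt0 (n + m)) dytD addn0.
have -> : dyt (n + m) (k * 2 ^ n) = t.
  by rewrite /t /dyt natrM natrX exprD; field; rewrite !pow2_neq0.
rewrite /cst; ring.
Unshelve. all: by end_near. Qed.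

Lemma measurable_pwalk n : measurable_fun setT (pwalk n).
Proof.
by apply: measurable_path => i; apply: measurable_walk => j; exact: measurable_coord.
Qed.

Lemma measurable_stop tau : measurable_fun setT (stop tau).
Proof. by apply: measurable_path => i; exact: measurable_coord. Qed.

Lemma measurable_pth W1 W2 A : HBM P W1 W2 A -> measurable_fun setT (pth W1 W2 A).
Proof.
move=> [[mW _ _] mA _]; apply: measurable_path => -[[[]|] [m k]].
- by have [] := mW (dyt m k).
- by have [] := mW (dyt m k).
- exact: mA.
Qed.

(** Once [n >= m] the time [k / 2^m] lies on the grid, where the Brownian coordinates of the walk
    are exact; only the area involves a genuine limit. *)
Lemma pwalk_cvg W1 W2 A i : HBM P W1 W2 A ->
  cvg_in_prob P (fun n w => pwalk n (incr W1 W2 n w) i) (fun w => pth W1 W2 A w i).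
Proof.
move=> [BM mA cA]; case: i => c [m k].
apply: (@cvg_in_prob_shift _ _ _ _ m).
have E n : (k * 2 ^ (n + m) %/ 2 ^ m = k * 2 ^ n)%N.
  by rewrite expnD mulnA mulnK// expn_gt0.
have E' n : dyt (n + m) (k * 2 ^ n) = dyt m k :> R.
  by rewrite /dyt natrM natrX exprD; field; rewrite !pow2_neq0.
case: c => [b|]; last first.
  rewrite (_ : (fun n => _) = (fun n w => ar (incr W1 W2 (n + m) w) (k * 2 ^ n)%N)); first exact: cA.
  by apply/funext => n; apply/funext => w; rewrite /pwalk/= E.
apply: cvg_in_prob_near; near=> n; apply/funext => w; rewrite /pwalk /pth/= E.
by rewrite -(E' n); case: b; rewrite /= (wk_incr _ _ _ _ BM).
Unshelve. all: by end_near. Qed.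

Definition extx p (x : pathT R (bool * 'I_p)) : pathT R (bool * nat) :=
  fun i => if insub i.2 is Some j then x (i.1, j) else 0.

Lemma measurable_extx p : measurable_fun setT (@extx p).
Proof.
apply: measurable_path => -[b i]; rewrite /extx/=.
by case: insub => [j|]; [exact: measurable_coord|exact: measurable_cst].
Qed.

(** The walk stopped at [tau] is a function of its first [tau * 2 ^ n] increments; [extx] pads them
    with zeros, which the stopped walk never reads. *)
Lemma stop_pwalk tau n (x : pathT R (bool * nat)) :
  stop tau (pwalk n x) = stop tau (pwalk n (extx (pinc (tau * 2 ^ n)%N x))).
Proof.
apply/funext => -[c [m k]]; rewrite /stop /pwalk/=; congr (sel c _).
apply: eq_walk => b i ij; rewrite /extx /pinc/=.
case: insubP => [j _ <- //|]; rewrite -leqNgt => H; exfalso.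
have : (i < tau * 2 ^ n)%N.
  apply: leq_trans ij _; rewrite -[leqRHS](@mulnK _ (2 ^ m)) ?expn_gt0//.
  by apply: leq_div2r; rewrite [leqRHS]mulnAC leq_mul2r geq_minr orbT.
by rewrite ltnNge H.
Qed.

(** The simple Markov property at integer times: independence of the increments of the walk before
    and after [tau], carried to the limit by [box_limit]. The future has the law of any other
    process satisfying [HBM]. *)
Lemma path_indep W1 W2 A W1' W2' A' tau :
  HBM P W1 W2 A -> HBM P W1' W2' A' ->
  forall S S' : set (pathT R idx), measurable S -> measurable S' ->
  P ((stop tau \o pth W1 W2 A) @^-1` S `&`
     pth (Wshift W1 tau) (Wshift W2 tau) (Ashift W1 W2 A tau) @^-1` S') =
  (P ((stop tau \o pth W1 W2 A) @^-1` S) * P (pth W1' W2' A' @^-1` S'))%E.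
Proof.
move=> H H'; have Hs := HBM_shift tau H.
have mst := measurable_stop tau.
have mp := measurable_pth H; have mp' := measurable_pth H'; have mps := measurable_pth Hs.
have [BM _ _] := H; have [BM' _ _] := H'; have [BMs _ _] := Hs.
apply: (@indep_gen _ _ _ _ _ (pathT R idx) (pathT R idx) P boxes boxes) => //.
- exact: setI_closed_boxes.
- by exists [::] => //; exact: box_nil.
- exact: setI_closed_boxes.
- by exists [::] => //; exact: box_nil.
- exact: measurableT_comp.
move=> _ _ [s _ <-] [s' _ <-].
have mpw n U1 U2 : BMinc P U1 U2 -> measurable_fun setT (fun w => pwalk n (incr U1 U2 n w)).
  by move=> BMU; exact: (measurableT_comp (measurable_pwalk n) (measurable_incr n BMU)).
apply: (@box_limit _ _ _ P _ _
  (fun n w => stop tau (pwalk n (incr W1 W2 n w))) (stop tau \o pth W1 W2 A)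
  (fun n w => pwalk n (incr (Wshift W1 tau) (Wshift W2 tau) n w)) _
  (fun n w => pwalk n (incr W1' W2' n w))) => //.
- by move=> n; apply: (measurableT_comp mst); exact: mpw.
- exact: measurableT_comp.
- by move=> n; exact: mpw.
- by move=> n; exact: mpw.
- by move=> i; exact: (pwalk_cvg _ H).
- by move=> i; exact: (pwalk_cvg _ Hs).
- by move=> i; exact: (pwalk_cvg _ H').
move=> {}s {}s'; near=> n.
pose p := (tau * 2 ^ n)%N.
have := incr_indep n BM BM' (p := p)
  (A := (fun y => stop tau (pwalk n (extx y))) @^-1` box s)
  (B := pwalk n @^-1` box s').
have -> : (shiftx p \o incr W1 W2 n) @^-1` (pwalk n @^-1` box s') =
    (fun w => pwalk n (incr (Wshift W1 tau) (Wshift W2 tau) n w)) @^-1` box s'.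
  by apply/seteqP; split => w /=; rewrite incr_shift.
have -> : (pinc p \o incr W1 W2 n) @^-1` ((fun y => stop tau (pwalk n (extx y))) @^-1` box s) =
    (fun w => stop tau (pwalk n (incr W1 W2 n w))) @^-1` box s.
  by apply/seteqP; split => w /=; rewrite (stop_pwalk tau n (incr W1 W2 n w)).
apply.
  apply: measurable_preim; last exact: measurable_box.
  apply: (measurableT_comp mst); apply: (measurableT_comp (measurable_pwalk n)).
  exact: measurable_extx.
by apply: measurable_preim; [exact: measurable_pwalk|exact: measurable_box].
Unshelve. all: by end_near. Qed.

(** Take [tau = 0] and the full past: the path restarted at time 0 has the law of each of the two
    paths. *)
Lemma path_law W1 W2 A W1' W2' A' : HBM P W1 W2 A -> HBM P W1' W2' A' ->
  forall S : set (pathT R idx), measurable S ->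
  P (pth W1 W2 A @^-1` S) = P (pth W1' W2' A' @^-1` S).
Proof.
move=> H H' S mS.
have := path_indep 0 H H' (@measurableT _ (pathT R idx)) mS.
have := path_indep 0 H H (@measurableT _ (pathT R idx)) mS.
by rewrite !preimage_setT !setTI probability_setT !mul1e => -> .
Qed.

(** Reflecting one Brownian coordinate, like exchanging the two, reverses the orientation and hence
    the area. *)
Lemma HBM_neg W1 W2 A : HBM P W1 W2 A ->
  HBM P (fun t w => - W1 t w) W2 (fun t w => - A t w).
Proof.
move=> [[mW W0 H] mA cA]; split.
- split.
  + move=> t; split; last by have [] := mW t.
    by apply: measurableT_comp => //; have [] := mW t.
  + by move=> w; have [-> ->] := W0 w; rewrite oppr0.
  + move=> n t B C t0 tS mB mC.
    pose B' i := [set x | B i (- x)].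
    have mB' i : measurable (B' i).
      rewrite -[X in measurable X]setTI.
      by apply: (measurable_funN (@measurable_id _ R setT)) => //; exact: mB.
    have := H n t B' C t0 tS mB' mC.
    under [X in _ = X -> _]eq_bigr => i _ do rewrite -normal_probN ?sqrtr_gt0 ?subr_gt0 ?tS//.
    move=> <-; congr (P _); apply: eq_bigcapr => i _.
    by apply/seteqP; split => w /=; rewrite /B'/= opprB opprK addrC.
- by move=> t; exact: measurableT_comp.
move=> m k e e0; have := cA m k e e0.
under [X in X @ _ --> _ -> _]eq_fun do idtac.
rewrite (_ : (fun n => P _) = (fun n => P [set w | e < `|ar (incr (fun t w0 => - W1 t w0) W2 (n + m) w) (k * 2 ^ n) - - A (dyt m k) w|]))//.
apply/funext => n; congr (P _).
have arN w j : ar (incr (fun t w0 => - W1 t w0) W2 (n + m) w) j = - ar (incr W1 W2 (n + m) w) j /\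
   wk (incr (fun t w0 => - W1 t w0) W2 (n + m) w) true j = - wk (incr W1 W2 (n + m) w) true j /\
   wk (incr (fun t w0 => - W1 t w0) W2 (n + m) w) false j = wk (incr W1 W2 (n + m) w) false j.
  elim: j => [|j [IH1 [IH2 IH3]]]; first by rewrite /ar /wk !big_ord0 !mulr0 oppr0.
  by rewrite !arS !wkS IH1 IH2 IH3 /incr/=; split; [|split]; field.
by apply/seteqP; split => w /=; rewrite (arN w _).1 -opprD normrN.
Qed.

Lemma HBM_swap W1 W2 A : HBM P W1 W2 A -> HBM P W2 W1 (fun t w => - A t w).
Proof.
move=> [[mW W0 H] mA cA]; split.
- split.
  + by move=> t; have [] := mW t.
  + by move=> w; have [] := W0 w.
  + move=> n t B C t0 tS mB mC.
    have := H n t C B t0 tS mC mB.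
    under [X in _ = X -> _]eq_bigr => i _ do rewrite muleC.
    by move=> <-; congr (P _); apply: eq_bigcapr => i _; rewrite setIC.
- by move=> t; exact: measurableT_comp.
move=> m k e e0; have := cA m k e e0.
rewrite (_ : (fun n => P _) = (fun n => P [set w | e < `|ar (incr W2 W1 (n + m) w) (k * 2 ^ n) - - A (dyt m k) w|]))//.
apply/funext => n; congr (P _).
have arN w j : ar (incr W2 W1 (n + m) w) j = - ar (incr W1 W2 (n + m) w) j /\
   wk (incr W2 W1 (n + m) w) true j = wk (incr W1 W2 (n + m) w) false j /\
   wk (incr W2 W1 (n + m) w) false j = wk (incr W1 W2 (n + m) w) true j.
  elim: j => [|j [IH1 [IH2 IH3]]]; first by rewrite /ar /wk !big_ord0 !mulr0 oppr0.
  by rewrite !arS !wkS IH1 IH2 IH3 /incr/=; split; [|split]; field.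
by apply/seteqP; split => w /=; rewrite (arN w _).1 -opprD normrN.
Qed.

Definition scaleW (c : R) W (t : R) (w : T) := c * W (t / c ^+ 2) w.
Definition scaleA (c : R) A (t : R) (w : T) := c ^+ 2 * A (t / c ^+ 2) w.

(** The starting point is [levy_lim] and not [HBM], because scaling a dyadic time by [c ^+ 2] need
    not give a dyadic time. *)
Lemma HBM_scale (c : R) W1 W2 A : 0 < c -> BMinc P W1 W2 -> levy_lim P W1 W2 A ->
  HBM P (scaleW c W1) (scaleW c W2) (scaleA c A).
Proof.
move=> c0 [mW W0 H] [mA cA].
have c20 : 0 < c ^+ 2 by rewrite exprn_gt0.
apply: levy_HBM; split.
- by move=> t; split; apply: measurable_funM => //; have [] := mW (t / c ^+ 2).
- by move=> w; rewrite /scaleW mul0r; have [-> ->] := W0 w; rewrite mulr0.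
- move=> n t B C t0 tS mB mC.
  pose t' i := t i / c ^+ 2.
  have t'0 : 0 <= t' 0%N by rewrite divr_ge0// ltW.
  have t'S i : (i < n)%N -> t' i < t' i.+1 by move=> /tS; rewrite ltr_pM2r ?invr_gt0.
  have mcB (D : nat -> set R) i : (forall i, measurable (D i)) -> measurable [set x | D i (c * x)].
    move=> mD; rewrite -[X in measurable X]setTI.
    by apply: (measurable_funM (@measurable_cst _ _ _ _ setT c) (@measurable_id _ R setT)) => //; exact: mD.
  have := H n t' (fun i => [set x | B i (c * x)]) (fun i => [set x | C i (c * x)]) t'0 t'S
    (fun i => mcB B i mB) (fun i => mcB C i mC).
  have E i : Num.sqrt (t i.+1 - t i) = c * Num.sqrt (t' i.+1 - t' i).
    rewrite -[X in X * _](gtr0_norm c0) -sqrtr_sqr -sqrtrM ?sqr_ge0//; congr Num.sqrt.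
    by rewrite /t'; field; rewrite gt_eqF.
  under [X in _ -> _ = X]eq_bigr => i _ do rewrite E !normal_probZ ?sqrtr_gt0 ?subr_gt0 ?t'S//.
  move=> <-; congr (P _); apply: eq_bigcapr => i _.
  by apply/seteqP; split => w /=; rewrite /scaleW -!mulrBr.
- by move=> t; apply: measurable_funM.
move=> t t0 e e0.
have t'0 : 0 <= t / c ^+ 2 by rewrite divr_ge0// ltW.
have e'0 : 0 < e / c ^+ 2 by rewrite divr_gt0.
have := cA _ t'0 _ e'0.
rewrite (_ : (fun n => P _) = (fun n => P [set w | e < `|levy_area_sum (scaleW c W1) (scaleW c W2) n t w - scaleA c A t w|]))//.
apply/funext => n; congr (P _).
have E w : levy_area_sum (scaleW c W1) (scaleW c W2) n t w = c ^+ 2 * levy_area_sum W1 W2 n (t / c ^+ 2) w.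
  rewrite /levy_area_sum [RHS]mulrCA; congr (_ * _).
  rewrite mulr_sumr; apply: eq_bigr => i _.
  rewrite /scaleW /=.
  have F j : t * j%:R / (2 ^ n)%:R / c ^+ 2 = t / c ^+ 2 * j%:R / (2 ^ n)%:R by ring.
  by rewrite !F; ring.
by apply/seteqP; split => w /=; rewrite E -mulrBr normrM (gtr0_norm c20) ltr_pdivrMr// mulrC.
Qed.

End path_law.

(** * Geometry of the homogeneous norm *)

Section heisenberg_norm.
Context {R : realType}.
Implicit Types (v u g k h : R * R * R) (r : R).

Definition N4 v := (v.1.1 ^+ 2 + v.1.2 ^+ 2) ^+ 2 + v.2 ^+ 2.
Definition hn v := hnorm v.1.1 v.1.2 v.2.

Lemma N4_ge0 v : 0 <= N4 v.
Proof. by rewrite addr_ge0 ?sqr_ge0. Qed.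

Lemma hn_ge0 v : 0 <= hn v.
Proof. by rewrite sqrtr_ge0. Qed.

Lemma hn4 v : hn v ^+ 4 = N4 v.
Proof. by rewrite /hn /hnorm (exprM _ 2 2) !sqr_sqrtr ?sqrtr_ge0// N4_ge0. Qed.

Lemma hn_le v r : 0 <= r -> (hn v <= r) = (N4 v <= r ^+ 4).
Proof. by move=> r0; rewrite -hn4 ler_pXn2r// nnegrE hn_ge0. Qed.

Lemma sqr_leW (a b : R) : 0 <= b -> a ^+ 2 <= b ^+ 2 -> a <= b.
Proof.
move=> b0 ab; rewrite leNgt; apply/negP => ba.
by nra.
Qed.

Lemma minkowski2 (p q r s a b : R) : 0 <= a -> 0 <= b ->
  p ^+ 2 + r ^+ 2 <= a ^+ 2 -> q ^+ 2 + s ^+ 2 <= b ^+ 2 ->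
  (p + q) ^+ 2 + (r + s) ^+ 2 <= (a + b) ^+ 2.
Proof.
move=> a0 b0 pa qb.
have : p * q + r * s <= a * b.
  apply: sqr_leW; first exact: mulr_ge0.
  rewrite exprMn.
  apply: (@le_trans _ _ ((p ^+ 2 + r ^+ 2) * (q ^+ 2 + s ^+ 2))).
    by have := sqr_ge0 (p * s - q * r); nra.
  by apply: ler_pM => //; rewrite addr_ge0 ?sqr_ge0.
nra.
Qed.

Lemma hn_xy v : v.1.1 ^+ 2 + v.1.2 ^+ 2 <= hn v ^+ 2.
Proof.
apply: sqr_leW; first by rewrite sqr_ge0.
by rewrite -exprM hn4 /N4 lerDl sqr_ge0.
Qed.

Lemma hn_z v : v.2 ^+ 2 <= hn v ^+ 4.
Proof. by rewrite hn4 /N4 lerDr sqr_ge0. Qed.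

(** Regard [(x^2 + y^2, z)] as a plane vector, of length [hn v ^+ 2]. The vector of a product is the
    sum of the vectors of both factors and of one made of twice the inner product and half the
    symplectic form, of length at most [2 hn v hn u]. Minkowski's inequality then yields
    [(hn v + hn u) ^+ 2]. *)
Lemma hn_mul v u : hn (hmul v u) <= hn v + hn u.
Proof.
rewrite hn_le ?addr_ge0 ?hn_ge0//.
have a0 := hn_ge0 v; have b0 := hn_ge0 u.
have Hv := hn4 v; have Hu := hn4 u.
have Pv := hn_xy v; have Pu := hn_xy u.
move: a0 b0 Hv Hu Pv Pu; rewrite /N4 /hmul.
set a := hn v; set b := hn u.
case: v @a => [[x1 y1] z1] a; case: u @b => [[x2 y2] z2] b /= a0 b0 Hv Hu Pv Pu.
have h1 : (x1 ^+ 2 + y1 ^+ 2) ^+ 2 + z1 ^+ 2 <= (a ^+ 2) ^+ 2 by rewrite -exprM Hv.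
have h2 : (x2 ^+ 2 + y2 ^+ 2) ^+ 2 + z2 ^+ 2 <= (b ^+ 2) ^+ 2 by rewrite -exprM Hu.
have h3 : (2 * (x1 * x2 + y1 * y2)) ^+ 2 + ((x1 * y2 - y1 * x2) / 2) ^+ 2 <= (2 * (a * b)) ^+ 2.
  apply: (@le_trans _ _ (4 * ((x1 ^+ 2 + y1 ^+ 2) * (x2 ^+ 2 + y2 ^+ 2)))).
    by have := sqr_ge0 (x1 * y2 - y1 * x2); nra.
  rewrite !exprMn (_ : 2 ^+ 2 = 4) ?ler_pM2l//; last by ring.
  by apply: ler_pM => //; rewrite addr_ge0 ?sqr_ge0.
have a20 : 0 <= a ^+ 2 by exact: sqr_ge0.
have b20 : 0 <= b ^+ 2 by exact: sqr_ge0.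
have ab0 : 0 <= 2 * (a * b) by rewrite !mulr_ge0.
have h4 := minkowski2 a20 b20 h1 h2.
have h5 := minkowski2 (addr_ge0 a20 b20) ab0 h4 h3.
rewrite (_ : (a + b) ^+ 4 = (a ^+ 2 + b ^+ 2 + 2 * (a * b)) ^+ 2); last by ring.
by apply: le_trans h5; rewrite le_eqVlt; apply/orP; left; apply/eqP; ring.
Qed.

Lemma hn0 : hn (0, 0, 0) = 0.
Proof. by rewrite /hn /hnorm/= !expr0n/= !addr0 expr0n/= !sqrtr0. Qed.

Definition sg (b : bool) : R := if b then 1 else -1.

Lemma sg_choice (c kap : R) : exists s : bool, forall a : R, kap <= sg s * a -> c * a <= - (kap * `|c|).
Proof.
have [c0|c0] := leP c 0.
  by exists true => a; rewrite mul1r ler0_norm// => ka; nra.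
by exists false => a; rewrite mulN1r gtr0_norm// => ka; nra.
Qed.

(** Far from the identity the linear part of the increment of [N4] dominates: with signs opposed to
    the derivatives it gains [4 kap r^3 + 2 kap |z|], where [r] is the horizontal radius, against a
    remainder of order [r^2]. *)
Lemma N4_descent_step (kap K : R) : 0 < kap -> 0 <= K -> exists2 rho : R, 0 <= rho &
  forall v, rho <= hn v -> exists s1 s2 s3 : bool, forall h,
    kap <= sg s1 * h.1.1 -> kap <= sg s2 * h.1.2 -> kap <= sg s3 * h.2 -> hn h <= K ->
    N4 (hmul v h) <= N4 v - 1.
Proof.
move=> k0 K0.
pose D := 9 * K ^+ 2 + 5 * K ^+ 4 + 1.
have K20 : 0 <= K ^+ 2 by exact: sqr_ge0.
have K40 : 0 <= K ^+ 4 by rewrite exprn_ge0.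
have D0 : 0 <= D by rewrite /D; lra.
(* If [r >= r1] then [4 kap r >= D] and the cubic gain absorbs the remainder; if [r < r1] the point
   is far because of its area, and [Z] is chosen so that [2 kap Z] absorbs it. *)
pose r1 := 1 + D / (4 * kap).
have r11 : 1 <= r1 by rewrite lerDl divr_ge0// mulr_ge0// ltW.
pose Z := (9 * K ^+ 2 * r1 ^+ 2 + 5 * K ^+ 4 + 1) / (2 * kap).
have Z0 : 0 <= Z.
  apply: divr_ge0; last by rewrite mulr_ge0// ltW.
  have := mulr_ge0 K20 (sqr_ge0 r1); lra.
exists (r1 + Z); first by lra.
move=> [[x y] z] hv.
have HN : (r1 + Z) ^+ 4 <= (x ^+ 2 + y ^+ 2) ^+ 2 + z ^+ 2.
  by rewrite -[leRHS](hn4 (x, y, z)) ler_pXn2r// nnegrE; [lra|exact: hn_ge0].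
pose X := x ^+ 2 + y ^+ 2.
have X0 : 0 <= X by rewrite addr_ge0 ?sqr_ge0.
pose r := Num.sqrt X.
have r0 : 0 <= r by exact: sqrtr_ge0.
have rX : r ^+ 2 = X by rewrite sqr_sqrtr.
(* The derivatives of [N4] at [v] along the two left-invariant horizontal directions. *)
pose c1 := 4 * X * x - z * y; pose c2 := 4 * X * y + z * x.
have [s1 H1] := sg_choice c1 kap.
have [s2 H2] := sg_choice c2 kap.
have [s3 H3] := sg_choice z kap.
exists s1, s2, s3 => -[[a b] c] /= ka kb kc hK.
have wK : a ^+ 2 + b ^+ 2 <= K ^+ 2.
  by apply: le_trans (hn_xy (a, b, c)) _; rewrite ler_pXn2r// nnegrE hn_ge0.
have cK : c ^+ 2 <= K ^+ 4.
  by apply: le_trans (hn_z (a, b, c)) _; rewrite ler_pXn2r// nnegrE hn_ge0.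
have {}H1 := H1 _ ka; have {}H2 := H2 _ kb; have {}H3 := H3 _ kc.
pose w := a ^+ 2 + b ^+ 2; pose sig := x * a + y * b; pose om := x * b - y * a.
have w0 : 0 <= w by rewrite addr_ge0 ?sqr_ge0.
have so : sig ^+ 2 + om ^+ 2 = X * w by rewrite /sig /om /X /w; ring.
have E : N4 (hmul (x, y, z) (a, b, c)) - N4 (x, y, z) =
   c1 * a + c2 * b + 2 * (z * c) +
   (2 * X * w + 4 * sig ^+ 2 + 4 * sig * w + w ^+ 2 + (c + om / 2) ^+ 2).
  by rewrite /N4 /hmul /c1 /c2 /sig /om /X /w /=; field.
have XwK : X * w <= X * K ^+ 2 by rewrite ler_wpM2l.
have wwK : w ^+ 2 <= K ^+ 4.
  by rewrite (_ : K ^+ 4 = (K ^+ 2) ^+ 2) ?ler_pXn2r ?nnegrE// -exprM.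
have rem : 2 * X * w + 4 * sig ^+ 2 + 4 * sig * w + w ^+ 2 + (c + om / 2) ^+ 2 <=
    9 * (X * K ^+ 2) + 5 * K ^+ 4.
  have q1 : 0 <= (sig - w) ^+ 2 by exact: sqr_ge0.
  have q2 : 0 <= (c - om / 2) ^+ 2 by exact: sqr_ge0.
  have q3 : 0 <= sig ^+ 2 by exact: sqr_ge0.
  have q4 : 0 <= om ^+ 2 by exact: sqr_ge0.
  have e1 : 4 * sig * w <= 2 * sig ^+ 2 + 2 * w ^+ 2.
    by move: q1; rewrite (_ : (sig - w) ^+ 2 = sig ^+ 2 - 2 * (sig * w) + w ^+ 2); [lra|ring].
  have e2 : (c + om / 2) ^+ 2 <= 2 * c ^+ 2 + om ^+ 2 / 2.
    move: q2; rewrite (_ : (c - om / 2) ^+ 2 = c ^+ 2 - c * om + om ^+ 2 / 4); last by field.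
    rewrite (_ : (c + om / 2) ^+ 2 = c ^+ 2 + c * om + om ^+ 2 / 4); last by field.
    lra.
  lra.
have c12 : 4 * r ^+ 3 <= `|c1| + `|c2|.
  apply: sqr_leW; first by rewrite addr_ge0.
  have -> : (`|c1| + `|c2|) ^+ 2 = c1 ^+ 2 + c2 ^+ 2 + 2 * (`|c1| * `|c2|).
    by rewrite sqrrD !real_normK ?num_real//; ring.
  have -> : c1 ^+ 2 + c2 ^+ 2 = X * (16 * X ^+ 2 + z ^+ 2) by rewrite /c1 /c2 /X; ring.
  have -> : (4 * r ^+ 3) ^+ 2 = X * (16 * X ^+ 2) by rewrite -rX; ring.
  have : 0 <= X * z ^+ 2 by rewrite mulr_ge0// sqr_ge0.
  have : 0 <= `|c1| * `|c2| by rewrite mulr_ge0.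
  by rewrite mulrDr; lra.
have key : 9 * (X * K ^+ 2) + 5 * K ^+ 4 + 1 <= 4 * kap * r ^+ 3 + 2 * kap * `|z|.
  have [rr1|rr1] := leP r1 r.
    have r1' : 1 <= r by exact: le_trans rr1.
    have r21 : 1 <= r ^+ 2 by rewrite exprn_ege1.
    apply: (@le_trans _ _ (D * r ^+ 2)).
      rewrite /D -rX.
      have : K ^+ 4 <= K ^+ 4 * r ^+ 2 by rewrite ler_peMr.
      lra.
    have : D * r ^+ 2 <= 4 * kap * r ^+ 3.
      have Dr : D <= 4 * kap * r.
        by rewrite -ler_pdivrMl ?mulr_gt0// mulrC; apply: le_trans rr1; rewrite lerDr.
      rewrite (_ : 4 * kap * r ^+ 3 = 4 * kap * r * r ^+ 2); last by ring.
      by rewrite ler_wpM2r// sqr_ge0.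
    have : 0 <= 2 * kap * `|z| by rewrite !mulr_ge0// ltW.
    lra.
  have Xr : X <= r1 ^+ 2 by rewrite -rX; nra.
  have zZ : Z <= `|z|.
    apply: sqr_leW => //; rewrite real_normK ?num_real//.
    have X2 : X ^+ 2 <= r1 ^+ 4.
      by rewrite (_ : r1 ^+ 4 = (r1 ^+ 2) ^+ 2) ?ler_pXn2r ?nnegrE ?sqr_ge0// -exprM.
    have : r1 ^+ 4 + Z ^+ 2 <= (r1 + Z) ^+ 4.
      have -> : (r1 + Z) ^+ 4 = r1 ^+ 4 + (4 * r1 ^+ 3 * Z + 6 * (r1 ^+ 2 * Z ^+ 2) + 4 * r1 * Z ^+ 3 + Z ^+ 4) by ring.
      have r10 : 0 <= r1 by lra.
      have t1 : 0 <= 4 * r1 ^+ 3 * Z by apply: mulr_ge0 => //; apply: mulr_ge0 => //; exact: exprn_ge0.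
      have t2 : 0 <= 4 * r1 * Z ^+ 3 by apply: mulr_ge0; [exact: mulr_ge0|exact: exprn_ge0].
      have t3 : 0 <= Z ^+ 4 by rewrite exprn_ge0.
      have t4 : Z ^+ 2 <= r1 ^+ 2 * Z ^+ 2 by rewrite ler_peMl ?sqr_ge0// exprn_ege1.
      have t5 : 0 <= Z ^+ 2 by exact: sqr_ge0.
      lra.
    move: HN; rewrite -/X; lra.
  have : X * K ^+ 2 <= r1 ^+ 2 * K ^+ 2 by rewrite ler_wpM2r.
  have : 9 * K ^+ 2 * r1 ^+ 2 + 5 * K ^+ 4 + 1 <= 2 * kap * `|z|.
    by rewrite -ler_pdivrMl ?mulr_gt0// mulrC.
  have : 0 <= 4 * kap * r ^+ 3 by rewrite !mulr_ge0 ?exprn_ge0// ltW.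
  lra.
have : 4 * kap * r ^+ 3 <= kap * (`|c1| + `|c2|) by rewrite [X in X * _]mulrC -mulrA ler_pM2l.
move: E; set F := N4 (hmul _ _); set G := N4 (x, y, z).
lra.
Qed.

(** Conjugation fixes the horizontal part and adds to the area the symplectic form of [k] and
    [g]. *)
Lemma N4_conj g k (r1 G : R) : 0 <= r1 -> hn k <= r1 -> g.1.1 ^+ 2 + g.1.2 ^+ 2 <= G ->
  N4 (hmul (hinv g) (hmul k g)) <= 3 * r1 ^+ 4 + 2 * r1 ^+ 2 * G.
Proof.
move=> r10 kr gG.
have k2 : k.1.1 ^+ 2 + k.1.2 ^+ 2 <= r1 ^+ 2.
  by apply: le_trans (hn_xy k) _; rewrite ler_pXn2r// nnegrE hn_ge0.
have kz : k.2 ^+ 2 <= r1 ^+ 4.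
  by apply: le_trans (hn_z k) _; rewrite ler_pXn2r// nnegrE hn_ge0.
move: k2 kz gG; case: k {kr} => [[a b] c]; case: g => [[x y] z]; rewrite /N4 /hmul /hinv /= => k2 kz gG.
set X' := (_ + _) ^+ 2; set Z' := (- z + _ + _).
have -> : X' = (a ^+ 2 + b ^+ 2) ^+ 2 by rewrite /X'; ring.
have -> : Z' = c + (a * y - b * x) by rewrite /Z'; field.
have h1 : (a ^+ 2 + b ^+ 2) ^+ 2 <= r1 ^+ 4.
  by rewrite (_ : r1 ^+ 4 = (r1 ^+ 2) ^+ 2) ?ler_pXn2r ?nnegrE ?addr_ge0 ?sqr_ge0// -exprM.
have h2 : (a * y - b * x) ^+ 2 <= r1 ^+ 2 * G.
  apply: (@le_trans _ _ ((a ^+ 2 + b ^+ 2) * (x ^+ 2 + y ^+ 2))).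
    have := sqr_ge0 (a * x + b * y).
    rewrite (_ : (a ^+ 2 + b ^+ 2) * (x ^+ 2 + y ^+ 2) = (a * y - b * x) ^+ 2 + (a * x + b * y) ^+ 2); [lra|ring].
  by apply: ler_pM => //; rewrite addr_ge0 ?sqr_ge0.
have h3 : (c + (a * y - b * x)) ^+ 2 <= 2 * c ^+ 2 + 2 * (a * y - b * x) ^+ 2.
  have := sqr_ge0 (c - (a * y - b * x)); set o := a * y - b * x.
  rewrite (_ : (c - o) ^+ 2 = c ^+ 2 - 2 * (c * o) + o ^+ 2); last by ring.
  rewrite (_ : (c + o) ^+ 2 = c ^+ 2 + 2 * (c * o) + o ^+ 2); last by ring.
  lra.
lra.
Qed.

(** The displaced point is [v g] times the conjugate of [k] by [g]. As [v] and [v g] both lie in the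
    ball, the horizontal part of [g] has length at most [2 rho], whence the term [8 r1^2 rho^2]. *)
Lemma hn_near v k g (r1 rho e : R) : 0 <= r1 -> 0 <= e -> hn k <= r1 -> hn v <= rho ->
  hn (hmul v g) <= rho -> 3 * r1 ^+ 4 + 8 * r1 ^+ 2 * rho ^+ 2 <= e ^+ 4 ->
  hn (hmul (hmul v k) g) <= rho + e.
Proof.
move=> r10 e0 kr vr vgr he.
have rho0 : 0 <= rho by exact: le_trans (hn_ge0 v) vr.
have -> : hmul (hmul v k) g = hmul (hmul v g) (hmul (hinv g) (hmul k g)).
  by rewrite /hmul /hinv/=; congr (_, _, _); field.
apply: le_trans (hn_mul _ _) (lerD vgr _).
rewrite hn_le//; apply: le_trans (N4_conj (G := 4 * rho ^+ 2) r10 kr _) _; last first.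
  by apply: le_trans he; rewrite lerD2l; lra.
have h1 : v.1.1 ^+ 2 + v.1.2 ^+ 2 <= rho ^+ 2.
  by apply: le_trans (hn_xy v) _; rewrite ler_pXn2r// nnegrE hn_ge0.
have h2 : (hmul v g).1.1 ^+ 2 + (hmul v g).1.2 ^+ 2 <= rho ^+ 2.
  by apply: le_trans (hn_xy _) _; rewrite ler_pXn2r// nnegrE hn_ge0.
have := @minkowski2 ((hmul v g).1.1) (- v.1.1) ((hmul v g).1.2) (- v.1.2) rho rho rho0 rho0 h2.
rewrite !sqrrN => /(_ h1).
rewrite /hmul/= !(addrC _ (- _)) !addKr => /le_trans; apply.
by rewrite (_ : (rho + rho) ^+ 2 = 4 * rho ^+ 2)//; ring.
Qed.

Definition dil (s : R) v : R * R * R := (s * v.1.1, s * v.1.2, s ^+ 2 * v.2).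

Lemma hn_dil s v : 0 <= s <= 1 -> hn (dil s v) <= hn v.
Proof.
move=> /andP[s0 s1]; rewrite hn_le ?hn_ge0// hn4 /N4 /dil/=.
have h : s ^+ 4 <= 1 by rewrite exprn_ile1.
rewrite (_ : _ + _ = s ^+ 4 * ((v.1.1 ^+ 2 + v.1.2 ^+ 2) ^+ 2 + v.2 ^+ 2)); last by ring.
by rewrite ler_piMl// addr_ge0 ?sqr_ge0.
Qed.

(** Between consecutive dilates the area coordinate of the displacement is of order [1 / J], hence
    of order [J^(-1/2)] in the homogeneous norm. This term decides the rate; 5 is a convenient
    constant above 4. *)
Lemma hn_dil_step (J i : nat) v (e : R) : (i < J)%N -> 0 <= e -> 5 / J%:R ^+ 2 <= e ^+ 4 ->
  hn (hmul (hinv (dil (i.+1%:R / J%:R) v)) (dil (i%:R / J%:R) v)) <= e * hn v.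
Proof.
move=> iJ e0 he.
have J0 : 0 < J%:R :> R by rewrite ltr0n (leq_trans _ iJ).
rewrite hn_le ?mulr_ge0 ?hn_ge0// exprMn hn4.
apply: (@le_trans _ _ (5 / J%:R ^+ 2 * N4 v)); last by rewrite ler_wpM2r// N4_ge0.
rewrite /N4 /hmul /hinv /dil/=.
set X := v.1.1 ^+ 2 + v.1.2 ^+ 2; set Z := v.2.
set A := (_ + _) ^+ 2; set B := (- _ + _ + _).
have -> : A = (1 / J%:R ^+ 4) * X ^+ 2.
  by rewrite /A /X -natr1; field; rewrite gt_eqF.
have -> : B ^+ 2 = ((2 * i%:R + 1) / J%:R ^+ 2) ^+ 2 * Z ^+ 2.
  by rewrite /B /Z -natr1; field; rewrite gt_eqF.
rewrite mulrDr lerD//; rewrite ler_wpM2r ?sqr_ge0//.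
  rewrite ler_pdivrMr ?exprn_gt0// (_ : 5 / J%:R ^+ 2 * J%:R ^+ 4 = 5 * J%:R ^+ 2); last by field; rewrite gt_eqF.
  have : 1 <= J%:R ^+ 2 :> R by rewrite exprn_ege1// ler1n (leq_trans _ iJ).
  lra.
have iJ' : i%:R + 1 <= J%:R :> R by rewrite natr1 ler_nat.
have i0 : 0 <= i%:R :> R by exact: ler0n.
rewrite expr_div_n ler_pdivrMr ?exprn_gt0// (_ : 5 / J%:R ^+ 2 * (J%:R ^+ 2) ^+ 2 = 5 * J%:R ^+ 2); last by field; rewrite gt_eqF.
by nra.
Qed.

End heisenberg_norm.

(** * Events on sampled paths *)

Section events.
Context {R : realType}.
Implicit Types (x y : pathT R idx) (v : R * R * R).

Definition pt x (m k : nat) : R * R * R :=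
  (x (Some true, (m, k)), x (Some false, (m, k)), x (None, (m, k))).

(* By continuity, the dyadic times suffice to keep the path in the ball on all of [[0, n]]. *)
Definition Ds v (n : nat) (r : R) : set (pathT R idx) :=
  [set x | forall m k, (k <= n * 2 ^ m)%N -> hn (hmul v (pt x m k)) <= r].

(** The path after time [n], left-translated back to the identity; level 0 has unit mesh, so
    [pt x 0 n] is the position at time [n]. *)
Definition shiftp (n : nat) x : pathT R idx := fun i =>
  sel i.1 (hmul (hinv (pt x 0 n)) (pt x i.2.1 (n * 2 ^ i.2.1 + i.2.2))).

Definition mH d (T : measurableType d) (F : T -> R * R * R) :=
  forall c, measurable_fun setT (fun w => sel c (F w)).

Lemma mH_cst d (T : measurableType d) v : mH (fun _ : T => v).
Proof. by move=> c; exact: measurable_cst. Qed.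

Lemma mH_hmul d (T : measurableType d) (F G : T -> R * R * R) :
  mH F -> mH G -> mH (fun w => hmul (F w) (G w)).
Proof.
move=> mF mG [[]|]; rewrite /hmul/=.
- by apply: measurable_funD; [exact: (mF (Some true))|exact: (mG (Some true))].
- by apply: measurable_funD; [exact: (mF (Some false))|exact: (mG (Some false))].
apply: measurable_funD.
  by apply: measurable_funD; [exact: (mF None)|exact: (mG None)].
apply: measurable_funM => //; apply: measurable_funB; apply: measurable_funM.
- exact: (mF (Some true)).
- exact: (mG (Some false)).
- exact: (mF (Some false)).
- exact: (mG (Some true)).
Qed.

Lemma mH_hinv d (T : measurableType d) (F : T -> R * R * R) :
  mH F -> mH (fun w => hinv (F w)).
Proof. by move=> mF [[]|]; apply: measurable_funN; [exact: (mF (Some true))|exact: (mF (Some false))|exact: (mF None)]. Qed.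

Lemma mH_pt d (T : measurableType d) (F : T -> pathT R idx) m k :
  measurable_fun setT F -> mH (fun w => pt (F w) m k).
Proof.
by move=> mF [[]|]; [exact: (measurableT_comp (measurable_coord _) mF)
  |exact: (measurableT_comp (measurable_coord _) mF)|exact: (measurableT_comp (measurable_coord _) mF)].
Qed.

Lemma measurable_le_set d (T : measurableType d) (f g : T -> R) :
  measurable_fun setT f -> measurable_fun setT g -> measurable [set w | f w <= g w].
Proof.
move=> mf mg.
rewrite (_ : [set w | _] = (fun w => g w - f w) @^-1` `[0, +oo[); last first.
  by apply/seteqP; split => w /=; rewrite in_itv/= andbT subr_ge0.
by apply: measurable_preim => //; exact: measurable_funB.
Qed.

Lemma measurable_N4 d (T : measurableType d) (F : T -> R * R * R) :
  mH F -> measurable_fun setT (fun w => N4 (F w)).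
Proof.
move=> mF; rewrite /N4; apply: measurable_funD; apply: measurable_funX.
  apply: measurable_funD; apply: measurable_funX;
  [exact: (mF (Some true))|exact: (mF (Some false))].
exact: (mF None).
Qed.

Lemma measurable_hn_le d (T : measurableType d) (F : T -> R * R * R) (r : R) :
  mH F -> measurable [set w | hn (F w) <= r].
Proof.
move=> mF; have [r0|r0] := leP 0 r.
  rewrite (_ : [set w | _] = [set w | N4 (F w) <= r ^+ 4]); last first.
    by apply/seteqP; split => w /=; rewrite hn_le.
  by apply: measurable_le_set => //; exact: measurable_N4.
rewrite (_ : [set w | _] = set0)//; apply/seteqP; split => w //=.
by rewrite leNgt (lt_le_trans r0)// hn_ge0.
Qed.

(** The starting point may depend on the sample, because the Markov property restarts the path from
    its random position. *)
Lemma measurable_Ds_comp d (T : measurableType d) (F : T -> R * R * R)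
  (Y : T -> pathT R idx) n r : mH F -> measurable_fun setT Y ->
  measurable [set w | Ds (F w) n r (Y w)].
Proof.
move=> mF mY.
rewrite (_ : [set w | _] = \bigcap_m \bigcap_(k in [set k | (k <= n * 2 ^ m)%N])
    [set w | hn (hmul (F w) (pt (Y w) m k)) <= r]); last first.
  by apply/seteqP; split => [w Hw m _ k /= kn|w Hw m k kn]; [exact: Hw|exact: Hw].
apply: bigcapT_measurable => m; apply: bigcap_measurable; first by exists 0%N.
move=> k _; apply: measurable_hn_le; apply: mH_hmul => //; exact: mH_pt.
Qed.

Lemma measurable_Ds v n r : measurable (Ds v n r).
Proof.
exact: (@measurable_Ds_comp _ (pathT R idx) (fun=> v) id n r (mH_cst _) (@measurable_id _ _ _)).
Qed.

Lemma pt_stop n x m k : (k <= n * 2 ^ m)%N -> pt (stop n x) m k = pt x m k.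
Proof. by move=> kn; rewrite /pt /stop/= (minn_idPl kn). Qed.

Lemma pt_stop0 n x : pt (stop n x) 0 n = pt x 0 n.
Proof. by rewrite pt_stop// expn0 muln1. Qed.

Lemma Ds_stop v n r x : Ds v n r (stop n x) <-> Ds v n r x.
Proof. by split => H m k kn; have := H m k kn; rewrite pt_stop. Qed.

Lemma pt_shiftp n x m k :
  pt (shiftp n x) m k = hmul (hinv (pt x 0 n)) (pt x m (n * 2 ^ m + k)).
Proof. by rewrite /pt /shiftp/=. Qed.

Lemma hmulK v u : hmul v (hmul (hinv v) u) = u.
Proof. by rewrite hmulA hmulV hmul1l. Qed.

Lemma hmulKV v u : hmul (hinv v) (hmul v u) = u.
Proof. by rewrite hmulA hmulVl hmul1l. Qed.

Lemma Ds_split v n n' r x : Ds v (n + n') r x <->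
  Ds v n r x /\ Ds (hmul v (pt x 0 n)) n' r (shiftp n x).
Proof.
split=> [H|[H1 H2] m k kn].
  split=> m k kn; first by apply: H; apply: leq_trans kn _; rewrite leq_mul2r leq_addr orbT.
  rewrite pt_shiftp -hmulA hmulK; apply: H.
  by rewrite mulnDl leq_add2l.
have [kn'|kn'] := leqP k (n * 2 ^ m); first exact: H1.
have := H2 m (k - n * 2 ^ m)%N; rewrite pt_shiftp -hmulA hmulK subnKC ?(ltnW kn')//.
by apply; rewrite leq_subLR -mulnDl.
Qed.

Lemma DsS v n r r' x : r <= r' -> Ds v n r x -> Ds v n r' x.
Proof. by move=> rr' H m k kn; apply: le_trans rr'; exact: H. Qed.

Lemma Ds_le v n n' r x : (n' <= n)%N -> Ds v n r x -> Ds v n' r x.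
Proof. by move=> nn H m k kn; apply: H; apply: leq_trans kn _; rewrite leq_mul2r nn orbT. Qed.

(** A good unit step: at time 1 each coordinate has a prescribed sign and size at least [kap], and
    the excursion stays within [K]. The signs are those demanded by [N4_descent_step]. *)
Definition Gst (s1 s2 s3 : bool) (kap K : R) : set (pathT R idx) :=
  [set x | [/\ kap <= sg s1 * (pt x 0 1).1.1, kap <= sg s2 * (pt x 0 1).1.2,
               kap <= sg s3 * (pt x 0 1).2 & Ds (0, 0, 0) 1 K x]].

Lemma measurable_Gst s1 s2 s3 kap K : measurable (Gst s1 s2 s3 kap K).
Proof.
have mc i s : measurable [set x : pathT R idx | kap <= sg s * x i].
  by apply: measurable_le_set => //; apply: measurable_funM => //; exact: measurable_coord.
rewrite (_ : Gst _ _ _ _ _ = [set x : pathT R idx | kap <= sg s1 * x (Some true, (0, 1)%N)] `&`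
 ([set x : pathT R idx | kap <= sg s2 * x (Some false, (0, 1)%N)] `&`
 ([set x : pathT R idx | kap <= sg s3 * x (None, (0, 1)%N)] `&` Ds (0, 0, 0) 1 K))); last first.
  by apply/seteqP; split => x /= => [[? ? ? ?]|[? [? [? ?]]]].
by do 3 (apply: measurableI; first exact: mc); exact: measurable_Ds.
Qed.

End events.

(** * Markov bounds and the survival probability in a ball *)

Section markov.
Context {R : realType} {d : measure_display} {T : measurableType d}.
Variable P : probability T R.
Variables (W1 W2 A : R -> T -> R).
Hypothesis H : HBM P W1 W2 A.
Local Notation X := (pth W1 W2 A).
Implicit Types (v a b : R * R * R).

Definition pi_ (S : set (pathT R idx)) := fine (P (X @^-1` S)).

Let mX : measurable_fun setT X. Proof. exact: measurable_pth H. Qed.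

Let mXS S : measurable S -> measurable (X @^-1` S).
Proof. exact: measurable_preim. Qed.

Lemma pi_le S S' : measurable S -> measurable S' -> S `<=` S' -> pi_ S <= pi_ S'.
Proof. by move=> mS mS' SS'; apply: Pr_le; [exact: mXS|exact: mXS|move=> w; exact: SS']. Qed.

Lemma pi_ge0 S : 0 <= pi_ S.
Proof. exact: Pr_ge0. Qed.

Lemma pi_le1 S : measurable S -> pi_ S <= 1.
Proof. by move=> mS; apply: Pr_le1; exact: mXS. Qed.

Lemma pt_pth m k w : pt (X w) m k = gpt W1 W2 A (dyt m k) w.
Proof. by rewrite /pt /pth/=. Qed.

Lemma shiftp_pth n w :
  shiftp n (X w) = pth (Wshift W1 n) (Wshift W2 n) (Ashift W1 W2 A n) w.
Proof.
apply/funext => -[c [m k]]; rewrite /shiftp /pth/= !pt_pth -dytD gpt_shift.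
have -> : dyt 0 n = n%:R :> R by rewrite /dyt expr0 divr1.
by rewrite hmulKV.
Qed.

(** [G] is an event of the past up to [n], and [S] couples the stopped path with the restarted one.
    The two halves give the upper and the lower estimate for an event [E] inside, respectively
    containing, this coupling. *)
Lemma pi_markov n (G : set (pathT R idx)) (S : set (pathT R idx * pathT R idx))
    (E : set (pathT R idx)) (c : R) :
  measurable G -> measurable S -> measurable E -> 0 <= c ->
  (forall x, G (stop n x) <-> G x) ->
  ((forall x, E x -> G x /\ S (stop n x, shiftp n x)) ->
   (forall x, G x -> pi_ [set y | S (stop n x, y)] <= c) -> pi_ E <= c * pi_ G) /\
  ((forall x, G x /\ S (stop n x, shiftp n x) -> E x) ->
   (forall x, G x -> c <= pi_ [set y | S (stop n x, y)]) -> c * pi_ G <= pi_ E).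
Proof.
move=> mG mS mE c0 Gs.
have mst : measurable_fun setT (stop n \o X) by apply: measurableT_comp => //; exact: measurable_stop.
have mSx x : measurable [set y | S (x, y)].
  rewrite (_ : [set y | _] = xsection S x); first exact: measurable_xsection.
  by apply/seteqP; split => y /=; rewrite /xsection/= inE.
have mY := measurable_pth (HBM_shift n H).
have B := indep_prod_bounds mst mY mX (path_indep n H H) mG mS c0.
have stG : (stop n \o X) @^-1` G = X @^-1` G by apply/seteqP; split => w /=; rewrite Gs.
have mXY : measurable_fun setT (fun w => ((stop n \o X) w, pth (Wshift W1 n) (Wshift W2 n) (Ashift W1 W2 A n) w)).
  exact: measurable_fun_pair.
have mGS : measurable [set w | G ((stop n \o X) w) /\ S ((stop n \o X) w, pth (Wshift W1 n) (Wshift W2 n) (Ashift W1 W2 A n) w)].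
  rewrite (_ : [set w | _] = (stop n \o X) @^-1` G `&` (fun w => ((stop n \o X) w, pth (Wshift W1 n) (Wshift W2 n) (Ashift W1 W2 A n) w)) @^-1` S)//.
  by apply: measurableI; exact: measurable_preim.
have ps x : P [set w' | S (stop n x, X w')] = (pi_ [set y | S (stop n x, y)])%:E.
  by rewrite /pi_ fineK// fin_num_measure//; exact: (mXS (mSx _)).
have EG : (c%:E * P ((stop n \o X) @^-1` G) = (c * pi_ G)%:E)%E.
  by rewrite stG /pi_ EFinM fineK// fin_num_measure//; exact: mXS.
split => HE Hc.
- rewrite -lee_fin -EG /pi_ fineK; last by rewrite fin_num_measure//; exact: mXS.
  apply: (@le_trans _ _ (P [set w | G ((stop n \o X) w) /\ S ((stop n \o X) w, pth (Wshift W1 n) (Wshift W2 n) (Ashift W1 W2 A n) w)])).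
    apply: le_measure; rewrite ?inE//; first exact: mXS.
    by move=> w /= /HE[Gw Sw]; rewrite Gs -shiftp_pth.
  by apply: B.1 => w Gw; rewrite /= ps lee_fin Hc// -Gs.
- rewrite -lee_fin -EG /pi_ fineK; last by rewrite fin_num_measure//; exact: mXS.
  apply: (@le_trans _ _ (P [set w | G ((stop n \o X) w) /\ S ((stop n \o X) w, pth (Wshift W1 n) (Wshift W2 n) (Ashift W1 W2 A n) w)])).
    by apply: B.2 => w Gw; rewrite /= ps lee_fin Hc// -Gs.
  apply: le_measure; rewrite ?inE//; first exact: mXS.
  by move=> w /=; rewrite Gs -shiftp_pth; exact: HE.
Qed.

(** [A 0] is only known as a limit in probability of empty sums, so it vanishes almost surely and
    not everywhere. *)
Lemma A0_ae : P [set w | A 0 w != 0] = 0%E.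
Proof.
have [BM mA cA] := H.
have m0 e : measurable [set w | (e : R) < `|A 0 w|].
  rewrite (_ : [set w | _] = [set w | e < `|A 0 w - 0|]); first exact: measurable_dev.
  by apply/seteqP; split => w /=; rewrite subr0.
have z e : 0 < e -> P [set w | e < `|A 0 w|] = 0%E.
  move=> e0; have := cA 0%N 0%N e e0; rewrite dyt0.
  rewrite (_ : (fun n => _) = (fun=> P [set w | e < `|A 0 w|])).
    by move=> /(cvg_lim _) <-//; rewrite lim_cst.
  apply/funext => n; congr (P _); apply/seteqP; split => w /=;
  by rewrite mul0n /ar big_ord0 mulr0 sub0r normrN.
rewrite (_ : [set w | _] = \bigcup_n [set w | n.+1%:R^-1 < `|A 0 w|]).
  apply/negligibleP; first by apply: bigcupT_measurable => n; exact: m0.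
  apply: negligible_bigcup => n; apply/negligibleP; [exact: m0|exact: z].
apply/seteqP; split => w /=.
  rewrite -normr_gt0 => A0; have [n] := @ltr_add_invr R _ _ A0; rewrite add0r => nA.
  by exists n.
by move=> [n _ /= nA]; rewrite -normr_gt0 (lt_trans _ nA).
Qed.

Lemma pi_start S : measurable S -> (forall x, (forall m, pt x m 0 = (0, 0, 0)) -> S x) ->
  pi_ S = 1.
Proof.
move=> mS HS; have [[_ W0 _] mA _] := H.
suff : P (X @^-1` S) = 1%E by rewrite /pi_ => ->.
have mA0 : measurable [set w | A 0 w != 0].
  rewrite (_ : [set w | _] = A 0 @^-1` (~` [set 0])); first by apply: measurable_preim => //; exact: measurableC.
  by apply/seteqP; split => w /= => /eqP.
have mc : measurable (~` (X @^-1` S)) by apply: measurableC; exact: mXS.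
have : P (~` (X @^-1` S)) = 0%E.
  apply/eqP; rewrite eq_le measure_ge0 andbT -[leRHS]A0_ae.
  apply: le_measure; rewrite ?inE// => w /= nS; apply/eqP => A00; apply: nS; apply: HS => m.
  by rewrite pt_pth dyt0 /gpt A00; have [-> ->] := W0 w.
have := probability_setC P mc; rewrite setCK => -> ->; exact: sube0.
Qed.

Let mS_Ds v n n' r : measurable [set z : pathT R idx * pathT R idx |
  Ds (hmul v (pt z.1 0 n)) n' r z.2].
Proof.
apply: measurable_Ds_comp; last exact: measurable_snd.
by apply: mH_hmul; [exact: mH_cst|apply: mH_pt; exact: measurable_fst].
Qed.

Definition Mset r n : set R := [set pi_ (Ds v n r) | v in [set v | hn v <= r]].
Definition M r n := sup (Mset r n).

Lemma Mset_has_sup r n : 0 <= r -> has_sup (Mset r n).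
Proof.
move=> r0; split.
  by exists (pi_ (Ds (0, 0, 0) n r)); exists (0, 0, 0) => //=; rewrite hn0.
by exists 1 => _ [v _ <-]; apply: pi_le1; exact: measurable_Ds.
Qed.

Lemma M_ge r n v : hn v <= r -> pi_ (Ds v n r) <= M r n.
Proof.
move=> vr; apply: sup_upper_bound; last by exists v.
by apply: Mset_has_sup; exact: le_trans (hn_ge0 v) vr.
Qed.

Lemma M_le r n c : 0 <= r -> (forall v, hn v <= r -> pi_ (Ds v n r) <= c) -> M r n <= c.
Proof.
move=> r0 Hc; apply: ge_sup; first by have [] := Mset_has_sup n r0.
by move=> _ [v vr <-]; exact: Hc.
Qed.

Lemma M_ge0 r n : 0 <= r -> 0 <= M r n.
Proof.
move=> r0; apply: le_trans (@M_ge r n (0, 0, 0) _); last by rewrite hn0.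
exact: pi_ge0.
Qed.

Lemma M_submul r n n' : 0 <= r -> M r (n + n') <= M r n * M r n'.
Proof.
move=> r0; apply: M_le => // v vr.
apply: (@le_trans _ _ (M r n' * pi_ (Ds v n r))); last first.
  by rewrite mulrC ler_wpM2r ?M_ge0// M_ge.
have [Hle _] := pi_markov (measurable_Ds v n r) (mS_Ds v n n' r)
  (measurable_Ds v (n + n') r) (M_ge0 n' r0) (fun x => Ds_stop v n r x).
apply: Hle.
- by move=> x /Ds_split[H1 H2]; split => //=; rewrite pt_stop0.
- move=> x Gx /=; rewrite pt_stop0; apply: M_ge.
  by apply: Gx; rewrite expn0 muln1.
Qed.

(** * Steering towards the identity at a bounded probabilistic cost *)

Section steering.
Variables (kap K p rho0 : R).
Hypotheses (K0 : 0 <= K) (p0 : 0 < p) (rho00 : 0 <= rho0).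
Hypothesis Hgreedy : forall v, rho0 <= hn v -> exists s1 s2 s3 : bool, forall h,
    kap <= sg s1 * h.1.1 -> kap <= sg s2 * h.1.2 -> kap <= sg s3 * h.2 -> hn h <= K ->
    N4 (hmul v h) <= N4 v - 1.
Hypothesis Hp : forall s1 s2 s3, p <= pi_ (Gst s1 s2 s3 kap K).
Let rho1 := rho0 + K.

Definition St a n B : set (pathT R idx) :=
  [set x | Ds a n (B + K) x /\ N4 (hmul a (pt x 0 n)) <= rho1 ^+ 4].

Lemma measurable_St_comp d' (S : measurableType d') (F : S -> R * R * R)
  (Y : S -> pathT R idx) n B : mH F -> measurable_fun setT Y ->
  measurable [set w | St (F w) n B (Y w)].
Proof.
move=> mF mY; rewrite (_ : [set w | _] = [set w | Ds (F w) n (B + K) (Y w)] `&`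
   [set w | N4 (hmul (F w) (pt (Y w) 0 n)) <= rho1 ^+ 4])//.
apply: measurableI; first exact: measurable_Ds_comp.
apply: measurable_le_set => //; apply: measurable_N4; apply: mH_hmul => //; exact: mH_pt.
Qed.

Lemma measurable_St a n B : measurable (St a n B).
Proof.
exact: (@measurable_St_comp _ (pathT R idx) (fun=> a) id n B (mH_cst _) (@measurable_id _ _ _)).
Qed.

(** Each unit step costs a factor [p] and, outside radius [rho0], lowers [N4] by 1; from inside, a
    step of size [K] cannot leave radius [rho1 = rho0 + K]. Hence [n] steps consume an excess [n] of
    [N4], with excursions of size [K] beyond [B]. *)
Lemma steer n a B : rho1 <= B -> hn a <= B -> N4 a <= n%:R + rho1 ^+ 4 ->
  p ^+ n <= pi_ (St a n B).
Proof.
move=> r1B; have r10 : 0 <= rho1 by rewrite addr_ge0.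
elim: n a => [|n IH] a aB aN.
  rewrite expr0 (pi_start (measurable_St a 0 B))// => x x0; split.
    by move=> m k; rewrite leqn0 => /eqP ->; rewrite x0 hmul1 (le_trans aB)// lerDl.
  by rewrite x0 hmul1; move: aN; rewrite add0r.
have [s1 [s2 [s3 Hs]]] : exists s1 s2 s3 : bool, forall h,
    kap <= sg s1 * h.1.1 -> kap <= sg s2 * h.1.2 -> kap <= sg s3 * h.2 -> hn h <= K ->
    hn (hmul a h) <= B /\ N4 (hmul a h) <= n%:R + rho1 ^+ 4.
  have [ra|ra] := leP rho0 (hn a).
    have [s1 [s2 [s3 Hs]]] := Hgreedy ra.
    exists s1, s2, s3 => h h1 h2 h3 hK.
    have Ha := Hs h h1 h2 h3 hK.
    split; last by apply: le_trans Ha _; rewrite lerBlDr (le_trans aN)// -natr1; lra.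
    rewrite hn_le; last by exact: le_trans r1B.
    apply: le_trans Ha _; rewrite -hn4.
    apply: (@le_trans _ _ (hn a ^+ 4)); first by lra.
    by rewrite ler_pXn2r ?nnegrE ?hn_ge0// (le_trans r10).
  (* Inside radius [rho0] every choice of signs serves. *)
  exists true, true, true => h _ _ _ hK.
  have ar1 : hn (hmul a h) <= rho1.
    by apply: le_trans (hn_mul _ _) _; apply: lerD => //; exact: ltW.
  split; first exact: le_trans r1B.
  by move: ar1; rewrite hn_le// => /le_trans; apply; rewrite lerDr.
pose S := [set z : pathT R idx * pathT R idx | St (hmul a (pt z.1 0 1)) n B z.2].
have mS : measurable S.
  apply: measurable_St_comp; last exact: measurable_snd.
  by apply: mH_hmul; [exact: mH_cst|apply: mH_pt; exact: measurable_fst].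
apply: (@le_trans _ _ (p ^+ n * pi_ (Gst s1 s2 s3 kap K))).
  by rewrite exprSr ler_wpM2l// exprn_ge0// ltW.
have pn0 : 0 <= p ^+ n by rewrite exprn_ge0// ltW.
have Gs x : Gst s1 s2 s3 kap K (stop 1 x) <-> Gst s1 s2 s3 kap K x.
  split=> -[]; rewrite ?pt_stop0 => g1 g2 g3 g4; split; rewrite ?pt_stop0//.
    exact: (Ds_stop _ _ _ _).1.
  exact: (Ds_stop _ _ _ _).2.
have [_ Hge] := pi_markov (measurable_Gst s1 s2 s3 kap K) mS (measurable_St a n.+1 B) pn0 Gs.
apply: Hge.
- move=> x [[g1 g2 g3 gD]]; rewrite /S/= pt_stop0 => -[D1 D2]; split.
    rewrite -add1n; apply/Ds_split; split => //.
    move=> m k k1; apply: le_trans (hn_mul _ _) _; apply: lerD => //.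
    by have := gD m k k1; rewrite hmul1l.
  by move: D2; rewrite pt_shiftp -hmulA hmulK expn0 mul1n add1n.
- move=> x [g1 g2 g3 gD]; rewrite /S/= pt_stop0.
  have [|h1 h2] := Hs (pt x 0 1) g1 g2 g3 _.
    by have := gD 0%N 1%N; rewrite hmul1l expn0 muln1; apply.
  exact: IH.
Qed.

End steering.

End markov.

(** * Comparison of starting points *)

Section pi_chain.
Context {R : realType} {d : measure_display} {T : measurableType d}.
Variable P : probability T R.
Variables (W1 W2 A : R -> T -> R).
Hypothesis H : HBM P W1 W2 A.
Local Notation pi := (pi_ P W1 W2 A).
Local Notation M := (M P W1 W2 A).
Variables (kap K p rho0 : R).
Hypotheses (K0 : 0 <= K) (p0 : 0 < p) (rho00 : 0 <= rho0).
Hypothesis Hgreedy : forall v, rho0 <= hn v -> exists s1 s2 s3 : bool, forall h,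
    kap <= sg s1 * h.1.1 -> kap <= sg s2 * h.1.2 -> kap <= sg s3 * h.2 -> hn h <= K ->
    N4 (hmul v h) <= N4 v - 1.
Hypothesis Hp : forall s1 s2 s3, p <= pi (Gst s1 s2 s3 kap K).
Let rho1 := rho0 + K.
Let r10 : 0 <= rho1. Proof. exact: addr_ge0. Qed.
Let steerH := steer H K0 p0 rho00 Hgreedy Hp.

(** Steering from the identity back to its neighbourhood keeps the path in the ball for any time;
    this makes the exponential rate finite. *)
Lemma M_lower rho n : rho1 + K <= rho -> p ^+ n <= M rho n.
Proof.
move=> hr.
have z : hn (0, 0, 0) <= rho by rewrite hn0 (le_trans _ hr)// addr_ge0.
apply: le_trans (M_ge H n z).
have z1 : hn (0, 0, 0) <= rho1 by rewrite hn0.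
have zN : N4 (0, 0, 0) <= n%:R + rho1 ^+ 4 by rewrite -hn4 hn0 expr0n addr_ge0// exprn_ge0.
apply: le_trans (steerH (lexx _) z1 zN) _.
apply: (pi_le H); [exact: measurable_St|exact: measurable_Ds|].
by move=> x [D _]; exact: DsS D.
Qed.

(* The law of the path started from 0 is compared with the law started from v
   by steering the path successively close to the points dil (i / J) v. *)
Lemma pi_chain (v : R * R * R) (rho e rho' B : R) (J n0 n : nat) :
  hn v <= rho -> (0 < J)%N -> 0 <= e -> 5 / J%:R ^+ 2 <= e ^+ 4 ->
  e * rho + rho1 <= B -> B ^+ 4 <= n0%:R -> rho + B + K <= rho' ->
  3 * rho1 ^+ 4 + 8 * rho1 ^+ 2 * rho ^+ 2 <= (rho' - rho) ^+ 4 ->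
  p ^+ (J * n0) * pi (Ds v n rho) <= pi (Ds (0, 0, 0) (J * n0 + n) rho').
Proof.
move=> vr J0 e0 eJ eB Bn rr' near.
have rho0' : 0 <= rho by exact: le_trans (hn_ge0 v) vr.
have B1 : rho1 <= B by apply: le_trans eB; rewrite lerDr mulr_ge0.
have Bge : 0 <= B by exact: le_trans B1.
have rr : rho <= rho' by apply: le_trans rr'; rewrite -addrA lerDl addr_ge0.
pose vi i := dil (i%:R / J%:R) v.
have Jn0 : J%:R != 0 :> R by rewrite pnatr_eq0 -lt0n.
have viJ : vi J = v.
  by rewrite /vi divff// /dil; case: (v) => [[a b] c] /=; rewrite expr1n !mul1r.
have vi0 : vi 0%N = (0, 0, 0).
  by rewrite /vi mul0r /dil !mul0r expr0n mul0r.
have vir i : (i <= J)%N -> hn (vi i) <= rho.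
  move=> iJ; apply: le_trans vr; apply: hn_dil; rewrite divr_ge0//=.
  by rewrite ler_pdivrMr ?ltr0n// mul1r ler_nat.
(* Induction on the number [j] of targets still ahead. The start [b] need only be within [rho1] of
   the current target, which is exactly what [steer] delivers. *)
suff : forall j, (j <= J)%N -> forall b, hn (hmul (hinv (vi (J - j)%N)) b) <= rho1 ->
    p ^+ (j * n0) * pi (Ds v n rho) <= pi (Ds b (j * n0 + n) rho').
  move=> /(_ J (leqnn _) (0, 0, 0)); apply.
  by rewrite subnn vi0 hmulVl hn0.
elim=> [|j IH] jJ b hb.
  rewrite mul0n expr0 mul1r add0n; apply: (pi_le H); try exact: measurable_Ds.
  (* At the last target the start differs from [v] by a right factor of norm at most [rho1], and
     [hn_near] enlarges the ball accordingly. *)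
  move: hb; rewrite subn0 viJ => hb x Hx m k kn.
  rewrite -(hmulK v b) -[rho'](subrKC rho).
  by apply: (hn_near r10 _ hb vr (Hx m k kn)) => //; rewrite subr_ge0.
set i := (J - j.+1)%N in hb.
have iS : (J - j)%N = i.+1 by rewrite /i subnSK.
have iJ : (i < J)%N by rewrite -iS leq_subr.
pose a := hmul (hinv (vi i.+1)) b.
(* One chain step of length at most [e * rho], plus the error [rho1] with which the current target
   was reached. *)
have aB : hn a <= B.
  rewrite /a -(hmulK (vi i) b) hmulA.
  apply: le_trans (hn_mul _ _) _; apply: le_trans eB; apply: lerD => //.
  by apply: le_trans (hn_dil_step v iJ e0 eJ) _; rewrite ler_wpM2l.
have aN : N4 a <= n0%:R + rho1 ^+ 4.
  rewrite -hn4; apply: (@le_trans _ _ (B ^+ 4)); first by rewrite ler_pXn2r// nnegrE hn_ge0.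
  by apply: le_trans Bn _; rewrite lerDl exprn_ge0.
have st := steerH B1 aB aN.
pose S := [set z : pathT R idx * pathT R idx | Ds (hmul b (pt z.1 0 n0)) (j * n0 + n) rho' z.2].
have mS : measurable S.
  apply: measurable_Ds_comp; last exact: measurable_snd.
  by apply: mH_hmul; [exact: mH_cst|apply: mH_pt; exact: measurable_fst].
have Gs x : St K rho0 a n0 B (stop n0 x) <-> St K rho0 a n0 B x.
  rewrite /St/= -/(pt _ _ _) pt_stop0; split => -[h1 h2]; split => //.
    exact: (Ds_stop _ _ _ _).1.
  exact: (Ds_stop _ _ _ _).2.
set c := p ^+ (j * n0) * pi (Ds v n rho).
have c0 : 0 <= c by apply: mulr_ge0; [exact/exprn_ge0/ltW|exact: pi_ge0].
apply: (@le_trans _ _ (c * pi (St K rho0 a n0 B))).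
  rewrite mulSn exprD /c -mulrA mulrC ler_wpM2l//.
have [_ Hge] := pi_markov H (measurable_St K rho0 a n0 B) mS
  (measurable_Ds b (j.+1 * n0 + n) rho') c0 Gs.
apply: Hge.
- move=> x [[D1 _]]; rewrite /S/= pt_stop0 => D2.
  rewrite mulSn -addnA; apply/Ds_split; split => // m k kn.
  rewrite -(hmulK (vi i.+1) b) -/a -hmulA.
  apply: le_trans (hn_mul _ _) _; apply: le_trans rr'; rewrite -addrA; apply: lerD.
    exact: vir.
  exact: D1.
- move=> x [_ D2]; rewrite /S/= pt_stop0; apply: IH; first exact: ltnW.
  by rewrite iS hmulA -/a hn_le.
Qed.

(** The mesh [J] and the steering time [n0] are fixed once [rho] is chosen, so the factor [C] and
    the delay [T0] do not depend on [n]. *)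
Lemma M_compare (delta : R) : 0 < delta -> exists rho : R,
  [/\ 0 < rho, rho1 + K <= rho & exists C : R, exists2 T0 : nat, 0 < C &
    forall n, M rho n <= C * pi (Ds (0, 0, 0) (T0 + n) ((1 + delta) * rho))].
Proof.
move=> d0.
pose e := delta / 4.
have e0 : 0 < e by rewrite divr_gt0.
(* The term with [delta] gives [rho1 + K <= delta rho / 2], which makes room for the excursions of
   the chain; the term with [delta ^+ 2] gives [16 rho1^2 <= delta^4 rho^2], which controls the
   conjugation error in [hn_near]. *)
pose rho := 1 + rho1 + 2 * (rho1 + K) / delta + 4 * rho1 / delta ^+ 2 + K.
have rK : 0 <= rho1 + K by exact: addr_ge0.
have q1 : 0 <= 2 * (rho1 + K) / delta.
  by apply: divr_ge0; [exact: mulr_ge0|exact: ltW].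
have q2 : 0 <= 4 * rho1 / delta ^+ 2.
  by apply: divr_ge0; [exact: mulr_ge0|exact: sqr_ge0].
have rp : 0 < rho by rewrite /rho; move: r10 K0; lra.
exists rho; split => //; first by rewrite /rho; move: r10; lra.
have [J J0 HJ] : exists2 J, (0 < J)%N & 5 / J%:R ^+ 2 <= e ^+ 4.
  have [J HJ] : exists J : nat, 5 / e ^+ 4 <= J%:R.
    by exists (Num.trunc (5 / e ^+ 4)).+1; rewrite ltW// truncnS_gt.
  have Jp : 0 < J%:R :> R by apply: lt_le_trans HJ; rewrite divr_gt0// exprn_gt0.
  exists J; first by rewrite -(ltr0n R).
  rewrite ler_pdivrMr ?exprn_gt0// -ler_pdivrMl ?exprn_gt0// mulrC.
  apply: le_trans HJ _; rewrite ler_eXnr// ler1n -(ltr0n R)//.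
pose B := e * rho + rho1.
have [n0 Hn0] : exists n0 : nat, B ^+ 4 <= n0%:R.
  by exists (Num.trunc (B ^+ 4)).+1; rewrite ltW// truncnS_gt.
exists (p ^- (J * n0)), (J * n0)%N; first by rewrite invr_gt0 exprn_gt0.
move=> n; apply: (M_le H); first exact: ltW.
move=> v vr; rewrite -ler_pdivrMl ?invr_gt0 ?exprn_gt0// invrK.
apply: (pi_chain n vr J0 (ltW e0) HJ (lexx _) Hn0).
  rewrite /B /e.
  have : rho1 + K <= delta / 2 * rho.
    have : delta / 2 * (2 * (rho1 + K) / delta) <= delta / 2 * rho.
      by rewrite ler_pM2l ?divr_gt0// /rho; move: r10 K0; lra.
    by rewrite (_ : delta / 2 * (2 * (rho1 + K) / delta) = rho1 + K)//; field; rewrite gt_eqF.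
  have := mulr_gt0 d0 rp; lra.
rewrite (_ : (1 + delta) * rho - rho = delta * rho); last by ring.
have r1r : rho1 <= rho by rewrite /rho; move: K0; lra.
have h1 : 4 * rho1 <= delta ^+ 2 * rho.
  have : delta ^+ 2 * (4 * rho1 / delta ^+ 2) <= delta ^+ 2 * rho.
    by rewrite ler_pM2l ?exprn_gt0// /rho; move: r10 K0; lra.
  by rewrite (_ : delta ^+ 2 * (4 * rho1 / delta ^+ 2) = 4 * rho1)//; field; rewrite gt_eqF.
have h2 : 16 * rho1 ^+ 2 <= delta ^+ 4 * rho ^+ 2.
  rewrite (_ : 16 * rho1 ^+ 2 = (4 * rho1) ^+ 2); last by ring.
  rewrite (_ : delta ^+ 4 * rho ^+ 2 = (delta ^+ 2 * rho) ^+ 2); last by ring.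
  by rewrite ler_pXn2r// nnegrE ?mulr_ge0 ?sqr_ge0// ltW.
have h3 : rho1 ^+ 2 <= rho ^+ 2 by rewrite ler_pXn2r// nnegrE ltW.
have h4 : 0 <= rho1 ^+ 2 by exact: sqr_ge0.
have h5 : rho1 ^+ 4 <= rho1 ^+ 2 * rho ^+ 2 by rewrite (_ : rho1 ^+ 4 = rho1 ^+ 2 * rho1 ^+ 2) ?ler_wpM2l//; ring.
have h6 : 16 * rho1 ^+ 2 * rho ^+ 2 <= delta ^+ 4 * rho ^+ 2 * rho ^+ 2.
  by rewrite ler_wpM2r// sqr_ge0.
rewrite (_ : (delta * rho) ^+ 4 = delta ^+ 4 * rho ^+ 2 * rho ^+ 2); last by ring.
have h7 : 0 <= rho1 ^+ 2 * rho ^+ 2 by rewrite mulr_ge0// sqr_ge0.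
lra.
Qed.

End pi_chain.

(** * Positive probability of all sign patterns, and of leaving a ball *)

Section positivity.
Context {R : realType} {d : measure_display} {T : measurableType d}.
Variable P : probability T R.
Variables (W1 W2 A : R -> T -> R).
Hypotheses (BM : BMinc P W1 W2) (LL : levy_lim P W1 W2 A).
Local Notation X := (pth W1 W2 A).
Local Notation pi := (pi_ P W1 W2 A).
Hypothesis bdd : forall w, exists K : R, Ds (0, 0, 0) 1 K (X w).
Let H : HBM P W1 W2 A := levy_HBM BM LL.

Let dyt01 : dyt 0 1 = 1 :> R.
Proof. by rewrite /dyt expr0 divr1. Qed.

Definition Qs (s1 s2 s3 : bool) : set (pathT R idx) :=
  [set x | [/\ 0 < sg s1 * x (Some true, (0, 1)%N), 0 < sg s2 * x (Some false, (0, 1)%N) &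
               0 < sg s3 * x (None, (0, 1)%N)]].

Lemma measurable_Qs s1 s2 s3 : measurable (Qs s1 s2 s3).
Proof.
have mc i s : measurable [set x : pathT R idx | 0 < sg s * x i].
  rewrite (_ : [set x | _] = (fun x : pathT R idx => sg s * x i) @^-1` `]0, +oo[); last first.
    by apply/seteqP; split => x /=; rewrite in_itv/= andbT.
  apply: measurable_preim => //; apply: measurable_funM => //; exact: measurable_coord.
rewrite (_ : Qs _ _ _ = [set x : pathT R idx | 0 < sg s1 * x (Some true, (0, 1)%N)] `&`
 ([set x : pathT R idx | 0 < sg s2 * x (Some false, (0, 1)%N)] `&`
 ([set x : pathT R idx | 0 < sg s3 * x (None, (0, 1)%N)]))); last first.
  by apply/seteqP; split => x /= => [[? ? ?]|[? [? ?]]].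
by do 2 (apply: measurableI; first exact: mc); exact: mc.
Qed.

Let sgN s (a : R) : sg s * - a = sg (~~ s) * a.
Proof. by case: s; rewrite /sg /= ?mulN1r ?opprK ?mul1r. Qed.

Lemma Qs_neg s1 s2 s3 : pi (Qs s1 s2 s3) = pi (Qs (~~ s1) s2 (~~ s3)).
Proof.
rewrite /pi_ (path_law H (HBM_neg H) (measurable_Qs _ _ _)); congr (fine (P _)).
by apply/seteqP; split => w; rewrite /Qs /= /pth/= !sgN.
Qed.

Lemma Qs_swap s1 s2 s3 : pi (Qs s1 s2 s3) = pi (Qs s2 s1 (~~ s3)).
Proof.
rewrite /pi_ (path_law H (HBM_swap H) (measurable_Qs _ _ _)); congr (fine (P _)).
by apply/seteqP; split => w; rewrite /Qs /= /pth/= !sgN => -[].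
Qed.

(** The symmetries [Qs_neg] and [Qs_swap] act transitively on the eight octants. *)
Lemma Qs_all s1 s2 s3 : pi (Qs s1 s2 s3) = pi (Qs true true true).
Proof.
have e1 : pi (Qs true true false) = pi (Qs true true true) by rewrite Qs_swap.
have e2 : pi (Qs false true false) = pi (Qs true true true) by rewrite Qs_neg.
have e3 : pi (Qs false true true) = pi (Qs true true true) by rewrite Qs_neg.
have e4 : pi (Qs true false true) = pi (Qs true true true) by rewrite Qs_swap.
have e5 : pi (Qs true false false) = pi (Qs true true true) by rewrite Qs_swap.
have e6 : pi (Qs false false false) = pi (Qs true true true) by rewrite Qs_neg.
have e7 : pi (Qs false false true) = pi (Qs true true true) by rewrite Qs_neg.
by case: s1; case: s2; case: s3.
Qed.

Let mneq (f : T -> R) : measurable_fun setT f -> measurable [set w | f w != 0].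
Proof.
move=> mf; rewrite (_ : [set w | _] = f @^-1` (~` [set 0])).
  by apply: measurable_preim => //; exact: measurableC.
by apply/seteqP; split => w /= => /eqP.
Qed.

(** If [A 1] vanished almost surely, so would the area of the path restarted at time 1, by
    stationarity, and [A 2], by scaling. The cross term in the cocycle rule would then vanish, yet
    it is positive with positive probability. *)
Lemma area_neq0 : P [set w | A 1 w != 0] != 0%E.
Proof.
apply/eqP => A1; have [_ mA _] := H.
have Hs := HBM_shift 1 H.
(* With [c ^+ 2 = 1 / 2] the scaled area at time 1 is half of [A 2]. *)
pose c : R := Num.sqrt 2^-1.
have c0 : 0 < c by rewrite sqrtr_gt0 invr_gt0.
have c2 : c ^+ 2 = 2^-1 by rewrite sqr_sqrtr// invr_ge0.
have Hc := HBM_scale c0 BM LL.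
pose S := [set x : pathT R idx | x (None, (0, 1)%N) != 0].
have mS : measurable S by
  rewrite (_ : S = (fun x : pathT R idx => x (None, (0, 1)%N)) @^-1` (~` [set 0]));
  [apply: measurable_preim; [exact: measurable_coord|exact: measurableC]
  |apply/seteqP; split => x /= /eqP].
have XS : X @^-1` S = [set w | A 1 w != 0].
  by apply/seteqP; split => w; rewrite /S /= /pth/= dyt01.
have As : P [set w | Ashift W1 W2 A 1 1 w != 0] = 0%E.
  rewrite -A1 -XS (path_law H Hs mS); congr (P _).
  by apply/seteqP; split => w; rewrite /S /= /pth/= dyt01.
have A2 : P [set w | A 2 w != 0] = 0%E.
  rewrite -A1 -XS (path_law H Hc mS); congr (P _).
  have E w : scaleA c A 1 w = 2^-1 * A 2 w by rewrite /scaleA c2 invrK mul1r.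
  by apply/seteqP; split => w; rewrite /S /= /pth/= dyt01 E mulf_eq0 negb_or invr_eq0 pnatr_eq0.
have [[mW W0 _] _ _] := H.
(* All increments positive except the second one of [W1]: then both terms of the cross term are
   positive. *)
pose B (b : bool) (i : nat) : set R := if b && (i == 1)%N then `]-oo, 0[%classic else `]0, +oo[%classic.
have mB b i : measurable (B b i) by rewrite /B; case: ifP.
pose U := [set w | forall i, (i < 2)%N -> forall b, B b i (incr W1 W2 0 w (b, i))].
have U0 : (0 < P U)%E.
  rewrite /U (incr_rect 0 2 BM mB) !big_ord_recl big_ord0 /B/= mule1.
  have s0 : 0 < Num.sqrt (2 ^- 0) :> R by rewrite sqrtr_gt0 invr_gt0 exprn_gt0.
  by rewrite !mule_gt0//; [exact: normal_prob_gt0|exact: normal_prob_gt0|exact: normal_prob_lt0|exact: normal_prob_gt0].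
suff : P U = 0%E by move=> U00; move: U0; rewrite U00 ltxx.
have sub : U `<=` [set w | A 1 w != 0] `|` [set w | Ashift W1 W2 A 1 1 w != 0] `|` [set w | A 2 w != 0].
  move=> w Uw; apply: contrapT => /not_orP[/not_orP[/= /negP/negPn/eqP a1 /negP/negPn/eqP a2] /negP/negPn/eqP a3].
  have u1 := Uw 0%N isT true; have u2 := Uw 0%N isT false.
  have u3 := Uw 1%N isT true; have u4 := Uw 1%N isT false.
  move: u1 u2 u3 u4 a2; rewrite /B/= !in_itv/= !andbT /incr/= dyt0 dyt01.
  have -> : dyt 0 2 = 2 :> R by rewrite /dyt expr0 divr1.
  have [-> ->] := W0 w; rewrite !subr0 /Ashift /Wshift.
  have -> : 1%N%:R + 1 = 2 :> R by [].
  rewrite a3 (a1 : A 1%N%:R w = 0) => u1 u2 u3 u4 a2.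
  have p1 := mulr_gt0 u1 u4.
  have p2 : 0 < W2 1 w * - (W1 2 w - W1 1 w) by rewrite mulr_gt0// oppr_gt0.
  by move: p1 p2 a2; lra.
have nA : P.-negligible ([set w | A 1 w != 0] `|` [set w | Ashift W1 W2 A 1 1 w != 0] `|` [set w | A 2 w != 0]).
  apply: negligibleU; first apply: negligibleU; apply/negligibleP => //.
  - exact: mneq (mA _).
  - by have [_ mAs _] := Hs; exact: mneq (mAs _).
  - exact: mneq (mA _).
apply/negligibleP; last exact: negligibleS sub nA.
rewrite (_ : U = \bigcap_(i in [set i | (i < 2)%N]) \bigcap_b ((fun w => incr W1 W2 0 w (b, i)) @^-1` B b i)); last first.
  by apply/seteqP; split => [w Uw i i2 b _|w Uw i i2 b]; exact: Uw.
apply: bigcap_measurable; first by exists 0%N.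
move=> i _; apply: fin_bigcap_measurable => // b _.
by apply: measurable_preim => //; exact: (measurableT_comp (measurable_coord _) (measurable_incr 0 BM)).
Qed.

(** By symmetry one null octant makes all eight null. As [W1 1] and [W2 1] are almost surely
    nonzero, [A 1] would vanish almost surely. *)
Lemma Qs_gt0 s1 s2 s3 : 0 < pi (Qs s1 s2 s3).
Proof.
rewrite Qs_all lt_neqAle pi_ge0 andbT; apply/eqP => q0.
have /eqP := area_neq0; apply.
have [[mW W0 _] mA _] := H.
have mX := measurable_pth H.
have n0 s s' s'' : P.-negligible (X @^-1` Qs s s' s'').
  apply/negligibleP; first exact: (measurable_preim mX (measurable_Qs _ _ _)).
  have := Qs_all s s' s''; rewrite -q0 /pi_ => /eqP.
  rewrite fine_eq0 ?fin_num_measure// => [/eqP//|].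
  exact: (measurable_preim mX (measurable_Qs _ _ _)).
have nbool (F : bool -> set T) : (forall b, P.-negligible (F b)) -> P.-negligible (\bigcup_b F b).
  move=> nF; apply: negligibleS (negligibleU (nF true) (nF false)).
  by move=> w [[|] _ Fw]; [left|right].
have nW b : P.-negligible [set w | (if b then W1 else W2) 1 w = 0].
  rewrite (_ : [set w | _] = [set w | [set 0] (incr W1 W2 0 w (b, 0%N))]).
    apply/negligibleP.
      apply: (measurable_preim _ (measurable_set1 (0 : R))).
      exact: (measurableT_comp (measurable_coord _) (measurable_incr 0 BM)).
    exact: (etrans (incr_law 0 BM b 0 (measurable_set1 (0 : R))) (normal_prob_set1 _ _)).
  have E w : (if b then W1 else W2) 0 w = 0 by have [] := W0 w; case: b.
  by apply/seteqP; split => w /=; rewrite /incr/= dyt0 dyt01 E subr0.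
apply/negligibleP; first exact: mneq (mA _).
apply: (@negligibleS _ _ _ _ ((\bigcup_s1 \bigcup_s2 \bigcup_s3 (X @^-1` Qs s1 s2 s3)) `|`
   ([set w | W1 1 w = 0] `|` [set w | W2 1 w = 0]))).
  move=> w /= Aw; have [w1|/eqP w1] := pselect (W1 1 w = 0); first by right; left.
  have [w2|/eqP w2] := pselect (W2 1 w = 0); first by right; right.
  left; exists (0 < W1 1 w) => //; exists (0 < W2 1 w) => //; exists (0 < A 1 w) => //=.
  have sgp (a : R) : a != 0 -> 0 < sg (0 < a) * a.
    move=> a0; have [a0'|a0'] := ltP 0 a; rewrite /sg ?mul1r//.
    by rewrite mulN1r oppr_gt0 lt_neqAle a0.
  by rewrite /Qs /pth/= dyt01; split; exact: sgp.
apply: negligibleU; last by apply: negligibleU; [exact: (nW true)|exact: (nW false)].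
by do 3 apply: (nbool _) => ?; exact: n0.
Qed.

(** Paths being bounded, each octant event is the increasing union of the events with
    [kap = 1 / (j + 1)] and [K = j]; one [j] is taken for all eight octants. *)
Lemma Gst_gt0 : exists kap K p : R, [/\ 0 < kap, 0 <= K, 0 < p &
  forall s1 s2 s3, p <= pi (Gst s1 s2 s3 kap K)].
Proof.
have mX := measurable_pth H.
pose G s1 s2 s3 (j : nat) : set (pathT R idx) := Gst s1 s2 s3 j.+1%:R^-1 j%:R.
have mG s1 s2 s3 j : measurable (X @^-1` G s1 s2 s3 j).
  exact: (measurable_preim mX (measurable_Gst _ _ _ _ _)).
have ev s1 s2 s3 : \forall j \near \oo, 0 < pi (G s1 s2 s3 j).
  have UE : \bigcup_j (X @^-1` G s1 s2 s3 j) = X @^-1` Qs s1 s2 s3.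
    apply/seteqP; split => [w [j _ [g1 g2 g3 _]]|w [q1 q2 q3]].
      have j0 : 0 < j.+1%:R^-1 :> R by rewrite invr_gt0.
      by split; [exact: lt_le_trans g1|exact: lt_le_trans g2|exact: lt_le_trans g3].
    have [K HK] := bdd w.
    have [j1] := @ltr_add_invr R _ _ q1; rewrite add0r => hj1.
    have [j2] := @ltr_add_invr R _ _ q2; rewrite add0r => hj2.
    have [j3] := @ltr_add_invr R _ _ q3; rewrite add0r => hj3.
    pose j := (j1 + j2 + j3 + (Num.trunc K).+1)%N.
    have mono i (a : R) : (i <= j)%N -> i.+1%:R^-1 < a -> j.+1%:R^-1 <= a.
      move=> ij /ltW; apply: le_trans; rewrite lef_pV2 ?posrE//.
      by rewrite ler_nat ltnS.
    exists j => //; split.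
    + by apply: (mono j1) => //; rewrite /j -!addnA leq_addr.
    + by apply: (mono j2) => //; rewrite /j [(j1 + j2)%N]addnC -!addnA leq_addr.
    + by apply: (mono j3) => //; rewrite /j [(_ + j3)%N]addnC -!addnA leq_addr.
    apply: DsS HK; apply: (@le_trans _ _ (Num.trunc K).+1%:R); first by rewrite ltW// truncnS_gt.
    by rewrite ler_nat /j leq_addl.
  have cv : P (X @^-1` G s1 s2 s3 j) @[j --> \oo] --> P (X @^-1` Qs s1 s2 s3).
    rewrite -UE; apply: nondecreasing_cvg_mu => //.
      by rewrite UE; exact: (measurable_preim mX (measurable_Qs _ _ _)).
    move=> i j ij; apply/subsetPset => w [g1 g2 g3 g4].
    have ij' : j.+1%:R^-1 <= i.+1%:R^-1 :> R by rewrite lef_pV2 ?posrE// ler_nat.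
    split; [exact: le_trans g1|exact: le_trans g2|exact: le_trans g3|].
    by apply: DsS g4; rewrite ler_nat.
  have q0 := Qs_gt0 s1 s2 s3.
  have /fine_cvgP[_ /cvgrPdist_lt /(_ _ q0)] :
    P (X @^-1` G s1 s2 s3 j) @[j --> \oo] --> (pi (Qs s1 s2 s3))%:E.
    rewrite /pi_ fineK//; rewrite fin_num_measure//.
    exact: (measurable_preim mX (measurable_Qs _ _ _)).
  apply: filterS => j /=; rewrite ltr_distl => /andP[_].
  by rewrite ltrDr.
near \oo => j.
have pos s1 s2 s3 : 0 < pi (G s1 s2 s3 j).
  by case: s1; case: s2; case: s3; near: j; exact: ev.
have minb (f : bool -> R) : (forall b, 0 < f b) -> exists2 p, 0 < p & forall b, p <= f b.
  move=> f0; exists (Num.min (f true) (f false)); first by rewrite lt_min !f0.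
  by case; rewrite ge_min lexx ?orbT.
have [p p0 Hp] : exists2 p, 0 < p & forall s1 s2 s3, p <= pi (G s1 s2 s3 j).
  have h3 s1 s2 := minb _ (pos s1 s2).
  have h3' s1 s2 : exists p, 0 < p /\ forall b, p <= pi (G s1 s2 b j).
    by have [p ? ?] := h3 s1 s2; exists p.
  have h2 s1 : exists p, 0 < p /\ forall b b', p <= pi (G s1 b b' j).
    have [p [p0 Hp]] := h3' s1 true; have [q [q0 Hq]] := h3' s1 false.
    exists (Num.min p q); rewrite lt_min p0 q0; split => // -[] b'.
      by apply: le_trans (Hp b'); rewrite ge_min lexx.
    by apply: le_trans (Hq b'); rewrite ge_min lexx orbT.
  have [p [p0 Hp]] := h2 true; have [q [q0 Hq]] := h2 false.
  exists (Num.min p q); rewrite ?lt_min ?p0 ?q0// => -[] b b'.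
    by apply: le_trans (Hp b b'); rewrite ge_min lexx.
  by apply: le_trans (Hq b b'); rewrite ge_min lexx orbT.
by exists j.+1%:R^-1, j%:R, p; split => //; rewrite invr_gt0 ltr0n.
Unshelve. all: by end_near. Qed.

(** The path leaves the ball when [W1 1] exceeds [rho] in absolute value with the sign of the first
    coordinate of [v], which has probability at least [eta] for every [v]. This makes the rate
    positive. *)
Lemma M_lt1 rho : 0 <= rho -> M P W1 W2 A rho 1 < 1.
Proof.
move=> r0; have [[mW W0 _] mA _] := H.
pose B (b : bool) : set R := if b then `]rho, +oo[%classic else `]-oo, - rho[%classic.
have s0 : 0 < Num.sqrt (2 ^- 0) :> R by rewrite sqrtr_gt0 invr_gt0 exprn_gt0.
have mB b : measurable (B b) by rewrite /B; case: b; exact: measurable_itv.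
have B0 b : (0 < gn 0 (B b))%E.
  by case: b; [exact: normal_prob_gt0|exact: normal_prob_lt0].
have mE b : measurable [set w | B b (W1 1 w)].
  by apply: (measurable_preim _ (mB b)); have [] := mW 1.
have PE b : P [set w | B b (W1 1 w)] = gn 0 (B b).
  rewrite -(incr_law 0 BM true 0 (mB b)); congr (P _).
  by apply/seteqP; split => w /=; rewrite /incr/= dyt0 dyt01; have [-> _] := W0 w; rewrite subr0.
pose eta := Num.min (fine (P [set w | B true (W1 1 w)])) (fine (P [set w | B false (W1 1 w)])).
have eta0 : 0 < eta.
  rewrite lt_min; apply/andP; split; rewrite -lte_fin fineK ?fin_num_measure// PE; exact: B0.
apply: (@le_lt_trans _ _ (1 - eta)); last by rewrite ltrBlDr ltrDl.
apply: (M_le H) => // v vr.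
have key b : (forall w, Ds v 1 rho (X w) -> ~ B b (W1 1 w)) ->
    pi (Ds v 1 rho) <= 1 - fine (P [set w | B b (W1 1 w)]).
  move=> HB; rewrite /pi_.
  have mX := measurable_pth H.
  apply: (@le_trans _ _ (fine (P (~` [set w | B b (W1 1 w)])))).
    apply: Pr_le => //; first exact: (measurable_preim mX (measurable_Ds _ _ _)).
    exact: measurableC.
  by rewrite probability_setC// fineB ?fin_num_measure.
have vx w : Ds v 1 rho (X w) -> `|v.1.1 + W1 1 w| <= rho.
  move=> /(_ 0%N 1%N); rewrite expn0 muln1 => /(_ isT).
  rewrite pt_pth dyt01 => hv; apply: sqr_leW => //; rewrite real_normK ?num_real//.
  apply: (@le_trans _ _ (hn (hmul v (gpt W1 W2 A 1 w)) ^+ 2)); last first.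
    by rewrite ler_pXn2r// nnegrE hn_ge0.
  by apply: le_trans (hn_xy _); rewrite /= lerDl sqr_ge0.
have [v0|v0] := leP 0 v.1.1.
  apply: le_trans (key true _) _.
    by move=> w /vx; rewrite /B/= in_itv/= andbT ler_norml => /andP[_ h]; lra.
  by rewrite lerB// ge_min lexx.
apply: le_trans (key false _) _.
  by move=> w /vx; rewrite /B/= in_itv/= ler_norml => /andP[h _]; lra.
by rewrite lerB// ge_min lexx orbT.
Qed.

End positivity.

(** * Continuity of the norm along paths *)

Section sup_path.
Context {R : realType} {d : measure_display} {T : measurableType d}.
Variables (W1 W2 A : R -> T -> R).
Hypotheses (cW1 : forall w, {within `[0, +oo[, continuous (W1^~ w)})
  (cW2 : forall w, {within `[0, +oo[, continuous (W2^~ w)})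
  (cA : forall w, {within `[0, +oo[, continuous (A^~ w)}).

Let f w t := hn (gpt W1 W2 A t w).

Lemma continuous_hn_path w : {within `[0, +oo[, continuous (f w)}.
Proof.
have csq (g : R -> R) : {within `[0, +oo[, continuous g} -> {within `[0, +oo[, continuous (fun t => g t ^+ 2)}.
  by move=> cg t; exact: (continuous_comp (cg t) (@exprn_continuous R 2 (g t))).
have csqrt (g : R -> R) : {within `[0, +oo[, continuous g} -> {within `[0, +oo[, continuous (fun t => Num.sqrt (g t))}.
  by move=> cg t; exact: (continuous_comp (cg t) (@sqrt_continuous R (g t))).
have cadd (g h : R -> R) : {within `[0, +oo[, continuous g} -> {within `[0, +oo[, continuous h} ->
    {within `[0, +oo[, continuous (fun t => g t + h t)}.
  by move=> cg ch t; apply: continuousD; [exact: cg|exact: ch].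
apply/csqrt/csqrt/cadd; last exact/csq/cA.
by apply/csq/cadd; [exact/csq/cW1|exact/csq/cW2].
Qed.

Lemma gstar_attained (t : R) w : 0 <= t -> exists2 c, 0 <= c <= t &
  gstar W1 W2 A t w = f w c /\ (forall s, 0 <= s <= t -> f w s <= f w c).
Proof.
move=> t0.
have cf : {within `[0, t], continuous (f w)}.
  have sub : (`[0, t]%classic : set R) `<=` `[0, +oo[%classic.
    by move=> s /=; rewrite !in_itv/= andbT => /andP[].
  exact: (continuous_subspaceW sub (@continuous_hn_path w)).
have [c ct Hc] := EVT_max t0 cf.
exists c; first by move: ct; rewrite in_itv.
split; last by move=> s st; apply: Hc; rewrite in_itv.
apply/eqP; rewrite eq_le; apply/andP; split.
  apply: ge_sup; first by exists (f w c); exists c.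
  by move=> _ [s st <-]; exact: Hc.
apply: ub_le_sup; last by exists c.
by exists (f w c) => _ [s st <-]; exact: Hc.
Qed.

Lemma gstar_le (t : R) w (r : R) : 0 <= t ->
  gstar W1 W2 A t w <= r <-> (forall s, 0 <= s <= t -> f w s <= r).
Proof.
move=> t0; have [c ct [-> Hc]] := gstar_attained w t0; split; last exact.
by move=> fr s /Hc /le_trans; apply.
Qed.

Lemma dyadic_dense w (c t r : R) (n : nat) : 0 < c -> t * c <= n%:R ->
  (forall m k, (k <= n * 2 ^ m)%N -> f w (dyt m k / c) <= r) ->
  forall s, 0 <= s <= t -> f w s <= r.
Proof.
move=> c0 tn H s /andP[s0 st]; rewrite leNgt; apply/negP => rs.
have /subspace_continuousP/(_ s) := @continuous_hn_path w.
rewrite /= in_itv/= andbT => /(_ s0) cf.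
have e0 : 0 < f w s - r by rewrite subr_gt0.
have := cf _ (nbhsx_ballx _ _ e0) => /nbhs_ballP[dl /= dl0 Hdl].
have dc0 : 0 < dl * c by rewrite mulr_gt0.
have [m Hm] : exists m : nat, 2 ^- m < dl * c.
  have [j] := @ltr_add_invr R _ _ dc0; rewrite add0r => hj; exists j.
  apply: le_lt_trans hj; rewrite lef_pV2 ?posrE ?exprn_gt0// -natrX ler_nat.
  exact: ltn_expl.
(* Rounding [s * c] down approximates [s] from the left, so the dyadic index never exceeds
   [n * 2 ^ m]. *)
pose k := Num.trunc (s * c * 2 ^+ m).
have sc0 : 0 <= s * c * 2 ^+ m by rewrite !mulr_ge0 ?exprn_ge0// ltW.
have /andP[k1 k2] : k%:R <= s * c * 2 ^+ m < k.+1%:R by exact: truncn_itv.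
have p2 : 0 < 2 ^+ m :> R by rewrite exprn_gt0.
have kn : (k <= n * 2 ^ m)%N.
  rewrite -(ler_nat R) natrM natrX; apply: le_trans k1 _.
  rewrite ler_pM2r//; apply: le_trans tn; rewrite ler_pM2r//.
have u1 : dyt m k / c <= s by rewrite ler_pdivrMr// /dyt ler_pdivrMr.
have u2 : s - dyt m k / c < dl.
  rewrite ltrBlDl -ltrBlDr -(ltr_pM2r c0) mulrBl divfK ?gt_eqF// /dyt.
  have : s * c < (k%:R + 1) / 2 ^+ m by rewrite ltr_pdivlMr// natr1.
  rewrite mulrDl mul1r => h; move: Hm h; lra.
have u0 : 0 <= dyt m k / c.
  by apply: divr_ge0; [apply: divr_ge0 => //; exact: ltW|exact: ltW].
have bu : ball s dl (dyt m k / c).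
  by rewrite /ball/= ger0_norm// subr_ge0.
have := Hdl _ bu; rewrite /= in_itv/= andbT => /(_ u0).
move=> hb.
have {}hb : `|f w s - f w (dyt m k / c)| < f w s - r by exact: hb.
by have := H m k kn; have := le_lt_trans (ler_norm _) hb; lra.
Qed.

End sup_path.

(** * From [gstar] to events on scaled sampled paths *)

Section scale.
Context {R : realType} {d : measure_display} {T : measurableType d}.
Variable P : probability T R.
Variables (W1 W2 A : R -> T -> R).
Hypotheses (BM : std_BM2 P W1 W2) (LA : is_levy_area P W1 W2 A).
Local Notation pi := (pi_ P W1 W2 A).
Local Notation Xc c := (pth (scaleW c W1) (scaleW c W2) (scaleA c A)).

Lemma BMinc0 : BMinc P W1 W2. Proof. exact: std_BM2_inc. Qed.
Lemma levy_lim0 : levy_lim P W1 W2 A. Proof. by have [mA [_ cA]] := LA; split. Qed.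
Lemma HBM0 : HBM P W1 W2 A. Proof. exact: levy_HBM BMinc0 levy_lim0. Qed.

Let cW1 w : {within `[0, +oo[, continuous (W1^~ w)}.
Proof. by have [_ _ cW _] := BM; have [] := cW w. Qed.
Let cW2 w : {within `[0, +oo[, continuous (W2^~ w)}.
Proof. by have [_ _ cW _] := BM; have [] := cW w. Qed.
Let cA w : {within `[0, +oo[, continuous (A^~ w)}.
Proof. by have [_ [cA _]] := LA. Qed.

Lemma hn_dilE (c : R) v : 0 <= c -> hn (dil c v) = c * hn v.
Proof.
move=> c0; apply/eqP; rewrite -(@eqrXn2 _ 4) ?hn_ge0 ?mulr_ge0 ?hn_ge0//.
by apply/eqP; rewrite exprMn !hn4 /N4 /dil/=; ring.
Qed.

Lemma Ds_scale (c r : R) n w : 0 < c -> Ds (0, 0, 0) n r (Xc c w) <->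
  (forall m k, (k <= n * 2 ^ m)%N -> hn (gpt W1 W2 A (dyt m k / c ^+ 2) w) <= r / c).
Proof.
move=> c0; have E m k : hn (hmul (0, 0, 0) (pt (Xc c w) m k)) = c * hn (gpt W1 W2 A (dyt m k / c ^+ 2) w).
  by rewrite hmul1l -hn_dilE ?(ltW c0).
by split => H m k kn; have := H m k kn; rewrite E ler_pdivlMr// mulrC.
Qed.

(** [Ds] knows only integer durations. Together with [Ds_gstar] this compares it with [gstar] at any
    [t], the loss being the rounding of [t * c ^+ 2]. *)
Lemma gstar_Ds (c t r : R) n w : 0 < c -> 0 <= t -> n%:R <= t * c ^+ 2 ->
  gstar W1 W2 A t w <= r -> Ds (0, 0, 0) n (c * r) (Xc c w).
Proof.
move=> c0 t0 nt /(gstar_le cW1 cW2 cA w r t0) H; apply/Ds_scale => // m k kn.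
rewrite (_ : c * r / c = r); last by field; rewrite gt_eqF.
apply: H.
have c20 : 0 < c ^+ 2 by rewrite exprn_gt0.
apply/andP; split.
  by apply: divr_ge0; [apply: divr_ge0 => //; exact: exprn_ge0|exact: ltW].
rewrite ler_pdivrMr//; apply: le_trans nt; rewrite /dyt ler_pdivrMr ?exprn_gt0//.
by rewrite -natrX -natrM ler_nat.
Qed.

Lemma Ds_gstar (c t r : R) n w : 0 < c -> 0 <= t -> t * c ^+ 2 <= n%:R ->
  Ds (0, 0, 0) n r (Xc c w) -> gstar W1 W2 A t w <= r / c.
Proof.
move=> c0 t0 nt /(Ds_scale _ _ _ c0) H; apply/(gstar_le cW1 cW2 cA w _ t0).
have c20 : 0 < c ^+ 2 by rewrite exprn_gt0.
exact: (dyadic_dense cW1 cW2 cA c20 nt H).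
Qed.

Lemma bdd_path w : exists K : R, Ds (0, 0, 0) 1 K (pth W1 W2 A w).
Proof.
exists (gstar W1 W2 A 1 w) => m k km; rewrite hmul1l pt_pth.
have /(gstar_le cW1 cW2 cA w _ ler01) := lexx (gstar W1 W2 A 1 w); apply.
apply/andP; split; first by rewrite /dyt divr_ge0// exprn_ge0.
by rewrite /dyt ler_pdivrMr ?exprn_gt0// mul1r -natrX ler_nat; move: km; rewrite mul1n.
Qed.

Lemma pi_scale c S : 0 < c -> measurable S -> P (Xc c @^-1` S) = (pi S)%:E.
Proof.
move=> c0 mS; have Hc := HBM_scale c0 BMinc0 levy_lim0.
rewrite -(path_law HBM0 Hc mS) /pi_ fineK// fin_num_measure//.
exact: (measurable_preim (measurable_pth HBM0) mS).
Qed.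

(** With [t * c ^+ 2 = 1] no rounding occurs, and the event is exactly a path event of duration
    1. *)
Lemma measurable_gstar_le t r : 0 < t -> measurable [set w | gstar W1 W2 A t w <= r].
Proof.
move=> t0; pose c := (Num.sqrt t)^-1.
have c0 : 0 < c by rewrite invr_gt0 sqrtr_gt0.
have tc : t * c ^+ 2 = 1 by rewrite /c exprVn sqr_sqrtr ?(ltW t0)// divff// gt_eqF.
rewrite (_ : [set w | _] = Xc c @^-1` Ds (0, 0, 0) 1 (c * r)).
  by apply: (measurable_preim _ (measurable_Ds _ _ _)); exact: measurable_pth (HBM_scale c0 BMinc0 levy_lim0).
apply/seteqP; split => w /=.
  by apply: gstar_Ds => //; [exact: ltW|rewrite tc].
move=> /(Ds_gstar c0 (ltW t0)); rewrite tc => /(_ (lexx _)).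
by rewrite mulrAC divff ?mul1r// gt_eqF.
Qed.

Lemma measurable_gstar_lt t r : 0 < t -> measurable [set w | gstar W1 W2 A t w < r].
Proof.
move=> t0; rewrite (_ : [set w | _] = \bigcup_j [set w | gstar W1 W2 A t w <= r - j.+1%:R^-1]).
  by apply: bigcupT_measurable => j; exact: measurable_gstar_le.
apply/seteqP; split => w /=.
  rewrite -subr_gt0 => h; have [j] := @ltr_add_invr R _ _ h; rewrite add0r => hj.
  by exists j => //=; rewrite lerBrDl -lerBrDr ltW.
by move=> [j _ /= h]; apply: le_lt_trans h _; rewrite ltrBlDr ltrDl invr_gt0.
Qed.

Definition Pg t r := fine (P [set w | gstar W1 W2 A t w < r]).

Lemma Pg_upper (c t e : R) n : 0 < c -> 0 < t -> n%:R <= t * c ^+ 2 ->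
  Pg t e <= pi (Ds (0, 0, 0) n (c * e)).
Proof.
move=> c0 t0 nt; rewrite -[leRHS]/(fine (pi _)%:E) -(pi_scale c0 (measurable_Ds _ _ _)).
apply: Pr_le; first exact: measurable_gstar_lt.
  by apply: (measurable_preim _ (measurable_Ds _ _ _)); exact: measurable_pth (HBM_scale c0 BMinc0 levy_lim0).
by move=> w /= /ltW; apply: gstar_Ds => //; exact: ltW.
Qed.

Lemma Pg_lower (c t e r : R) n : 0 < c -> 0 < t -> t * c ^+ 2 <= n%:R -> r < c * e ->
  pi (Ds (0, 0, 0) n r) <= Pg t e.
Proof.
move=> c0 t0 nt rc; rewrite -[leLHS]/(fine (pi _)%:E) -(pi_scale c0 (measurable_Ds _ _ _)).
apply: Pr_le; last first.
- move=> w /= /(Ds_gstar c0 (ltW t0) nt) /le_lt_trans; apply.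
  by rewrite ltr_pdivrMr// mulrC.
- exact: measurable_gstar_lt.
- by apply: (measurable_preim _ (measurable_Ds _ _ _)); exact: measurable_pth (HBM_scale c0 BMinc0 levy_lim0).
Qed.

End scale.

(** * Exponential rate of a submultiplicative sequence *)

Section fekete.
Context {R : realType}.

(** Fekete's lemma for the superadditive sequence [- ln (m n)]: the rate is the supremum of its
    slopes, so the lower bound on [m n] holds for every [n]. The bound by powers of [p] makes the
    rate finite, and [m 1 < 1] makes it positive. *)
Lemma submul_exp_rate (m : nat -> R) (p : R) : 0 < p ->
  (forall n, p ^+ n <= m n) -> (forall n n', m (n + n')%N <= m n * m n') ->
  (forall n, m n <= 1) -> m 1%N < 1 ->
  exists2 lam, 0 < lam & (forall n, expR (- lam * n%:R) <= m n) /\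
    (forall eta, 0 < eta -> exists N : nat, forall n, (N <= n)%N ->
      m n <= expR (- (lam - eta) * n%:R)).
Proof.
move=> p0 mp msub m1 m11.
have m0 n : 0 < m n by apply: lt_le_trans (mp n); rewrite exprn_gt0.
pose a n := - ln (m n).
have mE n : m n = expR (- a n) by rewrite /a opprK lnK// posrE.
have aD n n' : a n + a n' <= a (n + n')%N.
  by rewrite /a -opprD lerN2 -lnM ?posrE// ler_ln ?posrE ?mulr_gt0.
have a0 n : 0 <= a n by rewrite oppr_ge0 ln_le0.
have aM n k : k%:R * a n <= a (k * n)%N.
  elim: k => [|k IH]; first by rewrite mul0r a0.
  by rewrite mulSn -natr1 mulrDl mul1r addrC; apply: le_trans (aD _ _); rewrite lerD2l.
have ap n : a n <= n%:R * - ln p.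
  rewrite /a mulrN lerN2 mulr_natl -lnXn// ler_ln ?posrE ?exprn_gt0//; exact: mp.
pose S := [set a n / n%:R | n in [set n | (0 < n)%N]].
have hS : has_sup S.
  split; first by exists (a 1%N / 1); exists 1%N.
  exists (- ln p) => _ [n n0 <-]; rewrite ler_pdivrMr ?ltr0n//.
  by rewrite mulrC; exact: ap.
have Sub n : (0 < n)%N -> a n <= sup S * n%:R.
  by move=> n0; rewrite -ler_pdivrMr ?ltr0n//; apply: sup_upper_bound => //; exists n.
exists (sup S).
  apply: lt_le_trans (_ : a 1%N <= _); first by rewrite /a oppr_gt0 ln_lt0// m0.
  by have := Sub 1%N isT; rewrite mulr1.
split=> [n|eta eta0].
  rewrite mE ler_expR mulNr lerN2; case: n => [|n]; last exact: Sub.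
  by rewrite mulr0 /a oppr_le0 ln_ge0// (le_trans _ (mp 0%N)).
have eta2 : 0 < eta / 2 by rewrite divr_gt0.
have [_ [k k0 <-] hk] := sup_adherent eta2 hS.
(* Half of [eta] is lost in choosing the slope at [k]; for [n >= N] the other half covers the
   incomplete last block, which costs at most [a k]. *)
pose N := (k + (Num.trunc (2 * a k / eta)).+1)%N.
exists N => n Nn; rewrite mE ler_expR mulNr lerN2.
have kn : (k <= n)%N by apply: leq_trans Nn; rewrite leq_addr.
have k0' : 0 < k%:R :> R by rewrite ltr0n.
have h1 : (n %/ k)%:R * a k <= a n.
  apply: le_trans (aM k (n %/ k)%N) _.
  rewrite {2}(divn_eq n k); apply: le_trans (aD _ _); by rewrite lerDl.
have h2 : (n%:R - k%:R) * (a k / k%:R) <= (n %/ k)%:R * a k.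
  rewrite mulrA ler_pdivrMr// mulrAC ler_wpM2r ?a0// lerBlDr -natrM -natrD ler_nat.
  by rewrite {1}(divn_eq n k) leq_add2l ltnW// ltn_pmod.
have h3 : 2 * a k / eta <= n%:R.
  apply: ltW; apply: lt_le_trans (truncnS_gt _) _; rewrite ler_nat.
  by apply: leq_trans Nn; rewrite leq_addl.
have h4 : a k <= n%:R * (eta / 2).
  by move: h3; rewrite ler_pdivrMr//; lra.
have h5 : n%:R * (sup S - eta / 2) <= n%:R * (a k / k%:R) by rewrite ler_wpM2l// ltW.
have h6 : (n%:R - k%:R) * (a k / k%:R) = n%:R * (a k / k%:R) - a k by field; rewrite gt_eqF.
by move: h1 h2 h4 h5; rewrite h6; lra.
Qed.

End fekete.

(** * Two-sided small ball estimate *)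

Section small_ball.
Context {R : realType} {d : measure_display} {T : measurableType d}.
Variable P : probability T R.
Variables (W1 W2 A : R -> T -> R).
Hypotheses (BM : std_BM2 P W1 W2) (LA : is_levy_area P W1 W2 A).
Local Notation pi := (pi_ P W1 W2 A).
Local Notation M := (M P W1 W2 A).
Local Notation Pg := (Pg P W1 W2 A).

Let H : HBM P W1 W2 A := HBM0 BM LA.

(** Scaling by [rho / e] turns radius [e] into [rho] and duration [t] into [rho^2 t / e^2]; rounding
    that duration down is absorbed by [eta] once [t / e^2] is large. *)
Let upper (rho lam eta : R) : 0 < rho -> 0 < lam -> 0 < eta ->
  (forall eta, 0 < eta -> exists N : nat, forall n, (N <= n)%N ->
      M rho n <= expR (- (lam - eta) * n%:R)) ->
  exists Y : R, forall t e, 0 < t -> 0 < e -> Y <= t / e ^+ 2 ->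
    Pg t e <= expR (- (rho ^+ 2 * lam - eta) * (t / e ^+ 2)).
Proof.
move=> r0 l0 eta0 Hl.
have r20 : 0 < rho ^+ 2 by rewrite exprn_gt0.
(* Capping at [lam] keeps [lam - eta'] nonnegative, so that a lower bound on [n] can be inserted. *)
pose eta' := Num.min (eta / (2 * rho ^+ 2)) lam.
have e'0 : 0 < eta' by rewrite lt_min l0 divr_gt0// mulr_gt0.
have [N HN] := Hl _ e'0.
exists (2 * lam / eta + (N%:R + 1) / rho ^+ 2) => t e t0 e0.
set y := t / e ^+ 2 => hy.
have e20 : 0 < e ^+ 2 by rewrite exprn_gt0.
have y0 : 0 < y by rewrite divr_gt0.
pose n := Num.trunc (rho ^+ 2 * y).
have /andP[n1 n2] : n%:R <= rho ^+ 2 * y < n.+1%:R.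
  by apply: truncn_itv; rewrite mulr_ge0// ltW.
have c0 : 0 < rho / e by rewrite divr_gt0.
have q1 : 0 <= 2 * lam / eta by rewrite ltW// divr_gt0// mulr_gt0.
have Nn : (N <= n)%N.
  rewrite -ltnS -(ltr_nat R); apply: le_lt_trans n2.
  have : (N%:R + 1) / rho ^+ 2 <= y by lra.
  by rewrite ler_pdivrMr//; lra.
apply: (@le_trans _ _ (M rho n)).
  have z : hn (0, 0, 0) <= rho by rewrite hn0 ltW.
  apply: le_trans (M_ge H n z).
  have -> : rho = rho / e * e by rewrite divfK// gt_eqF.
  apply: (Pg_upper BM LA) => //.
  by rewrite expr_div_n mulrA mulrAC mulrC.
apply: le_trans (HN n Nn) _; rewrite ler_expR !mulNr lerN2.
have h1 : rho ^+ 2 * y - 1 <= n%:R by move: n2; rewrite -natr1; lra.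
have h2 : 0 <= lam - eta' by rewrite subr_ge0 ge_min lexx orbT.
have h3 : (lam - eta') * (rho ^+ 2 * y - 1) <= (lam - eta') * n%:R by rewrite ler_wpM2l.
have h4 : eta' * (rho ^+ 2 * y) <= eta / 2 * y.
  have : eta' <= eta / (2 * rho ^+ 2) by rewrite ge_min lexx.
  rewrite ler_pdivlMr ?mulr_gt0// => h.
  have := ler_wpM2r (ltW y0) h; lra.
have h5 : lam <= eta / 2 * y.
  have : 2 * lam / eta <= y.
    have : 0 <= (N%:R + 1) / rho ^+ 2 by rewrite divr_ge0 ?addr_ge0// ltW.
    lra.
  rewrite ler_pdivrMr//; lra.
move: h3 h4 h5; lra.
Qed.

Let lower (delta rho lam eta C : R) (T0 : nat) : 0 < delta -> 0 < rho -> 0 < lam -> 0 < eta -> 0 < C ->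
  (forall n, expR (- lam * n%:R) <= M rho n) ->
  (forall n, M rho n <= C * pi (Ds (0, 0, 0) (T0 + n) ((1 + delta) * rho))) ->
  exists Y : R, forall t e, 0 < t -> 0 < e -> Y <= t / e ^+ 2 ->
    expR (- ((1 + 2 * delta) ^+ 2 * (rho ^+ 2 * lam) + eta) * (t / e ^+ 2)) <= Pg t e.
Proof.
move=> d0 r0 l0 eta0 C0 Hl HC.
have s0 : 0 < (1 + 2 * delta) * rho by rewrite mulr_gt0//; lra.
(* Slightly more than [(1 + delta) * rho], because [Pg] concerns the strict inequality
   [gstar < e]. *)
pose s := (1 + 2 * delta) * rho.
have s20 : 0 < s ^+ 2 by rewrite exprn_gt0.
exists ((lam + `|ln C|) / eta + T0%:R / s ^+ 2) => t e t0 e0.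
set y := t / e ^+ 2 => hy.
have e20 : 0 < e ^+ 2 by rewrite exprn_gt0.
have y0 : 0 < y by rewrite divr_gt0.
pose n := (Num.trunc (s ^+ 2 * y)).+1.
have /andP[n1 n2] : (Num.trunc (s ^+ 2 * y))%:R <= s ^+ 2 * y < n%:R.
  by apply: truncn_itv; rewrite mulr_ge0// ltW.
have q1 : 0 <= (lam + `|ln C|) / eta by rewrite divr_ge0 ?addr_ge0 ?(ltW l0)// ltW.
have q2 : 0 <= T0%:R / s ^+ 2 by rewrite divr_ge0// ltW.
have Tn : (T0 <= n)%N.
  rewrite -(ler_nat R); apply: le_trans (ltW n2).
  have : T0%:R / s ^+ 2 <= y by lra.
  by rewrite ler_pdivrMr//; lra.
have c0 : 0 < s / e by rewrite divr_gt0.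
apply: (@le_trans _ _ (pi (Ds (0, 0, 0) n ((1 + delta) * rho)))); last first.
  apply: (@Pg_lower _ _ _ P W1 W2 A BM LA (s / e)) => //.
    by rewrite expr_div_n mulrA mulrAC mulrC ltW.
  by rewrite divfK ?gt_eqF// /s ltr_pM2r//; lra.
have := HC (n - T0)%N; rewrite subnKC// -ler_pdivrMl// => /(le_trans _); apply.
rewrite ler_pdivlMl//; apply: le_trans (Hl _).
rewrite -[X in X * _](lnK C0) -expRD ler_expR.
have h1 : (n - T0)%:R <= s ^+ 2 * y + 1.
  apply: (@le_trans _ _ n%:R); first by rewrite ler_nat leq_subr.
  by rewrite /n -natr1 lerD2r.
have h2 : lam * (n - T0)%:R <= lam * (s ^+ 2 * y + 1) by rewrite ler_wpM2l// ltW.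
have h3 : lam + `|ln C| <= eta * y.
  have : (lam + `|ln C|) / eta <= y by lra.
  by rewrite ler_pdivrMr// mulrC.
have h4 := ler_norm (ln C).
have E : (1 + 2 * delta) ^+ 2 * (rho ^+ 2 * lam) * y = lam * (s ^+ 2 * y) by rewrite /s; ring.
rewrite !mulNr mulrDl E; lra.
Qed.

(** [L] is the supremum of the exponents admissible in the upper bound. For each [th] a ball of
    suitable radius [rho] gives a lower bound with exponent close to [(1 + 2 th)^2 rho^2 lam], and
    [rho^2 lam <= L]. This takes the place of a limit of [rho^2 lam] as [rho] grows. *)
Theorem small_ball : exists2 L : R, 0 < L & forall delta : R, 0 < delta ->
  exists Y : R, forall t e, 0 < t -> 0 < e -> Y <= t / e ^+ 2 ->
    expR (- (L + delta) * (t / e ^+ 2)) <= Pg t e <= expR (- (L - delta) * (t / e ^+ 2)).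
Proof.
have [kap [K [p [kap0 K0 p0 Hp]]]] := Gst_gt0 (BMinc0 BM) (levy_lim0 LA) (bdd_path BM LA).
have [rho0 rho00 Hg] := N4_descent_step kap0 K0.
pose UE := [set a : R | exists Y : R, forall t e, 0 < t -> 0 < e -> Y <= t / e ^+ 2 ->
   Pg t e <= expR (- a * (t / e ^+ 2))].
have rate rho : 0 < rho -> rho0 + K + K <= rho ->
    exists2 lam, 0 < lam & (forall n, expR (- lam * n%:R) <= M rho n) /\
    (forall eta, 0 < eta -> exists N : nat, forall n, (N <= n)%N ->
      M rho n <= expR (- (lam - eta) * n%:R)).
  move=> r0 rK; apply: (@submul_exp_rate _ _ p) => //.
  - by move=> n; exact: (M_lower H K0 p0 rho00 Hg Hp).
  - by move=> n n'; apply: (M_submul H); exact: ltW.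
  - move=> n; apply: (M_le H); first exact: ltW.
    by move=> v _; apply: (pi_le1 H); exact: measurable_Ds.
  - apply: (M_lt1 (BMinc0 BM) (levy_lim0 LA)); exact: ltW.
have UEr rho lam : 0 < rho -> 0 < lam -> (forall eta, 0 < eta -> exists N : nat, forall n, (N <= n)%N ->
      M rho n <= expR (- (lam - eta) * n%:R)) -> forall eta, 0 < eta -> UE (rho ^+ 2 * lam - eta).
  by move=> r0 l0 Hl eta eta0; exact: upper.
have low (delta eta : R) : 0 < delta -> 0 < eta -> exists rho lam, [/\ 0 < rho, 0 < lam,
   forall eta, 0 < eta -> UE (rho ^+ 2 * lam - eta) &
   exists Y : R, forall t e, 0 < t -> 0 < e -> Y <= t / e ^+ 2 ->
    expR (- ((1 + 2 * delta) ^+ 2 * (rho ^+ 2 * lam) + eta) * (t / e ^+ 2)) <= Pg t e].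
  move=> d0 eta0.
  have [rho [r0 rK [C [T0 C0 HC]]]] := M_compare H K0 p0 rho00 Hg Hp d0.
  have [lam l0 [Hl Hl']] := rate rho r0 rK.
  exists rho, lam; split => //; first exact: UEr.
  exact: (lower d0 r0 l0 eta0 C0 Hl HC).
have hUE : has_sup UE.
  have [rho [lam [r0 l0 HU [Y HY]]]] := low 1 1 ltr01 ltr01.
  split; first by exists (rho ^+ 2 * lam - 1); exact: HU.
  exists ((1 + 2 * 1) ^+ 2 * (rho ^+ 2 * lam) + 1) => a [Y' HY'].
  (* At [e = 1] and [t = y] an upper and a lower bound hold together, so the exponents are
     ordered. *)
  pose y := Num.max 1 (Num.max Y Y').
  have y0 : 0 < y by rewrite lt_max ltr01.
  have E : y / 1 ^+ 2 = y by rewrite expr1n divr1.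
  have := HY y 1 y0 ltr01; have := HY' y 1 y0 ltr01; rewrite E.
  rewrite !le_max !lexx !orbT => /(_ isT) h1 /(_ isT) h2.
  by have := le_trans h2 h1; rewrite ler_expR !mulNr lerN2 ler_pM2r.
pose L := sup UE.
have Lge rho lam : (forall eta, 0 < eta -> UE (rho ^+ 2 * lam - eta)) -> rho ^+ 2 * lam <= L.
  move=> HU; apply/ler_addgt0Pr => eta eta0; rewrite -lerBlDr.
  by apply: sup_upper_bound => //; exact: HU.
have L0 : 0 < L.
  have [rho [lam [r0 l0 HU _]]] := low 1 1 ltr01 ltr01.
  by apply: lt_le_trans (Lge _ _ HU); rewrite mulr_gt0// exprn_gt0.
exists L => // delta d0.
have [a [Y1 HY1] ha] := sup_adherent d0 hUE.
(* For [th <= 1], [(1 + 2 th)^2 <= 1 + 8 th], and [8 th L <= delta / 2]; the other half of [delta]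
   is the error in [low]. *)
pose th := Num.min 1 (delta / (16 * L)).
have th0 : 0 < th by rewrite lt_min ltr01 divr_gt0// mulr_gt0.
have d2 : 0 < delta / 2 by rewrite divr_gt0.
have [rho [lam [r0 l0 HU [Y2 HY2]]]] := low th (delta / 2) th0 d2.
exists (Num.max Y1 Y2) => t e t0 e0; rewrite ge_max => /andP[y1 y2].
have y0 : 0 < t / e ^+ 2 by rewrite divr_gt0// exprn_gt0.
apply/andP; split; last first.
  by apply: le_trans (HY1 t e t0 e0 y1) _; rewrite ler_expR !mulNr lerN2 ler_pM2r// ltW.
apply: le_trans (HY2 t e t0 e0 y2); rewrite ler_expR !mulNr lerN2 ler_pM2r//.
have hL := Lge _ _ HU.
have t1 : th <= 1 by rewrite ge_min lexx.
have t2 : th * (16 * L) <= delta by rewrite -ler_pdivlMr ?mulr_gt0// ge_min lexx orbT.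
have h1 : (1 + 2 * th) ^+ 2 <= 1 + 8 * th by nra.
have h2 : (1 + 2 * th) ^+ 2 * (rho ^+ 2 * lam) <= (1 + 8 * th) * L.
  by apply: ler_pM => //; [exact: sqr_ge0|rewrite mulr_ge0 ?sqr_ge0// ltW].
lra.
Qed.

End small_ball.

(** * Lower bound of the liminf *)

Section lil_lower.
Context {R : realType} {d : measure_display} {T : measurableType d}.
Variable P : probability T R.
Variables (W1 W2 A : R -> T -> R).
Hypotheses (BM : std_BM2 P W1 W2) (LA : is_levy_area P W1 W2 A).
Local Notation Pg := (Pg P W1 W2 A).
Local Notation G := (gstar W1 W2 A).
Variable L : R.
Hypothesis L0 : 0 < L.
Hypothesis HL : forall delta : R, 0 < delta ->
  exists Y : R, forall t e, 0 < t -> 0 < e -> Y <= t / e ^+ 2 ->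
    expR (- (L + delta) * (t / e ^+ 2)) <= Pg t e <= expR (- (L - delta) * (t / e ^+ 2)).

Lemma borel_cantelli_geometric (F : nat -> set T) (C q : R) :
  (forall n, measurable (F n)) -> 0 <= C -> 0 < q < 1 ->
  (forall n, fine (P (F n)) <= C * q ^+ n) -> P (lim_sup_set F) = 0%E.
Proof.
move=> mF C0 /andP[q0 q1] HF; apply: lim_sup_set_cvg0 => //.
apply: (@le_lt_trans _ _ (C / (1 - q))%:E); last by rewrite ltry.
apply: lime_le; first by apply: is_cvg_nneseries => n _ _.
near=> n; rewrite big_mkord.
apply: (@le_trans _ _ (\sum_(i < n) (C * q ^+ i)%:E)%E).
  apply: lee_sum => i _; rewrite -[leLHS]fineK ?fin_num_measure// lee_fin.
  exact: HF.
rewrite sumEFin lee_fin; have := @geometric_le_lim R n C q C0 q0.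
by rewrite gtr0_norm// /series/= big_mkord => /(_ q1).
Unshelve. all: by end_near. Qed.

(** One factor [th] makes the small ball probabilities along the times [a ^+ k] summable, of order
    [k^(-1/th)]; the other is lost between consecutive times. *)
Lemma lil_lower (th : R) : 0 < th < 1 -> P.-negligible (~` [set w | exists M : R,
  forall t, M < t -> th ^+ 2 * Num.sqrt L <= Num.sqrt (ln (ln t) / t) * G t w]).
Proof.
move=> /andP[th0 th1].
(* With this ratio, replacing [t] by the preceding power of [a] costs [sqrt a], which is the inverse
   of [th]. *)
pose a := th ^- 2; pose la := ln a; pose b := th * Num.sqrt L.
have th20 : 0 < th ^+ 2 by rewrite exprn_gt0.
have a0 : 0 < a by rewrite invr_gt0.
have a1 : 1 < a by rewrite invf_gt1// exprn_ilt1// ltW.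
have la0 : 0 < la by rewrite ln_gt0.
have b0 : 0 < b by rewrite mulr_gt0// sqrtr_gt0.
have b2 : b ^+ 2 = th ^+ 2 * L by rewrite exprMn sqr_sqrtr// ltW.
have b20 : 0 < b ^+ 2 by rewrite exprn_gt0.
pose ll k := ln (k%:R * la).
have llE k : ln (ln (a ^+ k)) = ll k by rewrite lnXn// /ll mulr_natl.
pose r k := b * Num.sqrt (a ^+ k / ll k).
pose E k := [set w | G (a ^+ k) w < r k].
have tk0 k : 0 < a ^+ k by rewrite exprn_gt0.
have mE k : measurable (E k) by exact: (measurable_gstar_lt BM LA _ (tk0 k)).
(* The slack [L (1 - th)] leaves the exponent [L th]; divided by [b ^+ 2 = th^2 L] it becomes
   [1 / th], which exceeds 1. *)
have [Y HY] : exists Y : R, forall t e, 0 < t -> 0 < e -> Y <= t / e ^+ 2 ->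
    Pg t e <= expR (- (L * th) * (t / e ^+ 2)).
  have dl0 : 0 < L * (1 - th) by rewrite mulr_gt0// subr_gt0.
  have [Y HY] := HL dl0; exists Y => t e t0 e0 ye.
  have /andP[_] := HY t e t0 e0 ye.
  by rewrite (_ : L - L * (1 - th) = L * th)//; ring.
have PE k z : 0 < z -> Y <= z / b ^+ 2 -> z <= ll k -> fine (P (E k)) <= expR (- (th^-1 * z)).
  move=> z0 Yz zl; have l0 : 0 < ll k by exact: lt_le_trans zl.
  have rk0 : 0 < r k by rewrite mulr_gt0// sqrtr_gt0 divr_gt0.
  have yE : a ^+ k / r k ^+ 2 = ll k / b ^+ 2.
    rewrite exprMn sqr_sqrtr ?divr_ge0 ?(ltW (tk0 k)) ?(ltW l0)//.
    by field; rewrite !gt_eqF.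
  have := HY (a ^+ k) (r k) (tk0 k) rk0; rewrite yE => /(_ _)/le_trans; apply.
    by apply: le_trans Yz _; rewrite ler_pM2r ?invr_gt0.
  rewrite ler_expR mulNr lerN2 b2.
  rewrite (_ : L * th * (ll k / (th ^+ 2 * L)) = th^-1 * ll k); last by field; rewrite !gt_eqF.
  by rewrite ler_pM2l ?invr_gt0.
pose z j : R := j%:R * ln 2 + ln la.
have ln20 : 0 < ln 2 :> R by rewrite ln_gt0// ltr1n.
have [J HJ] : exists J : nat, forall j, (J <= j)%N -> 0 < z j /\ Y <= z j / b ^+ 2.
  pose c := Num.max 1 (Y * b ^+ 2) - ln la.
  exists (Num.trunc (c / ln 2)).+1 => j Jj.
  have : Num.max 1 (Y * b ^+ 2) <= z j.
    rewrite /z -lerBlDr -ler_pdivrMr//; apply: ltW; apply: lt_le_trans (truncnS_gt _) _.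
    by rewrite ler_nat.
  rewrite ge_max => /andP[h1 h2]; split; first exact: lt_le_trans h1.
  by rewrite ler_pdivlMr.
have llz j k : (2 ^ j <= k)%N -> z j <= ll k.
  move=> jk; rewrite /z /ll mulr_natl -lnXn// -lnM ?posrE ?exprn_gt0//.
  have k0 : 0 < k%:R :> R by rewrite ltr0n (leq_trans _ jk)// expn_gt0.
  rewrite ler_ln ?posrE ?mulr_gt0 ?exprn_gt0// ler_pM2r//.
  by rewrite -natrX ler_nat.
(* Grouping the indices [k] in dyadic blocks makes the bound geometric: [2^(j + J)] events of
   probability at most [expR (- z (j + J) / th)]. *)
pose F j := \big[setU/set0]_(i < 2 ^ (j + J)) E (2 ^ (j + J) + i)%N.
have mF j : measurable (F j) by apply: bigsetU_measurable.
pose q := expR (- (th^-1 - 1) * ln 2).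
have thv : 1 < th^-1 by rewrite invf_gt1.
have q01 : 0 < q < 1.
  by rewrite expR_gt0 /= -expR0 ltr_expR mulNr oppr_lt0 mulr_gt0// subr_gt0.
have q0 : 0 < q by case/andP: q01.
have PF j : fine (P (F j)) <= (q ^+ J * expR (- (th^-1 * ln la))) * q ^+ j.
  have [z0 Yz] := HJ _ (leq_addl j J).
  rewrite -lee_fin fineK ?fin_num_measure//.
  apply: le_trans (@Boole_inequality _ _ _ P (fun i => E (2 ^ (j + J) + i)%N) (2 ^ (j + J)) _) _.
    by move=> i _; exact: mE.
  apply: (@le_trans _ _ (\sum_(i < 2 ^ (j + J)) (expR (- (th^-1 * z (j + J)%N)))%:E)%E).
    apply: lee_sum => i _; rewrite -[leLHS]fineK ?fin_num_measure// lee_fin.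
    by apply: PE => //; apply: llz; exact: leq_addr.
  rewrite sumEFin lee_fin sumr_const card_ord -[leLHS]mulr_natl natrX.
  have -> : 2 ^+ (j + J) = expR ((j + J)%:R * ln 2) :> R.
    by rewrite mulr_natl -lnXn// lnK// posrE exprn_gt0.
  rewrite mulrAC -exprD -!expRM_natl -!expRD ler_expR /z addnC.
  by rewrite le_eqVlt; apply/orP; left; apply/eqP; ring.
have PL : P (lim_sup_set F) = 0%E.
  apply: (borel_cantelli_geometric mF _ q01 PF).
  by rewrite mulr_ge0 ?exprn_ge0 ?expR_ge0// ltW.
have mL : measurable (lim_sup_set F).
  by apply: bigcapT_measurable => n; apply: bigcup_measurable => k _.
exists (lim_sup_set F); split => // w; apply: contra_notP => nw /=.
have [N HN] : exists N, forall j, (N <= j)%N -> ~ F j w.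
  apply: contrapT => h; apply: nw => n _.
  apply: contrapT => h'; apply: h; exists n => j nj Fj; apply: h'.
  by exists j.
have Ek k : (2 ^ (N + J) <= k)%N -> r k <= G (a ^+ k) w.
  move=> Nk; rewrite leNgt; apply/negP => Hk.
  have k0 : (0 < k)%N by apply: leq_trans Nk; rewrite expn_gt0.
  pose j := trunc_log 2 k.
  have /andP[j1 j2] : (2 ^ j <= k < 2 ^ j.+1)%N by rewrite trunc_logP// trunc_log_ltn.
  have NJj : (N + J <= j)%N by rewrite -ltnS -(ltn_exp2l _ _ (isT : 1 < 2)%N) (leq_ltn_trans Nk).
  have jE : (j - J + J = j)%N by rewrite subnK// (leq_trans _ NJj)// leq_addl.
  apply: (HN (j - J)%N); first by rewrite leq_subRL ?(leq_trans _ NJj)// ?leq_addl// addnC.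
  rewrite /F jE.
  have ik : (k - 2 ^ j < 2 ^ j)%N by rewrite ltn_subLR// addnn -mul2n -expnS.
  rewrite (bigD1 (Ordinal ik))//=; left.
  by rewrite subnKC.
exists (Num.max 1 (a ^+ (2 ^ (N + J)))) => t; rewrite gt_max => /andP[t1 tN].
have t0 : 0 < t by exact: lt_trans t1.
have lt0 : 0 < ln t by rewrite ln_gt0.
(* The index with [a ^+ k <= t < a ^+ k.+1]. *)
pose k := Num.trunc (ln t / la).
have /andP[k1 k2] : k%:R <= ln t / la < k.+1%:R by apply: truncn_itv; rewrite divr_ge0// ltW.
have tk : a ^+ k <= t.
  rewrite -ler_ln ?posrE// lnXn// -mulr_natl -ler_pdivlMr//.
have tk1 : t < a ^+ k.+1.
  by rewrite -ltr_ln ?posrE// lnXn// -mulr_natl -ltr_pdivrMr.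
have kN : (2 ^ (N + J) <= k)%N.
  rewrite -ltnS -(ltr_nat R); apply: le_lt_trans k2; rewrite ler_pdivlMr// mulr_natl -lnXn//.
  by rewrite ler_ln ?posrE// ltW.
have lk0 : 0 < ll k.
  have [z0 _] := HJ _ (leq_addl N J); apply: lt_le_trans z0 _; exact: llz.
have Gt : r k <= G t w.
  apply: le_trans (Ek k kN) _.
  have cW1 v : {within `[0, +oo[, continuous (W1^~ v)} by have [_ _ cW _] := BM; have [] := cW v.
  have cW2 v : {within `[0, +oo[, continuous (W2^~ v)} by have [_ _ cW _] := BM; have [] := cW v.
  have cA v : {within `[0, +oo[, continuous (A^~ v)} by have [_ [cA _]] := LA.
  apply/(gstar_le cW1 cW2 cA w _ (ltW (tk0 k))) => s /andP[s0 sk].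
  have /(gstar_le cW1 cW2 cA w _ (ltW t0)) := lexx (G t w); apply.
  by rewrite s0 (le_trans sk).
have lln : ll k <= ln (ln t).
  rewrite -llE ler_ln ?posrE// ?ln_gt0 ?ler_ln ?posrE//.
  rewrite exprn_egt1// -lt0n (leq_trans _ kN)// expn_gt0//.
have h1 : Num.sqrt (ll k / a ^+ k.+1) <= Num.sqrt (ln (ln t) / t).
  rewrite ler_sqrt; last by apply: divr_ge0; [exact/ltW/(lt_le_trans lk0)|exact: ltW].
  apply: ler_pM => //; first exact: ltW; first by rewrite invr_ge0 ltW.
  by rewrite lef_pV2 ?posrE// ltW.
apply: (@le_trans _ _ (Num.sqrt (ll k / a ^+ k.+1) * r k)); last first.
  by apply: ler_pM => //; rewrite mulr_ge0 ?sqrtr_ge0// ltW.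
rewrite /r mulrCA -sqrtrM ?divr_ge0 ?(ltW lk0) ?(ltW (tk0 _))//.
have -> : ll k / a ^+ k.+1 * (a ^+ k / ll k) = th ^+ 2.
  have ak : a ^+ k.+1 = a * a ^+ k by rewrite exprS.
  rewrite ak {1}/a; have := tk0 k; set ak' := a ^+ k => ak0.
  by field; rewrite !gt_eqF.
by rewrite sqrtr_sqr gtr0_norm// /b [leRHS]mulrAC -expr2.
Qed.

End lil_lower.

(** * Almost independent blocks at factorial times *)

Section factorial_blocks.
Context {R : realType} {d : measure_display} {T : measurableType d}.
Variable P : probability T R.
Variables (W1 W2 A : R -> T -> R).
Hypotheses (BM : std_BM2 P W1 W2) (LA : is_levy_area P W1 W2 A).
Local Notation X := (pth W1 W2 A).
Local Notation pi := (pi_ P W1 W2 A).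
Let H : HBM P W1 W2 A := HBM0 BM LA.
Let mX := measurable_pth H.

Lemma measurable_shiftp n : measurable_fun [set: pathT R idx] (shiftp n).
Proof.
apply: measurable_path => i; rewrite /shiftp.
apply: mH_hmul; last exact: mH_pt.
by apply: mH_hinv; exact: mH_pt.
Qed.

Lemma pt_shiftp_stop n N (x : pathT R idx) m k : (n <= N)%N -> (n * 2 ^ m + k <= N * 2 ^ m)%N ->
  pt (shiftp n (stop N x)) m k = pt (shiftp n x) m k.
Proof. by move=> nN kN; rewrite !pt_shiftp !pt_stop// expn0 !muln1. Qed.

Lemma pi_indep n (S S' : set (pathT R idx)) : measurable S -> measurable S' ->
  (forall x, S (stop n x) <-> S x) ->
  pi (S `&` [set x | S' (shiftp n x)]) = pi S * pi S'.
Proof.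
move=> mS mS' St; rewrite /pi_ -fineM ?fin_num_measure//; try exact: (measurable_preim mX).
rewrite (_ : X @^-1` S = (stop n \o X) @^-1` S); last by apply/seteqP; split => w /=; rewrite St.
rewrite -(path_indep n H H mS mS'); congr (fine (P _)).
by apply/seteqP; split => w /=; rewrite St shiftp_pth.
Qed.

(** The ratio [tk k.+1 / tk k] is [(k + 1)^4], so a past of size [k sqrt (tk k)] is negligible
    against [sqrt (tk k.+1)] even after the iterated logarithm. Yet [ln (ln (tk k))] grows only like
    [ln k], which keeps the series of probabilities divergent. *)
Definition tk (k : nat) := (k`! ^ 4)%N.

Lemma tk_gt0 k : (0 < tk k)%N. Proof. by rewrite expn_gt0 fact_gt0. Qed.

Lemma tkS k : tk k.+1 = (k.+1 ^ 4 * tk k)%N. Proof. by rewrite /tk factS expnMn. Qed.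

Lemma tk_leS k : (tk k <= tk k.+1)%N.
Proof. by rewrite tkS leq_pmull// expn_gt0. Qed.

Lemma tk_le k n : (k <= n)%N -> (tk k <= tk n)%N.
Proof. exact: (homo_leq leqnn leq_trans tk_leS). Qed.

Section blocks.
Variable r : nat -> R.
(** [Ek] asks the path restarted at [tk k] to stay small over the block, [Bk] asks the past up to
    [tk k] to be moderate, and [DD m n] asks for both at some index from [m] to [n - 1]. *)
Definition Ek k : set (pathT R idx) := [set x | Ds (0, 0, 0) (tk k.+1 - tk k) (r k) (shiftp (tk k) x)].
Definition Bk k : set (pathT R idx) := Ds (0, 0, 0) (tk k) (k%:R * Num.sqrt (tk k)%:R).
Definition ek k := pi (Ds (0, 0, 0) (tk k.+1 - tk k) (r k)).
Definition DD m n : set (pathT R idx) := [set x | exists k, [/\ (m <= k)%N, (k < n)%N, Ek k x & Bk k x]].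

Let mEk k : measurable (Ek k).
Proof. exact: (measurable_preim (measurable_shiftp _) (measurable_Ds _ _ _)). Qed.

Let mDD m n : measurable (DD m n).
Proof.
rewrite (_ : DD m n = \bigcup_(k in [set k | (m <= k)%N /\ (k < n)%N]) (Ek k `&` Bk k)); last first.
  apply/seteqP; split => x /=; first by move=> [k [mk kn Ekx Bkx]]; exists k.
  by move=> [k [mk kn] [Ekx Bkx]]; exists k.
by apply: bigcup_measurable => k _; apply: measurableI => //; exact: measurable_Ds.
Qed.

Let DD_stop m n x : DD m n (stop (tk n) x) <-> DD m n x.
Proof.
have B k : (k < n)%N -> Bk k (stop (tk n) x) <-> Bk k x.
  move=> kn; split => h i j ij; have := h i j ij; rewrite pt_stop//;
  by apply: leq_trans ij _; rewrite leq_mul2r tk_le ?orbT// ltnW.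
have E k : (k < n)%N -> Ek k (stop (tk n) x) <-> Ek k x.
  move=> kn; have q i j : (j <= (tk k.+1 - tk k) * 2 ^ i)%N ->
      pt (shiftp (tk k) (stop (tk n) x)) i j = pt (shiftp (tk k) x) i j.
    move=> ij; rewrite pt_shiftp_stop//; first by rewrite tk_le// ltnW.
    apply: (@leq_trans (tk k.+1 * 2 ^ i)); last by rewrite leq_mul2r tk_le ?orbT.
    by rewrite -[X in (_ <= X * _)%N](subnKC (tk_leS k)) mulnDl leq_add2l.
  by split => h i j ij; have := h i j ij; rewrite q.
split=> -[k [mk kn Ex Bx]]; exists k; split => //.
- exact: (E k kn).1.
- exact: (B k kn).1.
- exact: (E k kn).2.
- exact: (B k kn).2.
Qed.

Let e_ge0 k : 0 <= ek k. Proof. exact: pi_ge0. Qed.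
Let e_le1 k : ek k <= 1. Proof. by apply: (pi_le1 H); exact: measurable_Ds. Qed.

(* Decompose according to the last index k < n.+1 at which Ek holds: it is
   independent of the past event Bk. *)
Let DD_rec m n : (m <= n)%N -> ek n * pi (Bk n) + pi (DD m n) * (1 - ek n) <= pi (DD m n.+1).
Proof.
move=> mn.
pose S' := Ds (0, 0, 0) (tk n.+1 - tk n) (r n) : set (pathT R idx).
have mS' : measurable S' by exact: measurable_Ds.
have i1 : pi (Bk n `&` Ek n) = pi (Bk n) * ek n.
  by apply: pi_indep => //; [exact: measurable_Ds|move=> x; exact: Ds_stop].
have i2 : pi (DD m n `&` Ek n) = pi (DD m n) * ek n.
  by apply: pi_indep => //; exact: DD_stop.
have mP S : measurable S -> measurable (X @^-1` S) by exact: (measurable_preim mX).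
have i3 : pi (DD m n `&` ~` Ek n) = pi (DD m n) * (1 - ek n).
  rewrite mulrBr mulr1 -i2 /pi_ -fineB ?fin_num_measure//; try exact/mP/measurableI; try exact: mP.
  rewrite (_ : X @^-1` (DD m n `&` ~` Ek n) = X @^-1` DD m n `\` X @^-1` Ek n)//.
  rewrite measureD ?preimage_setI//; try exact: mP.
  by apply: le_lt_trans (probability_le1 P _) _; rewrite ?ltry//; exact: mP.
rewrite mulrC -i1 -i3 /pi_ -fineD ?fin_num_measure//; try exact/mP/measurableI/measurableC;
  try (apply/mP/measurableI => //; exact: measurable_Ds).
rewrite -measureU; last first.
- by apply/seteqP; split => w //= [[_ Ew] [_ nEw]].
- by apply/mP/measurableI => //; exact: measurableC.
- by apply/mP/measurableI => //; exact: measurable_Ds.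
rewrite -preimage_setU; apply: Pr_le.
- apply/mP/measurableU; apply: measurableI => //; [exact: measurable_Ds|exact: measurableC].
- exact: mP.
move=> w /= [[Bw Ew]|[[k [mk kn Ew Bw]] _]]; first by exists n.
by exists k; split => //; exact: ltnW.
Qed.

(** This stands in for the second Borel-Cantelli lemma: [Ek] is independent of [Bk], but the events
    [Bk] are correlated. The recursion dominates the one with [ek = 1 / (k + 2)], whose product of
    [1 - 1 / (k + 2)] telescopes. *)
Lemma DD_lower m n (beta : R) : 0 <= beta <= 1 ->
  (forall k, (m <= k)%N -> beta <= pi (Bk k)) ->
  (forall k, (m <= k)%N -> k.+2%:R^-1 <= ek k) ->
  beta * (1 - m.+1%:R / (m + n).+1%:R) <= pi (DD m (m + n)).
Proof.
move=> /andP[b0 b1] HB He; elim: n => [|n IH].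
  by rewrite addn0 divff ?subrr ?mulr0 ?pi_ge0// pnatr_eq0.
rewrite addnS; set N := (m + n)%N in IH *.
have mN : (m <= N)%N by exact: leq_addr.
apply: le_trans (DD_rec mN).
have h1 := HB _ mN; have h2 := He _ mN.
pose s : R := m.+1%:R / N.+1%:R.
have N0 : 0 < N.+1%:R :> R by rewrite ltr0n.
have s0 : 0 <= s by rewrite divr_ge0.
have -> : m.+1%:R / N.+2%:R = s * (1 - N.+2%:R^-1).
  rewrite /s -[N.+2%:R]natr1; field.
  by rewrite -!natr1 in N0 *; apply/andP; split; apply: lt0r_neq0; move: (ler0n R N); lra.
have q1 : ek N * beta <= ek N * pi (Bk N) by rewrite ler_wpM2l.
have q2 : beta * (1 - s) * (1 - ek N) <= pi (DD m N) * (1 - ek N).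
  by rewrite ler_wpM2r// subr_ge0.
have q3 : 0 <= beta * s * (ek N - N.+2%:R^-1) by rewrite !mulr_ge0// subr_ge0.
move: q1 q2 q3; set E := ek N; set V := N.+2%:R^-1; lra.
Qed.

Lemma measurable_DD m n : measurable (DD m n). Proof. exact: mDD. Qed.

End blocks.

End factorial_blocks.

(** * Iterated logarithms of factorial times *)

Section loglog_factorial.
Context {R : realType}.

Lemma fact_le_exp n m : (n <= m)%N -> (n`! <= m ^ n)%N.
Proof.
elim: n => // n IH nm; rewrite factS expnS leq_mul// IH//; exact: ltnW.
Qed.

Lemma tk_ge k : (k <= tk k)%N.
Proof.
apply: leq_trans (fact_geq k) _; rewrite /tk -[leqLHS]expn1 leq_pexp2l//.
exact: fact_gt0.
Qed.

Lemma loglog_tk_ge (C : R) : \forall k \near \oo, C <= ln (ln (tk k.+1)%:R).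
Proof.
near=> k.
have h : expR (expR C) <= (tk k.+1)%:R.
  apply: (@le_trans _ _ k%:R); first by near: k; exact: nbhs_infty_ger.
  by rewrite ler_nat; apply: leq_trans (tk_ge _).
have u0 : 0 < (tk k.+1)%:R :> R by rewrite ltr0n tk_gt0.
have h1 : expR C <= ln (tk k.+1)%:R.
  by rewrite -[leLHS]expRK ler_ln// posrE ?expR_gt0.
by rewrite -[leLHS]expRK ler_ln// posrE ?expR_gt0// (lt_le_trans _ h1)// expR_gt0.
Unshelve. all: by end_near. Qed.

(** From [ln (tk k.+1) <= 4 (k + 2) ln (k + 2)], the iterated logarithm is at most [ln (k + 2)] plus
    [ln 4] and the logarithm of [ln (k + 2)]. *)
Lemma loglog_tk_le (th : R) : 1 < th ->
  \forall k \near \oo, ln (ln (tk k.+1)%:R) <= th * ln k.+2%:R.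
Proof.
move=> th1.
(* Half of [th - 1] pays for the linear part of [ln z <= z / s + ln s], the other half for the
   constants. *)
have [s s0 sE] : exists2 s, 0 < s & (th - 1) / 2 = s^-1.
  by exists (2 / (th - 1)); rewrite ?invf_div// divr_gt0// subr_gt0.
near=> k; pose z : R := ln k.+2%:R.
have zC : s * (ln 4 + ln s) <= z.
  rewrite -[leLHS]expRK ler_ln ?posrE ?expR_gt0 ?ltr0n//.
  apply: (@le_trans _ _ k%:R); first by near: k; exact: nbhs_infty_ger.
  by rewrite ler_nat ltnW.
have z0 : 0 < z by rewrite ln_gt0// ltr1n.
have lz : ln z <= z / s + ln s.
  have -> : ln z = ln (z / s) + ln s by rewrite -lnM ?posrE ?divr_gt0// divfK// gt_eqF.
  by rewrite lerD2r; apply/ltW/ln_sublinear; rewrite divr_gt0.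
have lu : ln (tk k.+1)%:R <= 4 * (k.+2%:R * z).
  rewrite /tk natrX lnXn ?ltr0n ?fact_gt0// -[leLHS]mulr_natl ler_pM2l//.
  rewrite mulr_natl -lnXn ?ltr0n// ler_ln ?posrE ?exprn_gt0 ?ltr0n ?fact_gt0//.
  rewrite -natrX ler_nat (leq_trans (fact_le_exp (leqnSn _)))//.
  by rewrite leq_pexp2l.
have lu1 : 0 < ln (tk k.+1)%:R :> R.
  have k2 : (2 <= k.+1)%N by near: k; exact: (nbhs_infty_ge 1).
  by rewrite ln_gt0// ltr1n (leq_trans _ (tk_ge _)).
apply: (@le_trans _ _ (ln (4 * (k.+2%:R * z)))).
  by rewrite ler_ln ?posrE// !mulr_gt0.
rewrite lnM ?posrE ?mulr_gt0// lnM ?posrE// -/z.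
have -> : th * z = z + z / s + z / s.
  by rewrite -sE; field.
have : ln 4 + ln s <= z / s by rewrite ler_pdivlMr// mulrC.
by move: lz; lra.
Unshelve. all: by end_near. Qed.

(** The contribution of the past, normalised as in the liminf. Its square is [k^2 l / (k + 1)^4]
    with [l] the iterated logarithm, and the crude bound [l <= 2 (k + 2)] already sends it to 0. *)
Lemma loglog_tk_error (c : R) : 0 < c -> \forall k \near \oo,
  k%:R * Num.sqrt (tk k)%:R * Num.sqrt (ln (ln (tk k.+1)%:R) / (tk k.+1)%:R) <= c.
Proof.
move=> c0; near=> k.
have : 0 <= ln (ln (tk k.+1)%:R) :> R by near: k; exact: loglog_tk_ge.
have h : ln (ln (tk k.+1)%:R) <= 2 * ln k.+2%:R :> R by near: k; apply: loglog_tk_le; rewrite ltr1n.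
have : ln (ln (tk k.+1)%:R) <= 2 * k.+2%:R :> R.
  by apply: le_trans h _; rewrite ler_pM2l// ltW// ln_sublinear.
set l := ln (ln _) => l1 l0.
have kc : 4 / c ^+ 2 <= k%:R by near: k; exact: nbhs_infty_ger.
have k1 : (0 < k)%N by near: k; exact: nbhs_infty_ge.
have k0 : 0 < k%:R :> R by rewrite ltr0n.
have t0 : 0 < (tk k)%:R :> R by rewrite ltr0n tk_gt0.
rewrite -(@ler_pXn2r _ 2) ?nnegrE ?mulr_ge0 ?(ltW c0) ?sqrtr_ge0//.
rewrite !exprMn !sqr_sqrtr ?divr_ge0// ?(ltW t0)//.
rewrite tkS natrM natrX -natr1.
have -> : k%:R ^+ 2 * (tk k)%:R * (l / ((k%:R + 1) ^+ 4 * (tk k)%:R)) = k%:R ^+ 2 * l / (k%:R + 1) ^+ 4 :> R.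
  by field; rewrite !gt_eqF//; move: k0; lra.
rewrite ler_pdivrMr ?exprn_gt0 ?addr_gt0//.
have {}kc : 4 <= c ^+ 2 * k%:R by rewrite mulrC -ler_pdivrMr// exprn_gt0.
move: l1; rewrite -[k.+2%:R]natr1 -[k.+1%:R]natr1 => l1.
have h1 : k%:R ^+ 2 * l <= k%:R ^+ 2 * (2 * (k%:R + 1 + 1)) by rewrite ler_wpM2l ?exprn_ge0// ltW.
apply: le_trans h1 _.
have k1' : 1 <= k%:R :> R by rewrite ler1n.
set x : R := k%:R in k0 kc k1' *.
have h2 : 4 * (x ^+ 2 * (x + 1)) <= c ^+ 2 * x * (x ^+ 2 * (x + 1)).
  by rewrite ler_pM2r// mulr_gt0 ?exprn_gt0 ?addr_gt0.
have h3 : c ^+ 2 * (x ^+ 3 * (x + 1)) <= c ^+ 2 * (x + 1) ^+ 4.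
  rewrite ler_pM2l ?exprn_gt0// [leRHS]exprSr ler_pM2r ?addr_gt0//.
  by rewrite lerXn2r ?nnegrE ?addr_ge0 ?(ltW k0)// lerDl.
have h4 : x ^+ 2 * (2 * (x + 1 + 1)) <= 4 * (x ^+ 2 * (x + 1)).
  rewrite [leRHS]mulrCA ler_pM2l ?exprn_gt0//; lra.
apply: le_trans h4 _; apply: le_trans h2 _; apply: le_trans h3.
by rewrite le_eqVlt; apply/orP; left; apply/eqP; ring.
Unshelve. all: by end_near. Qed.

End loglog_factorial.

(** * Upper bound of the liminf *)

Section lil_upper.
Context {R : realType} {d : measure_display} {T : measurableType d}.
Variable P : probability T R.
Variables (W1 W2 A : R -> T -> R).
Hypotheses (BM : std_BM2 P W1 W2) (LA : is_levy_area P W1 W2 A).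
Local Notation Pg := (Pg P W1 W2 A).
Local Notation G := (gstar W1 W2 A).
Local Notation X := (pth W1 W2 A).
Local Notation pi := (pi_ P W1 W2 A).
Variable L : R.
Hypothesis L0 : 0 < L.
Hypothesis HL : forall delta : R, 0 < delta ->
  exists Y : R, forall t e, 0 < t -> 0 < e -> Y <= t / e ^+ 2 ->
    expR (- (L + delta) * (t / e ^+ 2)) <= Pg t e <= expR (- (L - delta) * (t / e ^+ 2)).
Let H : HBM P W1 W2 A := HBM0 BM LA.
Let mX := measurable_pth H.

Lemma pth_scale1 : pth (scaleW 1 W1) (scaleW 1 W2) (scaleA 1 A) = X.
Proof.
have W W' : scaleW 1 W' = W' :> (R -> T -> R).
  by apply/funext => t; apply/funext => w; rewrite /scaleW expr1n divr1 mul1r.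
rewrite !W (_ : scaleA 1 A = A)//.
by apply/funext => t; apply/funext => w; rewrite /scaleA expr1n divr1 mul1r.
Qed.

Lemma gstar_tkS_le r k w : 0 <= r k -> Ek r k (X w) -> Bk k (X w) ->
  G (tk k.+1)%:R w <= k%:R * Num.sqrt (tk k)%:R + r k.
Proof.
move=> r0 Ew Bw; rewrite -[leRHS]divr1.
apply: (@Ds_gstar _ _ _ _ _ _ _ BM LA _ _ _ (tk k.+1)) => //; first by rewrite expr1n mulr1.
rewrite pth_scale1 -(subnKC (tk_leS k)); apply/Ds_split; split.
  by apply: DsS Bw; rewrite lerDl.
move=> i j ij; apply: le_trans (hn_mul _ _) _; apply: lerD.
  by apply: Bw; rewrite expn0 muln1.
by have := Ew i j ij; rewrite hmul1l.
Qed.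

Lemma Pg_cvg1 (eta : R) : 0 < eta -> \forall k \near \oo, 1 - eta <= Pg 1 k%:R.
Proof.
move=> eta0; pose F k := [set w | G 1 w < k%:R].
have mF k : measurable (F k) by exact: (measurable_gstar_lt BM LA).
have FT : \bigcup_k F k = setT.
  apply/seteqP; split => // w _; exists (Num.trunc (G 1 w)).+1 => //=.
  exact: truncnS_gt.
have hF : (P \o F) x @[x --> \oo] --> (1%:E : \bar R).
  rewrite -[1%:E](probability_setT P) -FT; apply: nondecreasing_cvg_mu => //; first by rewrite FT.
  move=> m n mn; apply/subsetPset => w /= /lt_le_trans; apply.
  by rewrite ler_nat.
have /fine_cvgP[_ /cvgrPdist_le/(_ _ eta0)] := hF; apply: filterS => k /=.
by move=> /ler_normlW; rewrite /Pg -/(F k); lra.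
Qed.

(** Scaling by [sqrt (tk k)] brings [Bk] to unit time and radius [k], so its probability tends to 1
    by [Pg_cvg1]. *)
Lemma pi_Bk_ge k : Pg 1 k%:R <= pi (Bk k).
Proof.
rewrite /Bk mulrC; apply: (Pg_upper BM LA) => //.
  by rewrite sqrtr_gt0 ltr0n tk_gt0.
by rewrite mul1r sqr_sqrtr.
Qed.

(** With slack [L (th - 1)] the exponent becomes the iterated logarithm divided by [th], which is at
    most [ln (k + 2)] by [loglog_tk_le]. *)
Lemma ek_ge (th b : R) : 1 < th -> b = th * Num.sqrt L ->
  \forall k \near \oo, k.+2%:R^-1 <=
    ek P W1 W2 A (fun k => b * Num.sqrt ((tk k.+1)%:R / ln (ln (tk k.+1)%:R))) k.
Proof.
move=> th1 bE.
have th0 : 0 < th by exact: lt_trans th1.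
have b0 : 0 < b by rewrite bE mulr_gt0// sqrtr_gt0.
have b2 : b ^+ 2 = th ^+ 2 * L by rewrite bE exprMn sqr_sqrtr// ltW.
have dl0 : 0 < L * (th - 1) by rewrite mulr_gt0// subr_gt0.
have [Y HY] := HL dl0; near=> k.
have : 1 <= ln (ln (tk k.+1)%:R) :> R by near: k; exact: loglog_tk_ge.
have : Y * b ^+ 2 <= ln (ln (tk k.+1)%:R) by near: k; exact: loglog_tk_ge.
have : ln (ln (tk k.+1)%:R) <= th * ln k.+2%:R by near: k; exact: loglog_tk_le.
set u : R := (tk k.+1)%:R; set l := ln (ln u) => lle lY l1.
have l0 : 0 < l by exact: lt_le_trans l1.
have u0 : 0 < u by rewrite ltr0n tk_gt0.
pose r := b * Num.sqrt (u / l).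
have r0 : 0 < r by rewrite mulr_gt0// sqrtr_gt0 divr_gt0.
have yE : u / r ^+ 2 = l / b ^+ 2.
  by rewrite exprMn sqr_sqrtr ?divr_ge0 ?(ltW u0) ?(ltW l0)//; field; rewrite !gt_eqF.
have /andP[+ _] := HY u r u0 r0 ltac:(by rewrite yE ler_pdivlMr// exprn_gt0).
rewrite yE (_ : - (L + L * (th - 1)) * (l / b ^+ 2) = - (l / th)); last first.
  by rewrite b2; field; rewrite !gt_eqF.
move=> hP; apply: (@le_trans _ _ (expR (- (l / th)))).
  rewrite -[leLHS](@lnK _ k.+2%:R^-1) ?posrE ?invr_gt0// ler_expR lnV ?posrE// lerN2.
  by rewrite ler_pdivrMr// mulrC.
(* Surviving up to [tk k.+1] is more demanding than surviving for the length of the block. *)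
apply: le_trans hP _.
have := @Pg_upper _ _ _ _ _ _ _ BM LA 1 u r (tk k.+1) ltr01 u0.
rewrite expr1n mulr1 mul1r => /(_ (lexx _))/le_trans; apply.
apply: (pi_le H); [exact: measurable_Ds|exact: measurable_Ds|].
by move=> x; apply: Ds_le; rewrite leq_subr.
Unshelve. all: by end_near. Qed.

(** Almost surely good blocks occur beyond every index [m]. At the end of such a block [th * sqrt L]
    bounds the share of the block itself, and [th - 1] that of the past. *)
Lemma lil_upper (th : R) : 1 < th -> P.-negligible (~` [set w | forall M : R,
  exists2 t, M < t & Num.sqrt (ln (ln t) / t) * G t w <= th * Num.sqrt L + (th - 1)]).
Proof.
move=> th1; pose b := th * Num.sqrt L.
pose r k := b * Num.sqrt ((tk k.+1)%:R / ln (ln (tk k.+1)%:R)).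
have b0 : 0 <= b by rewrite mulr_ge0 ?sqrtr_ge0// ltW// (lt_trans _ th1).
pose V m := \bigcup_n (X @^-1` DD r m n).
have mV m : measurable (V m).
  by apply: bigcupT_measurable => n; apply: (measurable_preim mX); exact: measurable_DD.
have PV m : P (V m) = 1%E.
  apply/eqP; rewrite eq_le probability_le1//=.
  rewrite -[leRHS]fineK ?fin_num_measure// lee_fin; apply/ler_addgt0Pl => eta eta0.
  (* One loss [x] comes from the past events [Bk] and one from the telescoped ratio;
     [(1 - x)^2 >= 1 - eta]. *)
  pose x := Num.min 1 (eta / 2).
  have x0 : 0 < x by rewrite lt_min ltr01 divr_gt0.
  have x1 : x <= 1 by rewrite ge_min lexx.
  have xe : x <= eta / 2 by rewrite ge_min lexx orbT.
  have [N1 _ h1] := Pg_cvg1 x0.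
  have [N2 _ h2] := ek_ge th1 (erefl b).
  pose m' := maxn m (maxn N1 N2).
  have mm' : (m <= m')%N by exact: leq_maxl.
  have mN1 : (N1 <= m')%N by rewrite /m' !leq_max leqnn orbT.
  have mN2 : (N2 <= m')%N by rewrite /m' !leq_max leqnn !orbT.
  have [n Hn] : exists n, m'.+1%:R / (m' + n).+1%:R <= x.
    exists (Num.trunc (m'.+1%:R / x)).
    rewrite ler_pdivrMr// mulrC -ler_pdivrMr// ltW// (lt_le_trans (truncnS_gt _))//.
    by rewrite ler_nat ltnS leq_addl.
  have := @DD_lower _ _ _ _ _ _ _ BM LA r m' n (1 - x).
  rewrite subr_ge0 x1 gerBl (ltW x0) => /(_ isT) h.
  apply: (@le_trans _ _ (eta + (1 - x) * (1 - m'.+1%:R / (m' + n).+1%:R))).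
    have := ler_wpM2l (_ : 0 <= 1 - x) Hn; rewrite subr_ge0 => /(_ x1).
    move: (sqr_ge0 x); set q := _ / _; move: xe; rewrite expr2; lra.
  rewrite lerD2l; apply: le_trans (h _ _) _.
  - move=> k mk; apply: le_trans (pi_Bk_ge k); apply: h1 => /=; exact: leq_trans mk.
  - by move=> k mk; apply: h2 => /=; exact: leq_trans mk.
  apply: Pr_le => //; first by apply: (measurable_preim mX); exact: measurable_DD.
  move=> w [k [mk kn Ew Bw]]; exists (m' + n)%N => //.
  by exists k; split => //; exact: leq_trans mk.
apply: (@negligibleS _ _ _ _ (\bigcup_m ~` V m)); last first.
  apply: negligible_bigcup => m; apply/negligibleP; first exact: measurableC.
  by have := probability_setC P (mV m); rewrite PV subee.
move=> w; apply: contra_notP => nw /= M.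
have Vw m : V m w by apply: contrapT => h; apply: nw; exists m.
have th1' : 0 < th - 1 by rewrite subr_gt0.
have [N1 _ h1] := @loglog_tk_error R _ th1'.
have [N2 _ h2] := @loglog_tk_ge R 1.
have [N3 _ h3] := @nbhs_infty_ger R M.
have [n _ [k [mk _ Ew Bw]]] := Vw (maxn N1 (maxn N2 N3)).
move: mk; rewrite !geq_max => /and3P[k1 k2 k3].
exists (tk k.+1)%:R.
  by apply: le_lt_trans (h3 _ k3) _; rewrite ltr_nat (leq_trans _ (tk_ge _)).
have l1 := h2 _ k2; rewrite /= in l1.
have := h1 _ k1; rewrite /=.
have rk0 : 0 <= r k by rewrite mulr_ge0// sqrtr_ge0.
have := gstar_tkS_le rk0 Ew Bw.
have : (0 : R) < (tk k.+1)%:R by rewrite ltr0n tk_gt0.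
move: l1; rewrite /r -/b.
set u : R := (tk k.+1)%:R; set l := ln (ln u) => l1 u0 hG he.
have l0 : 0 < l by exact: lt_le_trans l1.
have := ler_wpM2l (sqrtr_ge0 (l / u)) hG => /le_trans; apply.
rewrite mulrDr addrC lerD//; last by rewrite mulrC.
rewrite mulrCA -sqrtrM ?divr_ge0 ?(ltW l0) ?(ltW u0)//.
by rewrite (_ : l / u * (u / l) = 1) ?sqrtr1 ?mulr1//; field; rewrite !gt_eqF.
Qed.

End lil_upper.

(** * The liminf, the logarithmic limit, and their common constant *)

Lemma liminf_pinftyE {R : realType} (f : R -> R) (c : R) :
  (forall a, a < c -> exists M, forall t, M < t -> a <= f t) ->
  (forall a, c < a -> forall M, exists2 t, M < t & f t <= a) ->
  liminf_pinfty f = c%:E.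
Proof.
move=> Hl Hu; apply/eqP; rewrite eq_le; apply/andP; split.
  apply: ge_ereal_sup => _ [M _ <-]; apply/lee_addgt0Pr => e e0.
  have [t Mt ft] := Hu (c + e) ltac:(by rewrite ltrDl) M.
  apply: (@le_trans _ _ (f t)%:E); last by rewrite -EFinD lee_fin.
  by apply: ereal_inf_lbound; exists t => //=; rewrite in_itv/= andbT.
apply/lee_addgt0Pr => e e0.
have [M HM] := Hl (c - e) ltac:(by rewrite ltrBlDr ltrDl).
rewrite -leeBlDr//; apply: (@le_trans _ _ (ereal_inf [set (f t)%:E | t in `]M, +oo[])).
  apply: le_ereal_inf_tmp => _ [t /= + <-]; rewrite in_itv/= andbT => Mt.
  by rewrite -EFinB lee_fin HM.
by apply: ereal_sup_ubound; exists M.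
Qed.

Lemma small_ball_limit {R : realType} (p : R -> R) (L : R) :
  (forall delta : R, 0 < delta -> exists Y : R, forall e, 0 < e -> Y <= e ^- 2 ->
    expR (- (L + delta) * e ^- 2) <= p e <= expR (- (L - delta) * e ^- 2)) ->
  (fun e => - e ^+ 2 * ln (p e)) @ 0^'+ --> L.
Proof.
move=> H; apply/cvgrPdist_le => dl dl0; have [Y HY] := H _ dl0; near=> e.
have e0 : 0 < e by near: e; exact: nbhs_right_gt.
have e20 : 0 < e ^+ 2 by rewrite exprn_gt0.
have Y0 : 0 < `|Y| + 1 by rewrite ltr_wpDl.
have eY : Y <= e ^- 2.
  have he : e <= Num.sqrt (`|Y| + 1)^-1.
    by near: e; apply: nbhs_right_le; rewrite sqrtr_gt0 invr_gt0.
  apply: (@le_trans _ _ (`|Y| + 1)); first by rewrite ler_wpDr// ler_norm.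
  rewrite -[leLHS]invrK lef_pV2 ?posrE ?invr_gt0//.
  by rewrite -[leRHS]sqr_sqrtr ?invr_ge0 ?(ltW Y0)// lerXn2r ?nnegrE ?sqrtr_ge0 ?(ltW e0).
have /andP[h1 h2] := HY e e0 eY.
have p0 : 0 < p e by apply: lt_le_trans h1; exact: expR_gt0.
move: h1 h2; rewrite -{1}[p e]lnK ?posrE// -{2}[p e]lnK ?posrE// !ler_expR.
rewrite ler_pdivrMr// ler_pdivlMr// => h1 h2.
by rewrite ler_distl; apply/andP; split; move: h1 h2; rewrite mulrC mulNr; lra.
Unshelve. all: by end_near. Qed.

Theorem theorem3p2 (R : realType) (d : measure_display) (T : measurableType d)
  (P : probability T R) (W1 W2 A : R -> T -> R) :
  std_BM2 P W1 W2 -> is_levy_area P W1 W2 A ->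
  exists c : R, 0 < c /\
    {ae P, forall w,
       liminf_pinfty (fun t => Num.sqrt (ln (ln t) / t) * gstar W1 W2 A t w)
       = c%:E} /\
    (fun eps => - eps ^+ 2 * ln (fine (P [set w | gstar W1 W2 A 1 w < eps])))
      @ 0^'+ --> c ^+ 2.
Proof.
move=> BM LA; have [L L0 HL] := small_ball BM LA; pose c := Num.sqrt L.
have c0 : 0 < c by rewrite sqrtr_gt0.
exists c; split => //; split; last first.
  rewrite sqr_sqrtr ?(ltW L0)//; apply: (@small_ball_limit _ (Pg P W1 W2 A 1)) => dl dl0.
  have [Y HY] := HL _ dl0; exists Y => e e0 eY.
  by have := HY 1 e ltr01 e0; rewrite div1r; apply.
(* Countably many values of [th] tending to 1 from either side, so that the exceptional sets unite
   to a null set. *)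
pose lo (j : nat) : R := 1 - j.+2%:R^-1; pose up (j : nat) : R := 1 + j.+1%:R^-1.
have loP j : 0 < lo j < 1.
  have j1 : j.+2%:R^-1 < 1 :> R by rewrite invf_lt1 ?ltr1n// ltr0n.
  have j0 : 0 < j.+2%:R^-1 :> R by rewrite invr_gt0 ltr0n.
  by rewrite /lo subr_gt0 j1 ltrBlDr ltrDl.
have upP j : 1 < up j by rewrite ltrDl invr_gt0.
pose N1 := \bigcup_j ~` [set w | exists M : R, forall t, M < t ->
  lo j ^+ 2 * c <= Num.sqrt (ln (ln t) / t) * gstar W1 W2 A t w].
pose N2 := \bigcup_j ~` [set w | forall M : R, exists2 t, M < t &
  Num.sqrt (ln (ln t) / t) * gstar W1 W2 A t w <= up j * c + (up j - 1)].
apply: (@negligibleS _ _ _ _ (N1 `|` N2)); last first.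
  apply: negligibleU; apply: negligible_bigcup => j.
    exact: (lil_lower BM LA L0 HL (loP j)).
  exact: (lil_upper BM LA L0 HL (upP j)).
move=> w; apply: contra_notP => nw /=; apply: liminf_pinftyE => a ac.
  (* Since [(1 - x)^2 c >= c - 2 x c], any [x] below this quotient keeps the bound above [a]. *)
  have q0 : 0 < (c - a) / (2 * c) by rewrite divr_gt0 ?mulr_gt0// subr_gt0.
  have [j] := @ltr_add_invr R _ _ q0; rewrite add0r ltr_pdivlMr ?mulr_gt0// => hj.
  have [M HM] : exists M : R, forall t, M < t ->
      lo j ^+ 2 * c <= Num.sqrt (ln (ln t) / t) * gstar W1 W2 A t w.
    by apply: contrapT => h; apply: nw; left; exists j.
  exists M => t /HM; apply: le_trans; rewrite /lo.
  have : j.+2%:R^-1 <= j.+1%:R^-1 :> R by rewrite lef_pV2 ?posrE// ler_nat.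
  move=> /(ler_wpM2r (ltW (mulr_gt0 (ltr0n R 2) c0))).
  have := mulr_ge0 (sqr_ge0 (j.+2%:R^-1 : R)) (ltW c0).
  move: hj; set x := j.+2%:R^-1; set y := j.+1%:R^-1; rewrite !expr2; lra.
(* With [up j = 1 + x] the bound equals [c + x (c + 1)]. *)
have q0 : 0 < (a - c) / (c + 1) by rewrite divr_gt0 ?subr_gt0// addr_gt0.
have [j] := @ltr_add_invr R _ _ q0; rewrite add0r ltr_pdivlMr ?addr_gt0// => hj M.
have /(_ M)[t Mt ht] : forall M : R, exists2 t, M < t &
    Num.sqrt (ln (ln t) / t) * gstar W1 W2 A t w <= up j * c + (up j - 1).
  by apply: contrapT => h; apply: nw; right; exists j.
by exists t => //; apply: le_trans ht _; rewrite /up; move: hj; set x := j.+1%:R^-1; lra.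
Qed.
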